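(* Let $(S_n)_{n\ge 0}$ be the minimal random walk with parameters $p,q,s\in[0,1]$, and let $a=p-q$. Assume $a=1/2$ (critical regime). Then we have the almost sure convergence $$\lim_{n\to\infty}\frac{S_n}{n}=2q\qquad\text{a.s.}$$ In addition, we have the law of iterated logarithm $$\limsup_{n\to\infty}\Big(\frac{n}{2\log n\,\log\log\log n}\Big)^{1/2}\Big(\frac{S_n}{n}-2q\Big)=-\liminf_{n\to\infty}\Big(\frac{n}{2\log n\,\log\log\log n}\Big)^{1/2}\Big(\frac{S_n}{n}-2q\Big)=\sqrt{4q(1-p)}\qquad\text{a.s.}$$ In particular, $$\limsup_{n\to\infty}\Big(\frac{n}{2\log n\,\log\log\log n}\Big)\Big(\frac{S_n}{n}-2q\Big)^2=4q(1-p)\qquad\text{a.s.}$$ Moreover, we have the quadratic strong law $$\lim_{n\to\infty}\frac{1}{\log\log n}\sum_{k=2}^n\Big(\frac{1}{\log k}\Big)^2\Big(\frac{S_k}{k}-2q\Big)^2=4q(1-p)\qquad\text{a.s.}$$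
   Context: Minimal random walk (MRW) with parameters $p,q,s\in[0,1]$: $S_0=0$, $S_1=X_1$ where $X_1$ has the Bernoulli distribution with success probability $s$. For every $n\ge1$, $$X_{n+1}=\alpha_{n+1}X_{U_n}+\beta_{n+1}(1-X_{U_n}),\qquad S_{n+1}=S_n+X_{n+1},$$ where $\alpha_{n+1}\sim$ Bernoulli$(p)$, $\beta_{n+1}\sim$ Bernoulli$(q)$, $U_n$ is uniform on $\{1,\dots,n\}$, and $\alpha_{n+1},\beta_{n+1},U_n$ are mutually independent and independent of $(X_1,\dots,X_n)$. *)

(* Defs.v *)
From HB Require Import structures.
From mathcomp Require Import all_boot all_order all_algebra.
From mathcomp Require Import all_classical all_reals all_analysis.

Set Implicit Arguments.
Unset Strict Implicit.
Unset Printing Implicit Defensive.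

Import Order.TTheory GRing.Theory Num.Theory.
Import numFieldNormedType.Exports.

Local Open Scope classical_set_scope.
Local Open Scope ring_scope.

Definition sigma_join (T I : Type) (D : set I) (F : I -> set_system T) :
    set_system T :=
  <<s \bigcup_(i in D) F i >>.

Definition mutually_independent d (T : measurableType d) (R : realType)
    (P : probability T R) (I : finType) (F : I -> set_system T) : Prop :=
  forall (J : {set I}) (E : I -> set T),
    (forall i, i \in J -> F i (E i)) ->
    P (\bigcap_(i in [set i | i \in J]) E i) = (\prod_(i in J) P (E i))%E.

Definition independent_systems d (T : measurableType d) (R : realType)
    (P : probability T R) (F G : set_system T) : Prop :=
  forall A B, F A -> G B -> P (A `&` B) = (P A * P B)%E.

(* The library's [bernoulli_prob] lives on [bool]; for a real random variable
   it is transported along [false |-> 0], [true |-> 1]. *)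
Definition has_bernoulli_law d (T : measurableType d) (R : realType)
    (P : probability T R) (p : R) (Y : {RV P >-> R}) : Prop :=
  forall A : set R, measurable A ->
    distribution P Y A = bernoulli_prob p [set b : bool | A (b%:R)].

Definition has_uniform_law_upto d (T : measurableType d) (R : realType)
    (P : probability T R) (n : nat) (V : {RV P >-> nat}) : Prop :=
  forall k : nat, (1 <= k <= n)%N ->
    distribution P V [set k] = (n%:R^-1)%:E.

Definition innovation_systems d (T : measurableType d) (R : realType)
    (P : probability T R) (alpha beta : nat -> {RV P >-> R})
    (U : nat -> {RV P >-> nat}) (n : nat) : 'I_3 -> set_system T :=
  tnth [tuple g_sigma_algebra_preimage (alpha n.+1);
              g_sigma_algebra_preimage (beta n.+1);
              g_sigma_algebra_preimage (U n)].

(* Only [X n], [alpha n.+1], [beta n.+1] and [U n] with [1 <= n] are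
   constrained; the other indices are padding. *)
Record minimal_random_walk d (T : measurableType d) (R : realType)
    (P : probability T R) (p q s : R)
    (alpha beta X : nat -> {RV P >-> R}) (U : nat -> {RV P >-> nat})
    (S : nat -> T -> R) : Prop := MinimalRandomWalk {
  mrw_X1_law : has_bernoulli_law s (X 1%N);
  mrw_alpha_law : forall n, (1 <= n)%N -> has_bernoulli_law p (alpha n.+1);
  mrw_beta_law : forall n, (1 <= n)%N -> has_bernoulli_law q (beta n.+1);
  mrw_U_law : forall n, (1 <= n)%N -> has_uniform_law_upto n (U n);
  mrw_innovation_indep : forall n, (1 <= n)%N ->
    mutually_independent P
      (innovation_systems alpha beta U n);
  mrw_past_indep : forall n, (1 <= n)%N ->
    independent_systems P
      (sigma_join setT (innovation_systems alpha beta U n))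
      (sigma_join [set i | (1 <= i <= n)%N] (fun i => g_sigma_algebra_preimage (X i)));
  mrw_X_rec : forall n, (1 <= n)%N -> forall t,
    X n.+1 t = alpha n.+1 t * X (U n t) t
             + beta n.+1 t * (1 - X (U n t) t);
  mrw_S0 : forall t, S 0%N t = 0;
  mrw_S1 : forall t, S 1%N t = X 1%N t;
  mrw_S_rec : forall n, (1 <= n)%N -> forall t,
    S n.+1 t = S n t + X n.+1 t
}.

(* [ln] is 0 on nonpositive reals and [x / 0 = 0], so this is a finite
   arbitrary value for the finitely many n with log log log n <= 0. *)
Definition lil_rate (R : realType) (n : nat) : R :=
  n%:R / (2 * ln n%:R * ln (ln (ln n%:R))).

(* Main.v *)
(** Write v = 2q(1-2q) = 4q(1-p). Given the past, X_{n+1} is Bernoulli with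
    parameter q + S_n/(2n), so M_n = a_n (S_n - 2qn), with a_n the product over
    i < n of (1 + 1/(2i))^-1, is a martingale. Since n a_n^2 decreases to a
    constant c > 0, its bracket is equivalent to c v log n. As the law of
    (X_1, ..., X_n) is a product of one-step kernels, its expectations are
    finite iterated sums over words.

    Law of the iterated logarithm: comparing the conditional moment generating
    function of the increments of M with the Gaussian one of variance given by
    the bracket yields, through a maximal inequality, the upper tail; evaluating
    it at l, l(1-d) and l(1+d) yields the matching lower tail, conditionally on
    any past at which M is not abnormally large. The two bounds follow from the
    two Borel-Cantelli lemmas along the times exp(theta^j). The law of large
    numbers is a consequence of the upper bound.

    Quadratic strong law: telescoping M_k^2 / log k expresses
    sum M_k^2 (1/log k - 1/log (k+1)) as c v log log n plus a martingale whose
    second moment is O(log log n). Chebyshev's inequality along times n_i with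
    log log n_i = i^2, together with monotonicity in n of the sum, gives its
    almost sure equivalence to c v log log n. *)

Require Import Defs.
From HB Require Import structures.
From mathcomp Require Import all_boot all_order all_algebra.
From mathcomp Require Import all_classical all_reals all_analysis.
From mathcomp Require Import ring lra.

Set Implicit Arguments.
Unset Strict Implicit.
Unset Printing Implicit Defensive.

Import Order.TTheory GRing.Theory Num.Theory.
Import numFieldNormedType.Exports.

Local Open Scope classical_set_scope.
Local Open Scope ring_scope.

(** * Moment generating functions of Bernoulli variables *)

(** The obstacle is that the conditional variance of an increment is not v: it differs from it by at
    most |S_n - 2qn|/(2n), so the error of the Gaussian comparison carries a factor |M_n| and must
    itself be integrated under the exponential tilt. A crude a priori bound pays for it: for |l| <=
    1/4 the moment generating function grows at most like n^(1/4), while one step's error has weight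
    a_n/n, of order n^(-3/2); the products are summable, with tails of order n^(-1/4). Hence
    [growth_bound], [damping] and the condition [good], under which the comparison has relative
    error 30 |l| over any future length.

    Blocks are not independent, so the second Borel-Cantelli lemma is the conditional one: from
    every good past, block j succeeds with probability at least 1/(j+1). Bad pasts are declared
    successes; almost surely they no longer occur from some time on, by the upper bound with
    constant 1 > v.

    The clock of M is log n, whence the times exp(theta^j). Theta is close to 1 for the upper bound,
    and large for the lower one, so that the position at the start of a block is negligible against
    the gain made in it. The degenerate case v = 0 is handled apart, from the upper bound. *)

Section exponential_estimates.
Context {R : realType}.
Implicit Types y m l v : R.

(** As (n+3)! >= 2^(n+1), the terms of degree at least 3 are dominated by |y|^3 times a geometric
    series; the factor 1 - 2^(-n) is its partial sum and lets the induction close. *)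
Lemma series_exp_coeff_le y n : `|y| <= 1 ->
  `|series (exp_coeff y) n.+3 - (1 + y + y ^+ 2 / 2)| <=
  `|y| ^+ 3 * (1 - 2^-1 ^+ n).
Proof.
move=> y1; elim: n => [|n IH].
  rewrite /series/= /exp_coeff/= !big_nat_recr//= big_nil !factS fact0.
  rewrite (_ : _ - _ = 0); last by field.
  by rewrite normr0 expr0 subrr mulr0.
rewrite /series/= big_nat_recr//= addrAC.
rewrite (le_trans (ler_normD _ _))// (le_trans (lerD IH (lexx _)))//.
have fct : (2 ^ n.+1 <= n.+3`!)%N.
  elim: n {IH} => [//|n IHn]; rewrite factS expnS leq_mul//.
rewrite /exp_coeff/= normrM normrX.
have -> : `|(n.+3`!%:R^-1 : R)| = n.+3`!%:R^-1.
  by rewrite ger0_norm// invr_ge0 ler0n.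
have h : (n.+3`!%:R^-1 : R) <= 2^-1 ^+ n.+1.
  rewrite exprVn lef_pV2 ?posrE ?exprn_gt0// ?ltr0n ?fact_gt0//.
  by rewrite -natrX ler_nat.
have h3 : `|y| ^+ n.+3 <= `|y| ^+ 3.
  by rewrite -(addn3 n) exprD ler_piMl ?exprn_ge0// exprn_ile1.
have : `|y| ^+ n.+3 / n.+3`!%:R <= `|y| ^+ 3 * 2^-1 ^+ n.+1.
  by rewrite ler_pM ?exprn_ge0// invr_ge0 ler0n.
have -> : 2^-1 ^+ n = 2 * 2^-1 ^+ n.+1 :> R by rewrite exprS mulrA mulfV// mul1r.
lra.
Qed.

Lemma expR_taylor2 y : `|y| <= 1 ->
  `|expR y - (1 + y + y ^+ 2 / 2)| <= `|y| ^+ 3.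
Proof.
move=> y1.
have h n : `|series (exp_coeff y) n.+3 - (1 + y + y ^+ 2 / 2)| <= `|y| ^+ 3.
  apply: (le_trans (series_exp_coeff_le n y1)).
  have : 0 <= (2^-1 : R) ^+ n by rewrite exprn_ge0.
  have : 0 <= `|y| ^+ 3 by rewrite exprn_ge0.
  nra.
have c := is_cvg_series_exp_coeff y.
rewrite ler_norml lerBrDr lerBlDr; apply/andP; split.
- apply: limr_ge => //; near=> n.
  have -> : n = (n - 3).+3 by rewrite -addn3 subnK//; near: n; exact: nbhs_infty_ge.
  by have := h (n - 3)%N; rewrite ler_norml lerBrDr => /andP[].
- apply: limr_le => //; near=> n.
  have -> : n = (n - 3).+3 by rewrite -addn3 subnK//; near: n; exact: nbhs_infty_ge.
  by have := h (n - 3)%N; rewrite ler_norml lerBlDr => /andP[].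
Unshelve. all: by end_near. Qed.

Lemma mgf_bernoulli_taylor m l : 0 <= m <= 1 -> `|l| <= 1 ->
  `|m * expR (l * (1 - m)) + (1 - m) * expR (l * (0 - m))
    - (1 + l ^+ 2 * (m * (1 - m)) / 2)| <= `|l| ^+ 3.
Proof.
move=> /andP[m0 m1] l1.
have b (c : R) : `|c| <= 1 -> `|expR (l * c) - (1 + l * c + (l * c) ^+ 2 / 2)| <= `|l| ^+ 3.
  move=> c1; rewrite (le_trans (expR_taylor2 _))//.
    by rewrite normrM mulr_ile1.
  by rewrite normrM exprMn ler_piMr ?exprn_ge0// exprn_ile1.
have /b : `|1 - m| <= 1 by rewrite ler_norml; lra.
have /b : `|0 - m| <= 1 by rewrite ler_norml; lra.
rewrite !ler_norml; nra.
Qed.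

(** The Gaussian variance v is free: the last summand is the discrepancy of the second-order terms.
    The bound v <= 1/4 keeps the Gaussian exponent in the range of [expR_taylor2]. *)
Lemma mgf_bernoulli_gauss m l v : 0 <= m <= 1 -> 0 <= v <= 4^-1 -> `|l| <= 1 ->
  `|m * expR (l * (1 - m)) + (1 - m) * expR (l * (0 - m)) - expR (l ^+ 2 * v / 2)|
  <= 2 * `|l| ^+ 3 + l ^+ 2 * `|m * (1 - m) - v| / 2.
Proof.
move=> m01 v01 l1; have := mgf_bernoulli_taylor m01 l1.
set u := l ^+ 2 * v / 2.
have l2 : l ^+ 2 = `|l| ^+ 2 by rewrite real_normK ?num_real.
have l0 := normr_ge0 l.
have u0 : 0 <= u <= `|l| ^+ 2 / 8 by rewrite /u l2; nra.
have u1 : `|u| <= 1 by rewrite ger0_norm; nra.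
have := expR_taylor2 u1; rewrite (ger0_norm (_ : 0 <= u)); last by lra.
set E := expR u; move=> hE; set F := (X in `|X - _| <= _) => hF.
have hE2 : `|E - (1 + u)| <= `|l| ^+ 3.
  clearbody u E.
  move: hE; rewrite !ler_norml => hE.
  have := sqr_ge0 u; have : 0 <= u ^+ 2 / 2 + u ^+ 3 <= `|l| ^+ 3; last by lra.
  have u2 : u ^+ 2 <= (`|l| ^+ 2 / 8) ^+ 2 by rewrite lerXn2r ?nnegrE; lra.
  have u3 : u ^+ 3 <= u ^+ 2 by rewrite ler_wiXn2l//; have := le_trans (ler_norm u) u1; lra.
  have : 0 <= u ^+ 2 by exact: sqr_ge0.
  have : 0 <= u ^+ 3 by rewrite exprn_ge0; lra.
  have : (`|l| ^+ 2 / 8) ^+ 2 <= `|l| ^+ 3 / 8; last by lra.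
  have -> : (`|l| ^+ 2 / 8) ^+ 2 = `|l| ^+ 3 * `|l| / 64 by field.
  have : 0 <= `|l| ^+ 3 by rewrite exprn_ge0.
  nra.
have hd : `|l ^+ 2 * (m * (1 - m)) / 2 - u| <= l ^+ 2 * `|m * (1 - m) - v| / 2.
  rewrite /u (_ : _ - _ = l ^+ 2 * (m * (1 - m) - v) / 2); last by field.
  by rewrite normrM (normrM (l ^+ 2)) (ger0_norm (sqr_ge0 l)) [`|2^-1|]ger0_norm.
have -> : F - E = (F - (1 + l ^+ 2 * (m * (1 - m)) / 2)) - (E - (1 + u))
   + (l ^+ 2 * (m * (1 - m)) / 2 - u) by field.
have := ler_normD ((F - (1 + l ^+ 2 * (m * (1 - m)) / 2)) - (E - (1 + u))) (l ^+ 2 * (m * (1 - m)) / 2 - u).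
have := ler_normB (F - (1 + l ^+ 2 * (m * (1 - m)) / 2)) (E - (1 + u)).
lra.
Qed.

Lemma mgf_bernoulli_crude m l : 0 <= m <= 1 -> `|l| <= 1 ->
  m * expR (l * (1 - m)) + (1 - m) * expR (l * (0 - m)) <= 1 + 2 * l ^+ 2.
Proof.
move=> m01 l1; have := mgf_bernoulli_taylor m01 l1.
rewrite ler_norml => /andP[_].
have l2 : l ^+ 2 = `|l| ^+ 2 by rewrite real_normK ?num_real.
have l0 := normr_ge0 l.
have : `|l| ^+ 3 <= `|l| ^+ 2 by rewrite ler_wiXn2l.
rewrite l2; nra.
Qed.

End exponential_estimates.

(** * Normalizing sequences *)

Section normalizing_sequences.
Context {R : realType}.
Implicit Types k n : nat.

(* The factor with k = 0 is 1, because 1 / 0 = 0. *)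
Fixpoint mart_scale n : R :=
  if n is k.+1 then mart_scale k / (1 + (2 * k%:R)^-1) else 1.

Fixpoint growth_bound n : R :=
  if n is k.+1 then growth_bound k * (1 + (4 * k%:R)^-1) else 1.

Local Notation a := mart_scale.
Local Notation g := growth_bound.

Definition scale_sq n : R := a n ^+ 2 * n%:R.
(** The constant c of the overview, equal to pi/4 by the Wallis product. *)
Definition scale_lim : R := limn (fun n => scale_sq n.+1).
(** Deterministic substitute for the bracket of M, without the factor v: the step from time i to i+1
    is scaled by a_(i+1). *)
Definition qvar n : R := \sum_(1 <= i < n) a i.+1 ^+ 2.

Lemma natr_ge1 n : (0 < n)%N -> 1 <= n%:R :> R.
Proof. by rewrite ler1n. Qed.

Lemma mart_scale_factor_gt0 k (c : R) : 0 <= c -> 0 < 1 + (c * k%:R)^-1.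
Proof. by move=> c0; rewrite ltr_wpDr// invr_ge0 mulr_ge0. Qed.

Lemma mart_scale_gt0 n : 0 < a n.
Proof. by elim: n => //= n IH; rewrite divr_gt0// mart_scale_factor_gt0. Qed.

Lemma mart_scaleS k : a k.+1 * (1 + (2 * k%:R)^-1) = a k.
Proof. by rewrite /= mulfVK// gt_eqF// mart_scale_factor_gt0. Qed.

Lemma mart_scale_le k : a k.+1 <= a k.
Proof.
rewrite -[leRHS]mart_scaleS ler_peMr ?(ltW (mart_scale_gt0 _))//.
by rewrite lerDl invr_ge0 mulr_ge0.
Qed.

Lemma mart_scale1 : a 1 = 1.
Proof. by rewrite /= mulr0 invr0 addr0 divr1. Qed.

Lemma growth_bound_ge1 n : 1 <= g n.
Proof.
elim: n => //= n IH; have := mart_scale_factor_gt0 n (ler0n R 4).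
have : 0 <= (4 * n%:R)^-1 :> R by rewrite invr_ge0 mulr_ge0.
nra.
Qed.

Lemma scale_sqS k : (0 < k)%N ->
  scale_sq k.+1 = scale_sq k * (4 * k%:R * (k%:R + 1) / (2 * k%:R + 1) ^+ 2).
Proof.
move=> /natr_ge1 k1; rewrite /scale_sq -(mart_scaleS k) -(@natr1 _ k).
set b := a k.+1; field; lra.
Qed.

Lemma scale_sq_gt0 k : (0 < k)%N -> 0 < scale_sq k.
Proof. by move=> k0; rewrite mulr_gt0 ?exprn_gt0 ?mart_scale_gt0 ?ltr0n. Qed.

Lemma scale_sq_nonincreasing : nonincreasing_seq (fun n => scale_sq n.+1).
Proof.
apply/nonincreasing_seqP => n; rewrite scale_sqS//.
have := scale_sq_gt0 (ltn0Sn n); have := natr_ge1 (ltn0Sn n).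
move: (n.+1%:R) => x x1 s0; rewrite ler_piMr ?(ltW s0)// ler_pdivrMr; nra.
Qed.

(** The correction n/(n+1) reverses the monotonicity without changing the limit, which encloses
    [scale_sq n] between c and c (1 + 1/n). *)
Lemma scale_sq_nondecreasing :
  nondecreasing_seq (fun n => scale_sq n.+1 * (n.+1%:R / (n.+1%:R + 1))).
Proof.
apply/nondecreasing_seqP => n; rewrite (@scale_sqS n.+1)// -(@natr1 _ n.+1).
have := scale_sq_gt0 (ltn0Sn n); have := natr_ge1 (ltn0Sn n).
move: (n.+1%:R) => x x1 s0; rewrite -mulrA ler_wpM2l ?(ltW s0)//.
rewrite mulf_div ler_pdivlMr; last by nra.
rewrite mulrAC ler_pdivrMr; last by lra.
by nra.
Qed.

Lemma cvg_scale_sq : (fun n => scale_sq n.+1) @ \oo --> scale_lim.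
Proof.
apply: nonincreasing_is_cvgn; first exact: scale_sq_nonincreasing.
by exists 0 => _ [n _ <-]; rewrite ltW// scale_sq_gt0.
Qed.

Lemma scale_lim_le k : (0 < k)%N -> scale_lim <= scale_sq k.
Proof.
case: k => // k _; apply: nonincreasing_cvgn_ge; first exact: scale_sq_nonincreasing.
by apply/cvg_ex; exists scale_lim; exact: cvg_scale_sq.
Qed.

Lemma scale_sq_le k : (0 < k)%N -> scale_sq k * (k%:R / (k%:R + 1)) <= scale_lim.
Proof.
case: k => // k _.
have c : (fun n => scale_sq n.+1 * (n.+1%:R / (n.+1%:R + 1))) @ \oo --> scale_lim.
  rewrite -[scale_lim]mulr1; apply: cvgM; first exact: cvg_scale_sq.
  have -> : (fun n : nat => n.+1%:R / (n.+1%:R + 1) : R) =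
    (fun n => 1 - harmonic n.+1).
    apply/funext => n; rewrite /harmonic/= -(@natr1 _ n.+1).
    have := natr_ge1 (ltn0Sn n); move: (n.+1%:R) => x x1; field; lra.
  rewrite -[X in _ --> X]subr0; apply: cvgB; first exact: cvg_cst.
  by have := @cvg_harmonic R; rewrite -(cvg_shiftn 1); under eq_fun do rewrite addn1.
have := nondecreasing_cvgn_le scale_sq_nondecreasing (cvgP _ c) k.
by rewrite (cvg_lim _ c).
Qed.

Lemma scale_lim_ge : 2^-1 <= scale_lim.
Proof.
apply: le_trans (scale_sq_le (ltn0Sn 0)).
by rewrite /scale_sq mart_scale1 expr1n !mul1r.
Qed.

Lemma scale_sq_le1 k : scale_sq k <= 1.
Proof.
case: k => [|k]; first by rewrite /scale_sq mulr0.
have := scale_sq_nonincreasing (leq0n k).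
by rewrite /scale_sq mart_scale1 expr1n mul1r.
Qed.

Lemma scale_lim_le1 : scale_lim <= 1.
Proof. exact: le_trans (scale_lim_le (ltn0Sn 0)) (scale_sq_le1 _). Qed.

Lemma ln_succ_le k : (0 < k)%N -> ln k.+1%:R - ln k%:R <= k%:R^-1 :> R.
Proof.
move=> k0; have := natr_ge1 k0; rewrite -(@natr1 _ k) => k1.
rewrite -ln_div ?posrE; [|lra|lra].
rewrite (_ : _ / _ = 1 + k%:R^-1); last by field; lra.
by rewrite le_ln1Dx// (lt_le_trans (_ : _ < 0))// invr_ge0; lra.
Qed.

Lemma ln_succ_ge k : (0 < k)%N -> k.+1%:R^-1 <= ln k.+1%:R - ln k%:R :> R.
Proof.
move=> k0; have := natr_ge1 k0; rewrite -(@natr1 _ k) => k1.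
rewrite -lerN2 opprB -ln_div ?posrE; [|lra|lra].
rewrite (_ : _ / _ = 1 + - (k%:R + 1)^-1); last by field; lra.
rewrite le_ln1Dx// ltrN2 invf_lt1; lra.
Qed.

Lemma mart_scale_sq k : (0 < k)%N -> a k ^+ 2 = scale_sq k / k%:R.
Proof. by move=> k0; rewrite /scale_sq mulfK// pnatr_eq0 -lt0n. Qed.

Lemma qvarS k : (0 < k)%N -> qvar k.+1 = qvar k + a k.+1 ^+ 2.
Proof. by move=> k0; rewrite /qvar big_nat_recr. Qed.

(** The terms 1/k are there for the induction: their differences 1/k - 1/(k+1) absorb both the error
    in a_(k+1)^2 and the gap between the increments of ln and 1/(k+1). *)
Lemma qvar_bounds k : (0 < k)%N ->
  scale_lim * (ln k%:R - 1 + k%:R^-1) <= qvar k <=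
  scale_lim * (ln k%:R + 1 - k%:R^-1).
Proof.
have c0 := scale_lim_ge.
elim: k => // -[_ _|k /(_ erefl) IH _].
  by rewrite /qvar big_geq// ln1 invr1; lra.
rewrite qvarS// mart_scale_sq//.
have h1 := ln_succ_ge (ltn0Sn k); have h2 := ln_succ_le (ltn0Sn k).
have h3 := scale_lim_le (ltn0Sn k.+1); have h4 := scale_sq_le (ltn0Sn k.+1).
move: h1 h2 h3 h4 IH; move: (ln k.+2%:R) (ln k.+1%:R) => l' l.
rewrite -(@natr1 _ k.+1); have := natr_ge1 (ltn0Sn k).
move: (k.+1%:R) (scale_sq k.+2) (qvar k.+1) => x A Q x1 h1 h2 h3 h4 /andP[IH1 IH2].
have x0 : 0 < x + 1 by lra.
have {}h3 : scale_lim / (x + 1) <= A / (x + 1) by rewrite ler_pM2r ?invr_gt0.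
have {}h4 : A / (x + 1) <= scale_lim * ((x + 1)^-1 + (x^-1 - (x + 1)^-1)).
  have : A / (x + 1) <= scale_lim * ((x + 2) / (x + 1) ^+ 2).
    rewrite (_ : A / (x + 1) = (A * ((x + 1) / (x + 1 + 1))) * ((x + 2) / (x + 1) ^+ 2)); last by field; lra.
    by rewrite ler_wpM2r// divr_ge0 ?sqr_ge0//; lra.
  move=> h; apply: le_trans h _; rewrite ler_wpM2l//; first by lra.
  rewrite (addrC (_^-1)) subrK ler_pdivrMr ?exprn_gt0// mulrC ler_pdivlMr; nra.
have e : 0 <= scale_lim by lra.
have f1 := ler_wpM2l e h1; have f2 := ler_wpM2l e h2.
apply/andP; split; nra.
Qed.

Lemma qvar_le k : (0 < k)%N -> qvar k <= scale_lim * (ln k%:R + 1).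
Proof.
move=> k0; have /andP[_ /le_trans] := qvar_bounds k0; apply.
rewrite ler_wpM2l//; first by have := scale_lim_ge; lra.
by rewrite lerBlDr lerDl invr_ge0.
Qed.

Lemma qvar_ge k : (0 < k)%N -> scale_lim * (ln k%:R - 1) <= qvar k.
Proof.
move=> k0; have /andP[+ _] := qvar_bounds k0; apply: le_trans.
rewrite ler_wpM2l//; first by have := scale_lim_ge; lra.
by rewrite lerDl invr_ge0.
Qed.

Lemma qvar_mono m n : (m <= n)%N -> qvar m <= qvar n.
Proof.
move=> mn; have [n0|n1] := leqP n 1.
  by rewrite /qvar !big_geq// (leq_trans mn).
have [m0|m1] := leqP m 1.
  by rewrite {1}/qvar big_geq// sumr_ge0// => i _; exact: sqr_ge0.
rewrite /qvar (@big_cat_nat _ _ _ m 1 n)//=; last exact: ltnW.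
by rewrite lerDl sumr_ge0// => i _; exact: sqr_ge0.
Qed.

(* Of order n^(-1/4), since a n is of order n^(-1/2) and g n of order n^(1/4). *)
Definition damping n : R := g n * a n.

Lemma damping_gt0 n : 0 < damping n.
Proof. by rewrite mulr_gt0 ?mart_scale_gt0 ?(lt_le_trans ltr01 (growth_bound_ge1 _)). Qed.

Lemma dampingB k : (0 < k)%N -> damping k - damping k.+1 = damping k / (4 * k%:R + 2).
Proof.
move=> /natr_ge1 k1; rewrite /damping /=.
by have := mart_scale_gt0 k; move=> ?; field; lra.
Qed.

(** Both sides are of order k^(-5/4). This turns the sum of one-step errors into a telescoping one;
    the constant 6 comes from 4k + 2 <= 6k. *)
Lemma damping_telescope k : (0 < k)%N ->
  a k / k%:R * g k <= 6 * (damping k - damping k.+1).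
Proof.
move=> k0; rewrite dampingB//; have := damping_gt0 k; have := natr_ge1 k0.
rewrite /damping (mulrC (g k)) => k1; rewrite [leLHS]mulrAC; move: (a k * g k) => u u0.
rewrite ler_pdivrMr; last by lra.
rewrite !mulrA mulrAC ler_pdivlMr; nra.
Qed.

(** The exponent 1/6 instead of the true 1/4 again comes from 4k + 2 <= 6k; any negative power of n
    suffices to beat powers of log n. *)
Lemma damping_le k : (0 < k)%N -> damping k <= expR (- (ln k%:R / 6)).
Proof.
elim: k => // -[_ _|k /(_ erefl) IH _].
  by rewrite ln1 mul0r oppr0 expR0 /damping mart_scale1/= mulr0 invr0; lra.
have h := dampingB (ltn0Sn k); have l := ln_succ_le (ltn0Sn k).
have -> : damping k.+2 = damping k.+1 * (1 - (4 * k.+1%:R + 2)^-1).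
  by rewrite mulrBr mulr1 -h; lra.
have k1 := natr_ge1 (ltn0Sn k).
have h1 : 1 - (4 * k.+1%:R + 2)^-1 <= expR (- (k.+1%:R^-1 / 6)) :> R.
  apply: le_trans (expR_ge1Dx _); rewrite lerD2l lerN2.
  rewrite -invfM lef_pV2 ?posrE; lra.
apply: le_trans (_ : expR (- (ln k.+1%:R / 6)) * expR (- (k.+1%:R^-1 / 6)) <= _).
  apply: ler_pM => //; first by rewrite ltW// damping_gt0.
  by rewrite subr_ge0 invf_le1; lra.
rewrite -expRD ler_expR; move: l; move: (ln k.+2%:R) (ln k.+1%:R) (k.+1%:R^-1) => u v w; lra.
Qed.

End normalizing_sequences.

(** * The walk on finite words *)

Section walk_on_words.
Context {R : realType} (q s : R).
Hypotheses (q_half : 0 <= q <= 2^-1) (s_prob : 0 <= s <= 1).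
Implicit Types (x y z : seq bool) (f h : seq bool -> R) (n k : nat) (l c : R).

(* A word lists X_n, ..., X_1, latest first; with k ones among n values the next
   success has probability p k/n + q (1 - k/n) = q + k/(2n), as p - q = 1/2. *)
Definition succ_prob x : R :=
  if x is [::] then s else q + (count id x)%:R / (2 * (size x)%:R).

Definition step f x : R :=
  succ_prob x * f (true :: x) + (1 - succ_prob x) * f (false :: x).

Definition expect n f x : R := iter n step f x.

Lemma succ_prob_itv x : 0 <= succ_prob x <= 1.
Proof.
case: x => [//|b x]; rewrite /succ_prob; move: (b :: x) (ltn0Sn (size x) : (0 < size (b :: x))%N) => y y0.
have : 0 <= (count id y)%:R / (2 * (size y)%:R) :> R by rewrite divr_ge0 ?mulr_ge0.
have : (count id y)%:R / (2 * (size y)%:R) <= 2^-1 :> R.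
  rewrite invfM mulrCA ler_piMr ?invr_ge0//.
  by rewrite ler_pdivrMr ?ltr0n// mul1r ler_nat count_size.
have gen (u : R) : u <= 2^-1 -> 0 <= u -> 0 <= q + u <= 1 by have := q_half; lra.
exact: gen.
Qed.

Lemma expectS n f x : expect n.+1 f x = expect n (step f) x.
Proof. by rewrite /expect iterSr. Qed.

Lemma expect_add m n f x : expect (m + n) f x = expect m (expect n f) x.
Proof. by rewrite /expect iterD. Qed.

(** The comparison is asked only on words that extend x by n letters, so that later bounds may use
    the length of the word and its past. *)
Lemma expect_le n f h x :
  (forall z, size z = (n + size x)%N -> drop n z = x -> f z <= h z) ->
  expect n f x <= expect n h x.
Proof.
elim: n x => [|n IH] x fh; first by apply: fh; rewrite ?drop0.
have e b : expect n f (b :: x) <= expect n h (b :: x).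
  apply: IH => z sz dz; apply: fh; first by rewrite sz addnS.
  by rewrite -add1n -drop_drop dz /= drop0.
rewrite /expect !iterS /step -!/(expect _ _ _).
have /andP[p0 p1] := succ_prob_itv x.
by rewrite lerD// ler_wpM2l ?e// subr_ge0.
Qed.

Lemma expectZ n c f x : expect n (fun z => c * f z) x = c * expect n f x.
Proof.
elim: n f => [//|n IH] f; rewrite !expectS -IH; congr (expect _ _ _).
by apply/funext => z; rewrite /step; ring.
Qed.

Lemma expectD n f h x :
  expect n (fun z => f z + h z) x = expect n f x + expect n h x.
Proof.
elim: n f h => [//|n IH] f h; rewrite !expectS -IH; congr (expect _ _ _).
by apply/funext => z; rewrite /step; ring.
Qed.

Lemma expect_cst n c x : expect n (fun=> c) x = c.
Proof.
elim: n => [//|n IH]; rewrite expectS -[RHS]IH; congr (expect _ _ _).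
by apply/funext => z; rewrite /step; ring.
Qed.

Lemma expect_ge0 n f x : (forall z, 0 <= f z) -> 0 <= expect n f x.
Proof. by move=> f0; rewrite -(expect_cst n 0 x) expect_le. Qed.

Lemma expect_norm_le n f h x :
  (forall z, size z = (n + size x)%N -> `|f z| <= h z) ->
  `|expect n f x| <= expect n h x.
Proof.
move=> fh; rewrite ler_norml; apply/andP; split.
  rewrite -mulN1r -expectZ expect_le// => z sz _.
  by have := fh z sz; rewrite ler_norml mulN1r => /andP[].
by rewrite expect_le// => z sz _; have := fh z sz; rewrite ler_norml => /andP[].
Qed.

Local Notation a := (@mart_scale R).

Definition mrw_var : R := 2 * q * (1 - 2 * q).
Definition centered x : R := (count id x)%:R - 2 * q * (size x)%:R.
Definition mart x : R := a (size x) * centered x.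

Lemma martE x : mart x = a (size x) * centered x. Proof. by []. Qed.

Lemma mrw_var_itv : 0 <= mrw_var <= 4^-1.
Proof.
rewrite /mrw_var; have := sqr_ge0 (2 * q - 2^-1); rewrite expr2.
have /andP[h0 h] := q_half; have : 0 <= q * (1 - 2 * q) by rewrite mulr_ge0//; lra.
lra.
Qed.

Lemma succ_probE x : (0 < size x)%N ->
  succ_prob x = 2 * q + centered x / (2 * (size x)%:R).
Proof.
case: x => // b x /(@natr_ge1 R) x1; rewrite /succ_prob /centered.
by move: x1; move: (size (b :: x))%:R (count id (b :: x))%:R => u v u1; field; lra.
Qed.

(** The success probability exceeds 2q by [centered x] / (2n); the factor 1 + 1/(2n) relating a_n to
    a_(n+1) cancels exactly this drift. *)
Lemma mart_cons b x : (0 < size x)%N ->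
  mart (b :: x) = mart x + a (size x).+1 * (b%:R - succ_prob x).
Proof.
move=> x0; rewrite succ_probE// /mart -(mart_scaleS (size x)) -mulrA -mulrDr.
congr (_ * _); rewrite /centered.
have -> : count id (b :: x) = (b + count id x)%N by [].
have -> : size (b :: x) = (size x).+1 by [].
rewrite natrD -(@natr1 _ (size x)); have := @natr_ge1 R _ x0; move=> ?; field; lra.
Qed.

Lemma step_mart_cons x (g : R -> R) : (0 < size x)%N ->
  step (fun z => g (mart z)) x =
  succ_prob x * g (mart x + a (size x).+1 * (1 - succ_prob x)) +
  (1 - succ_prob x) * g (mart x + a (size x).+1 * (0 - succ_prob x)).
Proof. by move=> x0; rewrite /step !mart_cons. Qed.

Definition mgf_weight x l z : R := expR (l * (mart z - mart x)).

Definition cond_mgf l y : R :=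
  succ_prob y * expR (l * a (size y).+1 * (1 - succ_prob y)) +
  (1 - succ_prob y) * expR (l * a (size y).+1 * (0 - succ_prob y)).

Lemma step_mgf_weight x l y : (0 < size y)%N ->
  step (mgf_weight x l) y = mgf_weight x l y * cond_mgf l y.
Proof.
move=> y0; rewrite /mgf_weight (step_mart_cons (fun u => expR (l * (u - mart x))))//.
rewrite /cond_mgf; set A := a _; set p := succ_prob y; set M := mart y - mart x.
have e (c : R) : expR (l * (mart y + A * c - mart x)) = expR (l * M) * expR (l * A * c).
  by rewrite -expRD; congr expR; rewrite /M; ring.
by rewrite !e; ring.
Qed.

Lemma mart_scale_le1 k : a k <= 1.
Proof. by elim: k => [//|k]; apply: le_trans; exact: mart_scale_le. Qed.

Lemma mart_scale_sq_le k : (0 < k)%N -> a k.+1 ^+ 2 <= k%:R^-1.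
Proof.
move=> k0; rewrite mart_scale_sq//.
apply: le_trans (_ : k.+1%:R^-1 <= _).
  by rewrite ler_piMl ?invr_ge0// scale_sq_le1.
by rewrite lef_pV2 ?posrE ?ltr0n// ler_nat.
Qed.

Lemma norm_mul_scale_le l k : `|l| <= 1 -> `|l * a k| <= 1.
Proof.
move=> l1; rewrite normrM (ger0_norm (ltW (mart_scale_gt0 k))).
by rewrite mulr_ile1// ?(ltW (mart_scale_gt0 k))// mart_scale_le1.
Qed.

(** A step costs at most 1 + 2 l^2 a_(k+1)^2 <= 1 + 1/(8k) when |l| <= 1/4. The bound is uniform in
    the past, as is needed to integrate the errors of the sharper comparison. *)
Lemma expect_mgf_weight_crude n x l : (0 < size x)%N -> `|l| <= 4^-1 ->
  expect n (mgf_weight x l) x <= growth_bound (n + size x).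
Proof.
move=> x0 l1; elim: n => [|n IH].
  by rewrite /expect/= /mgf_weight subrr mulr0 expR0 growth_bound_ge1.
rewrite expectS addSn /= mulrC.
apply: le_trans (_ : (1 + (4 * (n + size x)%:R)^-1) * expect n (mgf_weight x l) x <= _); last first.
  by rewrite (ler_wpM2l _ IH)// ltW// mart_scale_factor_gt0.
rewrite -expectZ expect_le// => z sz _.
have z0 : (0 < size z)%N by rewrite sz addn_gt0 x0 orbT.
rewrite step_mgf_weight// mulrC ler_wpM2r ?expR_ge0// -sz.
have l11 : `|l| <= 1 by lra.
apply: le_trans (mgf_bernoulli_crude (succ_prob_itv z) (norm_mul_scale_le _ l11)) _.
rewrite lerD2l exprMn invfM.
have := mart_scale_sq_le z0; have := sqr_ge0 (a (size z).+1).
have l2 : l ^+ 2 <= 16^-1.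
  rewrite -(real_normK (num_real l)) (_ : 16^-1 = 4^-1 ^+ 2); last by field.
  by rewrite lerXn2r ?nnegrE.
have := sqr_ge0 l; move: ((size z)%:R^-1) => B; move: (a _ ^+ 2) (l ^+ 2) l2 => A L; nra.
Qed.

(** With r the success probability, r(1-r) - 2q(1-2q) = (r-2q)(1-r-2q), and the second factor is at
    most 1 in absolute value. *)
Lemma cond_var_le z : (0 < size z)%N ->
  `|succ_prob z * (1 - succ_prob z) - mrw_var| <= `|centered z| / (2 * (size z)%:R).
Proof.
move=> z0; have /(@natr_ge1 R) z1 := z0; have := succ_prob_itv z.
have -> : `|centered z| / (2 * (size z)%:R) = `|centered z / (2 * (size z)%:R)|.
  by rewrite normf_div (ger0_norm (_ : 0 <= 2 * (size z)%:R)).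
have -> : centered z / (2 * (size z)%:R) = succ_prob z - 2 * q.
  by rewrite succ_probE//; ring.
move: (succ_prob z) => p p01.
have -> : p * (1 - p) - mrw_var = (p - 2 * q) * (1 - p - 2 * q).
  by rewrite /mrw_var; ring.
rewrite normrM ler_piMr// ler_norml; have /andP[] := q_half; lra.
Qed.

(** The cubic Taylor error and the variance discrepancy share the prefactor a_k/k, because a_(k+1)^2
    <= 1/k, a_(k+1) <= a_k and a_k |[centered z]| = |[mart z]|. *)
Lemma cond_mgf_error l z : (0 < size z)%N -> `|l| <= 1 ->
  `|cond_mgf l z - expR (l ^+ 2 * (a (size z).+1 ^+ 2 * mrw_var) / 2)| <=
  a (size z) / (size z)%:R * `|l| * (2 * `|l| + `|l| * `|mart z| / 4).
Proof.
move=> z0 l1.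
have := mgf_bernoulli_gauss (succ_prob_itv z) mrw_var_itv (norm_mul_scale_le (size z).+1 l1).
rewrite -/(cond_mgf l z) normrM (ger0_norm (ltW (mart_scale_gt0 _))).
set A := a (size z).+1; set B := a (size z).
have k1 := @natr_ge1 R _ z0.
have A0 : 0 < A := mart_scale_gt0 _; have AB : A <= B := mart_scale_le _.
have A2 : A ^+ 2 <= (size z)%:R^-1 := mart_scale_sq_le z0.
have A3 : A ^+ 3 <= B / (size z)%:R.
  by rewrite exprS ler_pM// ?sqr_ge0// ltW.
have cv := cond_var_le z0.
have vb : A ^+ 2 * `|succ_prob z * (1 - succ_prob z) - mrw_var| <=
    B / (size z)%:R * (`|mart z| / 2).
  apply: le_trans (_ : B ^+ 2 * (`|centered z| / (2 * (size z)%:R)) <= _).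
    by rewrite ler_pM ?sqr_ge0//; rewrite lerXn2r ?nnegrE; lra.
  rewrite /mart normrM (ger0_norm (ltW (mart_scale_gt0 _))) -/B.
  by rewrite le_eqVlt; apply/orP; left; apply/eqP; field; lra.
have l0 := normr_ge0 l; have l2 : l ^+ 2 = `|l| ^+ 2 by rewrite real_normK ?num_real.
have -> : l ^+ 2 * (A ^+ 2 * mrw_var) / 2 = (l * A) ^+ 2 * mrw_var / 2 by ring.
have -> : (l * A) ^+ 2 = (`|l| * A) ^+ 2 by transitivity (l ^+ 2 * A ^+ 2); [ring|rewrite l2; ring].
move/le_trans; apply.
have gen (L C V K Z : R) : 0 <= L -> L <= 1 -> 0 <= C -> C ^+ 3 <= K ->
    C ^+ 2 * V <= K * (Z / 2) ->
    2 * (L * C) ^+ 3 + (L * C) ^+ 2 * V / 2 <= K * L * (2 * L + L * Z / 4).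
  move=> L0 L1 C0 h1 h2; have := ler_wpM2l (sqr_ge0 L) h2.
  have := ler_wpM2l (sqr_ge0 L) h1.
  have : L ^+ 3 * C ^+ 3 <= L ^+ 2 * C ^+ 3.
    by rewrite ler_wpM2r ?exprn_ge0// ler_wiXn2l.
  by rewrite !exprMn; lra.
exact: gen (ltW A0) A3 vb.
Qed.

(** The factor |[mart z]| of the error is traded for a doubled parameter, by |u| e^u <= e^(2u) +
    1. *)
Lemma mgf_weight_tilt x l z :
  `|l| * `|mart z| * mgf_weight x l z <=
  `|l| * `|mart x| * mgf_weight x l z + mgf_weight x (2 * l) z + 1.
Proof.
have t : `|mart z| <= `|mart x| + `|mart z - mart x|.
  by have := ler_normD (mart x) (mart z - mart x); rewrite (addrC (mart x)) subrK.
have w0 : 0 < mgf_weight x l z by exact: expR_gt0.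
have e : `|l| * `|mart z - mart x| * mgf_weight x l z <= mgf_weight x (2 * l) z + 1.
  rewrite -normrM /mgf_weight -(mulrA 2); set u := l * _.
  have -> : 2 * u = u + u by ring.
  rewrite expRD; have [u0|u0] := leP 0 u.
    by rewrite ger0_norm//; have := expR_ge1Dx u; have := expR_gt0 u; nra.
  rewrite ltr0_norm//; have := expR_ge1Dx (- u); have := expR_gt0 u.
  by have := expRxMexpNx_1 u; nra.
have h := ler_wpM2r (ltW w0) (ler_wpM2l (normr_ge0 l) t).
by move: h; rewrite mulrDr mulrDl; lra.
Qed.

Lemma mgf_step_error x l z : (0 < size z)%N -> `|l| <= 1 ->
  `|step (mgf_weight x l) z
     - expR (l ^+ 2 * (a (size z).+1 ^+ 2 * mrw_var) / 2) * mgf_weight x l z| <=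
  a (size z) / (size z)%:R * `|l| *
    ((2 + `|mart x|) * mgf_weight x l z + mgf_weight x (2 * l) z + 1).
Proof.
move=> z0 l1; rewrite step_mgf_weight// [in X in _ - X]mulrC -mulrBr normrM.
have w0 : 0 < mgf_weight x l z by exact: expR_gt0.
have := cond_mgf_error z0 l1; have := mgf_weight_tilt x l z.
have w20 : 0 < mgf_weight x (2 * l) z by exact: expR_gt0.
rewrite (ger0_norm (ltW w0)); move: (mgf_weight x l z) (mgf_weight x (2 * l) z) w0 w20 => w w2 w0 w20.
have : 0 <= a (size z) / (size z)%:R * `|l|.
  by rewrite !mulr_ge0 ?invr_ge0// ltW// mart_scale_gt0.
move: (_ / _ * `|l|) => K K0 h1; move: `|_ - expR _| => D h2.
have h3 := ler_wpM2l (ltW w0) h2; apply: le_trans h3 _.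
rewrite mulrCA ler_wpM2l//.
have := normr_ge0 l; have := normr_ge0 (mart x).
have gen (L X Z : R) : L <= 1 -> L * Z * w <= L * X * w + w2 + 1 -> 0 <= X ->
  0 <= L -> w * (2 * L + L * Z / 4) <= (2 + X) * w + w2 + 1.
  move=> L1 h X0 L0; have := ler_wpM2r (ltW w0) L1.
  have := ler_wpM2r (mulr_ge0 X0 (ltW w0)) L1.
  have := mulr_ge0 X0 (ltW w0); lra.
exact: gen.
Qed.

(* The pasts for which the error terms of the comparison with the Gaussian moment
   generating function, once summed by [damping_telescope], stay bounded. *)
Definition good x := `|mart x| * damping (size x) <= 1.

(** Inverse of the Gaussian moment generating function with the variance gained between times m and
    n. *)
Definition gauss_factor l m n : R :=
  expR (- (l ^+ 2 * (mrw_var * (qvar n - qvar m)) / 2)).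

Lemma gauss_factor_le1 l m n : (m <= n)%N -> gauss_factor l m n <= 1.
Proof.
move=> mn; rewrite expR_le1 oppr_le0 divr_ge0// mulr_ge0 ?sqr_ge0//.
by have /andP[v0 _] := mrw_var_itv; rewrite mulr_ge0// subr_ge0 qvar_mono.
Qed.

Lemma gauss_factorS l m n : (0 < n)%N -> gauss_factor l m n =
  gauss_factor l m n.+1 * expR (l ^+ 2 * (a n.+1 ^+ 2 * mrw_var) / 2).
Proof. by move=> n0; rewrite -expRD qvarS//; congr expR; field. Qed.

Lemma damping_le1 k : (0 < k)%N -> damping k <= 1 :> R.
Proof.
move=> k0; apply: le_trans (damping_le k0) _.
by rewrite expR_le1 oppr_le0 divr_ge0// ln_ge0// natr_ge1.
Qed.

(** Multiplied by [gauss_factor], the expected weight would be constant in the Gaussian case; here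
    each step moves it by at most an increment of [damping]. The condition |l| <= 1/8 makes the
    crude bound available at both l and 2l. *)
Lemma expect_mgf_weight_telescope x l n : (0 < size x)%N -> `|l| <= 8^-1 ->
  `|expect n (mgf_weight x l) x * gauss_factor l (size x) (n + size x) - 1| <=
  6 * `|l| * (4 + `|mart x|) * (damping (size x) - damping (n + size x)).
Proof.
move=> x0 l8; have l1 : `|l| <= 1 by lra.
elim: n => [|n IH].
  rewrite /expect/= /gauss_factor add0n !subrr !mulr0 mul0r oppr0 expR0 mulr1.
  by rewrite /mgf_weight subrr mulr0 expR0 subrr normr0.
set k := (n + size x)%N; have k0 : (0 < k)%N by rewrite addn_gt0 x0 orbT.
rewrite addSn -/k; set G := gauss_factor l (size x) k.+1.
set c := expR (l ^+ 2 * (a k.+1 ^+ 2 * mrw_var) / 2).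
have GE : gauss_factor l (size x) k = G * c by exact: gauss_factorS.
have err : `|expect n.+1 (mgf_weight x l) x - c * expect n (mgf_weight x l) x| <=
    6 * `|l| * (4 + `|mart x|) * (damping k - damping k.+1).
  rewrite expectS -expectZ -mulN1r -expectZ -expectD.
  apply: le_trans (_ : expect n (fun z => a k / k%:R * `|l| *
    ((2 + `|mart x|) * mgf_weight x l z + mgf_weight x (2 * l) z + 1)) x <= _).
    apply: expect_norm_le => z sz; rewrite mulN1r; have := @mgf_step_error x l z; rewrite sz -/k; exact.
  rewrite expectZ !expectD expect_cst expectZ.
  have h1 : expect n (mgf_weight x l) x <= growth_bound k.
    by apply: expect_mgf_weight_crude => //; lra.
  have h2 : expect n (mgf_weight x (2 * l)) x <= growth_bound k.
    by apply: expect_mgf_weight_crude => //; rewrite normrM (ger0_norm (_ : 0 <= 2))//; lra.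
  have h3 := @damping_telescope R k k0; have h4 := @growth_bound_ge1 R k.
  have h5 : 0 <= a k / k%:R by rewrite divr_ge0// ltW// mart_scale_gt0.
  set e1 := expect n _ x in h1 *; set e2 := expect n _ x in h2 *.
  set g := growth_bound k in h1 h2 h3 h4 *; set K := a k / k%:R in h3 h5 *.
  apply: le_trans (_ : K * `|l| * ((4 + `|mart x|) * g) <= _).
    rewrite ler_wpM2l//; first by rewrite mulr_ge0.
    have gen (X : R) : 0 <= X -> (2 + X) * e1 + e2 + 1 <= (4 + X) * g by nra.
    exact: gen.
  have -> : K * `|l| * ((4 + `|mart x|) * g) = `|l| * (4 + `|mart x|) * (K * g) by ring.
  have -> : 6 * `|l| * (4 + `|mart x|) * (damping k - damping k.+1) =
    `|l| * (4 + `|mart x|) * (6 * (damping k - damping k.+1)) by ring.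
  by rewrite ler_wpM2l// mulr_ge0// addr_ge0.
have G1 : G <= 1 by apply: gauss_factor_le1; rewrite /k -addSn leq_addl.
have G0 : 0 < G by exact: expR_gt0.
have -> : expect n.+1 (mgf_weight x l) x * G - 1 =
   (expect n.+1 (mgf_weight x l) x - c * expect n (mgf_weight x l) x) * G +
   (expect n (mgf_weight x l) x * gauss_factor l (size x) k - 1).
  by rewrite GE; ring.
apply: le_trans (ler_normD _ _) _; rewrite normrM (ger0_norm (ltW G0)).
have e1 : `|expect n.+1 (mgf_weight x l) x - c * expect n (mgf_weight x l) x| * G <=
  6 * `|l| * (4 + `|mart x|) * (damping k - damping k.+1).
  by apply: le_trans err; rewrite ler_piMr.
apply: le_trans (lerD e1 IH) _.
by rewrite -mulrDr -/k [X in _ * X](_ : _ = damping (size x) - damping k.+1)//; ring.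
Qed.

(** On a good past (4 + |M|) times the drop of [damping] is at most 4 + 1, hence 30 = 6 * 5. *)
Lemma expect_mgf_weight x l n : (0 < size x)%N -> good x -> `|l| <= 8^-1 ->
  `|expect n (mgf_weight x l) x * gauss_factor l (size x) (n + size x) - 1| <=
  30 * `|l|.
Proof.
move=> x0 gx l8; apply: le_trans (expect_mgf_weight_telescope n x0 l8) _.
have := damping_le1 x0; have := @damping_gt0 R (n + size x).
have n0 := normr_ge0 (mart x); have l0 := normr_ge0 l.
have gen (m r r' : R) : 0 <= m -> m * r <= 1 -> 0 < r' -> r <= 1 -> (4 + m) * (r - r') <= 5.
  by nra.
move=> h1 h2; have := ler_wpM2l l0 (gen _ _ _ n0 gx h1 h2); lra.
Qed.

End walk_on_words.

(** * Tail estimates *)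

Section deviations.
Context {R : realType} (q s : R).
Hypotheses (q_half : 0 <= q <= 2^-1) (s_prob : 0 <= s <= 1).
Implicit Types (x y z : seq bool) (n k : nat) (l b sg : R).

Local Notation a := (@mart_scale R).
Local Notation expect := (expect q s).
Local Notation step := (step q s).
Local Notation mart := (mart q).
Local Notation succ_prob := (succ_prob q s).

(** Jensen's inequality for a centred step, through 1 + u <= e^u. It makes the exponential weight a
    submartingale. *)
Lemma cond_mgf_ge1 l y : 1 <= cond_mgf q s l y.
Proof.
rewrite /cond_mgf; have := succ_prob_itv q_half s_prob y.
set p := succ_prob y; set L := l * _ => /andP[p0 p1].
have h1 := ler_wpM2l p0 (expR_ge1Dx (L * (1 - p))).
have h2 : (1 - p) * (1 + L * (0 - p)) <= (1 - p) * expR (L * (0 - p)).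
  by rewrite ler_wpM2l ?subr_ge0// expR_ge1Dx.
apply: le_trans (lerD h1 h2); rewrite le_eqVlt; apply/orP; left; apply/eqP; ring.
Qed.

Lemma expect_mgf_weight_ge1 n x l : (0 < size x)%N ->
  1 <= expect n (mgf_weight q x l) x.
Proof.
move=> x0; elim: n => [|n IH]; first by rewrite /expect/= /mgf_weight subrr mulr0 expR0.
apply: le_trans IH _; rewrite expectS; apply: expect_le => // z sz _.
rewrite step_mgf_weight ?sz ?addn_gt0 ?x0 ?orbT//.
by rewrite ler_peMr ?expR_ge0// cond_mgf_ge1.
Qed.

(** A word contains its whole history, so the running maximum is read from the word itself; sg will
    be 1 or -1, one sign for each tail. *)
Fixpoint hits b sg x : bool :=
  (b <= sg * mart x) || (if x is _ :: x' then hits b sg x' else false).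

Lemma hits_drop b sg k x : hits b sg (drop k x) -> hits b sg x.
Proof.
elim: x k => [|c x IH] [|k]//= /IH h; by rewrite h orbT.
Qed.

Lemma expect_indicator_le1 n (A : pred (seq bool)) x :
  expect n (fun z => (A z)%:R) x <= 1.
Proof. by rewrite -[leRHS](expect_cst q s n 1 x) expect_le// => z _ _; rewrite lern1 leq_b1. Qed.

(** Doob's maximal inequality by induction on the remaining time. The hypothesis on [behead x] says
    that no crossing occurred strictly before the present. *)
Lemma expect_hits_le n b sg l x : (0 < size x)%N -> 0 <= l ->
  ~~ hits b sg (behead x) ->
  expect n (fun z => (hits b sg z)%:R) x <=
  expR (l * (sg * mart x - b)) * expect n (mgf_weight q x (l * sg)) x.
Proof.
move=> x0 l0; elim: n x x0 => [|n IH] x x0 nh.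
  rewrite /expect/= /mgf_weight subrr mulr0 expR0 mulr1.
  have [hx|hx] := boolP (hits b sg x); last exact: expR_ge0.
  move: hx nh; case: x x0 => [//|c x] _ /=.
  case/orP => [hx _|->//]; apply: le_trans (expR_ge1Dx _).
  by rewrite lerDl mulr_ge0// subr_ge0.
(* At the first crossing the left side is at most 1, while the exponential prefactor and the
   expected weight are both at least 1. *)
have [hx|hx] := leP b (sg * mart x).
  apply: le_trans (expect_indicator_le1 _ _ _) _.
  rewrite -[leLHS]mul1r ler_pM//; last exact: expect_mgf_weight_ge1.
  by apply: le_trans (expR_ge1Dx _); rewrite lerDl mulr_ge0// subr_ge0.
have nhx : ~~ hits b sg x.
  by move: nh hx; case: x {x0} => [|c x] /= nh hx; rewrite leNgt hx.
have h c : expect n (fun z => (hits b sg z)%:R) (c :: x) <=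
    expR (l * (sg * mart x - b)) * expect n (mgf_weight q x (l * sg)) (c :: x).
  apply: le_trans (IH (c :: x) isT nhx) _; rewrite -!expectZ.
  apply: expect_le => // z _ _; rewrite /mgf_weight -!expRD le_eqVlt; apply/orP; left.
  by apply/eqP; congr expR; ring.
rewrite /expect !iterS -!/(expect _ _) /step -!/(expect _ _ _).
have /andP[p0 p1] := succ_prob_itv q_half s_prob x.
have q0 : 0 <= 1 - succ_prob x by rewrite subr_ge0.
have h1 := ler_wpM2l p0 (h true); have h2 := ler_wpM2l q0 (h false).
rewrite mulrDr; apply: le_trans (lerD h1 h2) _.
by rewrite le_eqVlt; apply/orP; left; apply/eqP; rewrite /expect; ring.
Qed.

Lemma mart_singleton (b : bool) : `|mart [:: b]| <= 1.
Proof.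
rewrite /mart /centered mart_scale1 mul1r /= addn0 mulr1 ler_norml.
by have /andP[] := q_half; case: b => /=; lra.
Qed.

Lemma good_singleton (b : bool) : good q [:: b].
Proof.
rewrite /good mulr_ile1 ?mart_singleton//; first by rewrite ltW// damping_gt0.
exact: damping_le1.
Qed.

Lemma mart_nil : mart [::] = 0.
Proof. by rewrite /mart /centered /= mulr0 subrr mulr0. Qed.

Lemma qvar1 : qvar 1 = 0 :> R.
Proof. by rewrite /qvar big_geq. Qed.

(** The first letter has its own parameter s and the martingale starts only after it, so estimates
    from the empty word are reduced to bounds uniform in that letter. *)
Lemma expect_nil_le n f B : (forall c, expect n f [:: c] <= B) ->
  expect n.+1 f [::] <= B.
Proof.
move=> h; rewrite /expect iterS -/(expect _ _) /step -!/(expect _ _ _) /=.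
have := h true; have := h false; rewrite /expect.
move: (iter _ _ _ _) (iter _ _ _ _) => u v; have := s_prob; nra.
Qed.

(** The constant is 5 * 2: the relative error gives 1 + 30/8 <= 5, and the position after the first
    letter costs at most exp(1/8) <= 2. *)
Lemma upper_tail n b sg l : (0 < n)%N -> `|sg| = 1 -> 0 < b -> 0 <= l <= 8^-1 ->
  expect n (fun z => (hits b sg z)%:R) [::] <=
  10 * expR (l ^+ 2 * (mrw_var q * qvar n) / 2 - l * b).
Proof.
case: n => // n _ sg1 b0 /andP[l0 l8]; apply: expect_nil_le => c.
have nh : ~~ hits b sg [::] by rewrite /= orbF mart_nil mulr0 -ltNge.
apply: le_trans (@expect_hits_le n b sg l [:: c] isT l0 nh) _.
have lsg : `|l * sg| = l by rewrite normrM sg1 mulr1 ger0_norm.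
have lsg8 : `|l * sg| <= 8^-1 by rewrite lsg.
have := expect_mgf_weight q_half s_prob n (isT : 0 < size [:: c])%N (good_singleton c) lsg8.
rewrite lsg /= addn1 /gauss_factor qvar1 subr0.
have -> : (l * sg) ^+ 2 = l ^+ 2.
  by rewrite -[LHS](real_normK (num_real _)) lsg.
set W := l ^+ 2 * _ / 2; set E := expect _ _ _ => h.
have {}h : E <= 5 * expR W.
  move: h; rewrite ler_norml => /andP[_ h].
  have W0 := expR_gt0 W; rewrite -ler_pdivrMr// -expRN; lra.
rewrite mulrBr expRD.
have h2 : expR (l * (sg * mart [:: c])) <= 2.
  have : expR (l * (sg * mart [:: c])) <= expR 8^-1.
    rewrite ler_expR (le_trans (ler_norm _))// mulrA normrM lsg.
    by rewrite -[leRHS]mulr1 ler_pM// mart_singleton.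
  move/le_trans; apply; have : `|8^-1| <= 1 :> R by rewrite ger0_norm//; lra.
  move=> /expR_taylor2; rewrite ler_norml => /andP[_].
  rewrite ger0_norm//.
  by rewrite !exprS expr0; lra.
rewrite (expRD W) mulrA.
have e0 := expR_ge0 (l * (sg * mart [:: c])); have f0 := expR_gt0 (- (l * b)).
have E0 : 0 <= E by apply: expect_ge0 => // z; exact: expR_ge0.
have : expR (l * (sg * mart [:: c])) * E <= 2 * (5 * expR W) by rewrite ler_pM.
move=> h3; rewrite mulrAC; apply: le_trans (ler_wpM2r (ltW f0) h3) _.
by rewrite mulrA; lra.
Qed.

(** Let w = l^2 V / 2. The tilted mass at l is at least e^w / 2; the parts below (1-d) l V and above
    (1+d) l V are each at most (3/2) e^(w - d^2 w) <= e^w / 8. So at least e^w / 4 remains in the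
    window, where the weight is at most exp(2 (1+d) w); dividing gives the bound. *)
Lemma lower_tail n x (sg l d V : R) : (0 < size x)%N -> good q x -> `|sg| = 1 ->
  0 < d < 1 -> 0 <= l -> (1 + d) * l <= 60^-1 ->
  V = mrw_var q * (qvar (n + size x) - qvar (size x)) ->
  expR (- (d ^+ 2 * (l ^+ 2 * V / 2))) <= 12^-1 ->
  4^-1 * expR (- ((1 + 2 * d) * (l ^+ 2 * V / 2))) <=
  expect n (fun z => ((1 - d) * l * V <= sg * (mart z - mart x))%R%:R) x.
Proof.
move=> x0 gx sg1 /andP[d0 d1] l0 l60 VE hd.
pose F mu := expect n (mgf_weight q x (mu * sg)) x.
pose w := l ^+ 2 * V / 2.
(* For mu <= 1/60 the relative error 30 mu is at most 1/2, hence the factors 1/2 and 3/2. *)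
have Fb (mu : R) : 0 <= mu -> mu <= 60^-1 ->
   2^-1 * expR (mu ^+ 2 * V / 2) <= F mu <= 3 / 2 * expR (mu ^+ 2 * V / 2).
  move=> m0 m60.
  have msg : `|mu * sg| = mu by rewrite normrM sg1 mulr1 ger0_norm.
  have m8 : `|mu * sg| <= 8^-1 by rewrite msg; lra.
  have := expect_mgf_weight q_half s_prob n x0 gx m8.
  rewrite msg -/(F mu) /gauss_factor.
  have -> : (mu * sg) ^+ 2 = mu ^+ 2.
    by rewrite -[LHS](real_normK (num_real _)) msg.
  rewrite -VE expRN; set G := expR _; have G0 : 0 < G := expR_gt0 _.
  rewrite ler_norml => /andP[h1 h2].
  have [r rE] : exists r, r = F mu / G by exists (F mu / G).
  have FE : F mu = r * G by rewrite rE mulfVK// gt_eqF.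
  by rewrite FE !ler_pM2r//; rewrite -rE in h1 h2; lra.
have F0 := Fb l l0 ltac:(nra).
have F1 := Fb ((1 - d) * l) ltac:(nra) ltac:(nra).
have F2 := Fb ((1 + d) * l) ltac:(nra) ltac:(nra).
(* Pointwise domination of the weight at l: below the window by the tilt (1-d) l, above it by the
   tilt (1+d) l, inside it by its largest value. *)
have key : F l <= expR (d * (1 - d) * (2 * w)) * F ((1 - d) * l)
   + expR (- (d * (1 + d) * (2 * w))) * F ((1 + d) * l)
   + expR ((1 + d) * (2 * w)) * expect n (fun z => ((1 - d) * l * V <= sg * (mart z - mart x))%R%:R) x.
  rewrite /F -!expectZ -!expectD; apply: expect_le => // z _ _.
  rewrite /mgf_weight -!expRD.
  have e0 u := expR_ge0 u : 0 <= expR u.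
  have -> : 2 * w = l * (l * V) by rewrite /w; field.
  rewrite -!(mulrA _ sg); set Z := sg * _; set c := l * V.
  rewrite -(mulrA (1 - d)) -/c.
  have [hZ|hZ] := leP ((1 - d) * c) Z; last first.
    apply: le_trans (_ : expR (d * (1 - d) * (l * c) + (1 - d) * l * Z) <= _); last first.
      by rewrite mulr0 addr0 lerDl.
    by rewrite ler_expR; have := mulr_ge0 (ltW d0) l0; nra.
  have [hZ2|hZ2] := leP Z ((1 + d) * c).
    apply: le_trans (_ : expR ((1 + d) * (l * c)) <= _); last first.
      by rewrite mulr1 lerDr addr_ge0.
    by rewrite ler_expR; nra.
  apply: le_trans (_ : expR (- (d * (1 + d) * (l * c)) + (1 + d) * l * Z) <= _); last first.
    by rewrite mulr1 addrAC lerDr addr_ge0.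
  by rewrite ler_expR; have := mulr_ge0 (ltW d0) l0; nra.
have /andP[f0 _] := F0; have /andP[_ f1] := F1; have /andP[_ f2] := F2.
set Pr := expect _ _ _ in key *.
have g1 : expR (d * (1 - d) * (2 * w)) * F ((1 - d) * l) <= 3 / 2 * (expR w * expR (- (d ^+ 2 * w))).
  apply: le_trans (ler_wpM2l (expR_ge0 _) f1) _.
  rewrite mulrCA -!expRD; rewrite le_eqVlt; apply/orP; left; apply/eqP.
  by congr (_ * expR _); rewrite /w; field.
have g2 : expR (- (d * (1 + d) * (2 * w))) * F ((1 + d) * l) <= 3 / 2 * (expR w * expR (- (d ^+ 2 * w))).
  apply: le_trans (ler_wpM2l (expR_ge0 _) f2) _.
  rewrite mulrCA -!expRD; rewrite le_eqVlt; apply/orP; left; apply/eqP.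
  by congr (_ * expR _); rewrite /w; field.
have g3 : 4^-1 * expR w <= expR ((1 + d) * (2 * w)) * Pr.
  have := ler_wpM2l (expR_ge0 w) hd; rewrite -/w in f0 hd *; lra.
rewrite -/w (_ : - ((1 + 2 * d) * w) = w - (1 + d) * (2 * w)); last by ring.
by rewrite expRB (mulrA 4^-1) ler_pdivrMr ?expR_gt0// (mulrC Pr).
Qed.

Lemma step_mart_sq y : (0 < size y)%N ->
  step (fun z => mart z ^+ 2) y =
  mart y ^+ 2 + a (size y).+1 ^+ 2 * (succ_prob y * (1 - succ_prob y)).
Proof. by move=> y0; rewrite (step_mart_cons q s (fun u => u ^+ 2))//; ring. Qed.

Lemma cond_var_itv y : 0 <= succ_prob y * (1 - succ_prob y) <= 4^-1.
Proof.
have := succ_prob_itv q_half s_prob y; have := sqr_ge0 (succ_prob y - 2^-1).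
rewrite expr2; nra.
Qed.

Lemma expect_mart_sq n : (0 < n)%N ->
  expect n (fun z => mart z ^+ 2) [::] <= 1 + qvar n.
Proof.
case: n => // n _; apply: expect_nil_le => c.
elim: n => [|n IH].
  rewrite /expect/= qvar1 addr0 -real_normK ?num_real//.
  by rewrite exprn_ile1// mart_singleton.
rewrite expectS qvarS// addrA; apply: le_trans (lerD IH (lexx _)).
rewrite -(expect_cst q s n (a n.+2 ^+ 2) [:: c]) -expectD; apply: expect_le => // z /= sz _.
rewrite step_mart_sq ?sz ?addn1// lerD2l ler_piMr ?sqr_ge0//.
by have := cond_var_itv z; lra.
Qed.

(* The martingale part of the telescoped sum of M_k^2 / ln k; the factor
   1 / ln 1 = 0 makes the first step vanish. *)
Definition sq_increment y : R :=
  a (size y).+1 * (2 * mart y + a (size y).+1 * (1 - 2 * succ_prob y)).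

Fixpoint sq_noise x : R :=
  if x is b :: y then
    sq_noise y + (b%:R - succ_prob y) * sq_increment y / ln (size y).+1%:R
  else 0.

Lemma mart_sq_cons (b : bool) y : (0 < size y)%N ->
  mart (b :: y) ^+ 2 = mart y ^+ 2 +
    a (size y).+1 ^+ 2 * (succ_prob y * (1 - succ_prob y)) +
    (b%:R - succ_prob y) * sq_increment y.
Proof.
move=> y0; rewrite (mart_cons q s)// /sq_increment; by case: b; rewrite /= ?mulr1n ?mulr0n; ring.
Qed.

Lemma step_sq_noise y :
  step (fun z => sq_noise z ^+ 2) y = sq_noise y ^+ 2 +
    succ_prob y * (1 - succ_prob y) * sq_increment y ^+ 2 / ln (size y).+1%:R ^+ 2.
Proof. by rewrite /step /= -exprVn; ring. Qed.

Lemma ln2_ge : 2^-1 <= ln 2 :> R.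
Proof.
have := @ln_succ_ge R 1 isT; rewrite ln1 subr0; exact.
Qed.

Lemma ln_ge_half n : (2 <= n)%N -> 2^-1 <= ln n%:R :> R.
Proof.
move=> n2; apply: le_trans ln2_ge _; rewrite ler_ln ?posrE ?ltr0n ?ler_nat//.
exact: leq_trans n2.
Qed.

Lemma lnln_succ_ge k : (2 <= k)%N ->
  (k.+1%:R * ln k.+1%:R)^-1 <= ln (ln k.+1%:R) - ln (ln k%:R) :> R.
Proof.
move=> k2; have h1 := ln_ge_half k2; have h2 := ln_ge_half (leqW k2).
have h3 := @ln_succ_ge R k (ltnW k2).
set u := ln k%:R in h1 h3 *; set v := ln k.+1%:R in h2 h3 *.
rewrite -lerN2 opprB -ln_div ?posrE; [|lra|lra].
rewrite (_ : _ / _ = 1 + - ((v - u) / v)); last by field; lra.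
have v0 : 0 < v by lra.
apply: le_trans (le_ln1Dx _) _.
  by rewrite ltrN2 ltr_pdivrMr//; lra.
by rewrite lerN2 invfM ler_pM2r ?invr_gt0.
Qed.

(** Increments are orthogonal. Given the past, the one at time k+1 has second moment at most (2
    M_k^2 + 1/2) / ((k+1) ln^2 (k+1)), and the expectation of M_k^2 is at most ln (k+1) + 2; as ln
    (k+1) >= 1/2 the constants are absorbed into 22 / ((k+1) ln (k+1)), whose sum is of order log
    log n. *)
Lemma expect_sq_noise n : (2 <= n)%N ->
  expect n (fun z => sq_noise z ^+ 2) [::] <= 22 * (2 + ln (ln n%:R)).
Proof.
have inc k : (0 < k)%N -> expect k.+1 (fun z => sq_noise z ^+ 2) [::] <=
   expect k (fun z => sq_noise z ^+ 2) [::] + 22 / (k.+1%:R * ln k.+1%:R).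
  move=> k0; rewrite expectS.
  set L := ln k.+1%:R; have L0 : 2^-1 <= L by exact: ln_ge_half.
  apply: le_trans (_ : expect k (fun z => sq_noise z ^+ 2 +
     (2 * mart z ^+ 2 + 2^-1) * (k.+1%:R^-1 / L ^+ 2)) [::] <= _).
    apply: expect_le => // z; rewrite addn0 => sz _; rewrite step_sq_noise sz lerD2l -/L.
    rewrite [leRHS]mulrA ler_pM2r ?invr_gt0 ?exprn_gt0//; last by lra.
    have /andP[v0 v1] := cond_var_itv z.
    have A1 : a k.+1 ^+ 2 <= k.+1%:R^-1.
      by rewrite mart_scale_sq// ler_piMl ?invr_ge0// scale_sq_le1.
    have d1 : sq_increment z ^+ 2 <= a k.+1 ^+ 2 * (8 * mart z ^+ 2 + 2).
      rewrite /sq_increment sz exprMn ler_wpM2l ?sqr_ge0//.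
      have A0 := @mart_scale_gt0 R k.+1; have A2 := @mart_scale_le1 R k.+1.
      have p01 := succ_prob_itv q_half s_prob z.
      have : (a k.+1 * (1 - 2 * succ_prob z)) ^+ 2 <= 1.
        rewrite -(real_normK (num_real _)) exprn_ile1// normrM mulr_ile1//.
          by rewrite ger0_norm// ltW.
        by rewrite ler_norml; lra.
      have := sqr_ge0 (2 * mart z - a k.+1 * (1 - 2 * succ_prob z)).
      rewrite !expr2; lra.
    have d2 := ler_wpM2r (_ : 0 <= 8 * mart z ^+ 2 + 2) A1.
    apply: le_trans (_ : 4^-1 * (k.+1%:R^-1 * (8 * mart z ^+ 2 + 2)) <= _); last first.
      by rewrite le_eqVlt; apply/orP; left; apply/eqP; field; rewrite lt0r_neq0// ltr0n.
    rewrite ler_pM ?sqr_ge0//; apply: le_trans d1 _; apply: d2.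
    by have := sqr_ge0 (mart z); lra.
  rewrite expectD lerD2l.
  under [X in expect k X _]eq_fun do rewrite mulrC.
  rewrite expectZ expectD expect_cst expectZ.
  have h1 := expect_mart_sq k0; have h2 := @qvar_le R k k0.
  have h3 : ln k%:R <= L by rewrite ler_ln ?posrE ?ltr0n ?ler_nat.
  have lk0 : 0 <= ln k%:R :> R by rewrite ln_ge0// natr_ge1.
  have c1 := @scale_lim_le1 R; have c0 := @scale_lim_ge R.
  have h4 : qvar k <= L + 1 by apply: le_trans h2 _; nra.
  have -> : 22 / (k.+1%:R * L) = k.+1%:R^-1 / L ^+ 2 * (22 * L).
    by have k1 := ler0n R k; field; lra.
  rewrite ler_wpM2l//; first by rewrite divr_ge0 ?invr_ge0 ?sqr_ge0.
  lra.
elim: n => // n IH; rewrite ltnS leq_eqVlt => /predU1P[<-|n1].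
  apply: le_trans (inc 1%N isT) _.
  have -> : expect 1 (fun z => sq_noise z ^+ 2) [::] = 0.
    by rewrite /expect/= /step /= ln1 invr0 !mulr0 !addr0 expr0n/= !mulr0 addr0.
  have l2 := ln2_ge.
  have h : -1 <= ln (ln 2) :> R.
    rewrite -[leLHS]expRK ler_ln ?posrE ?expR_gt0//; last by lra.
    rewrite expRN; apply: le_trans l2; rewrite lef_pV2 ?posrE ?expR_gt0//.
    by apply: le_trans (expR_ge1Dx 1).
  have : 22 / (2 * ln 2) <= 22 :> R by rewrite ler_pdivrMr; lra.
  lra.
apply: le_trans (inc n (ltnW n1)) _.
have := lnln_succ_ge n1; have := IH n1.
set e := expect _ _ _; set u := ln (ln _); set v := ln (ln _); set w := _^-1; lra.
Qed.

(* The blocks are the intervals between consecutive times [tm j]. *)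
Fixpoint miss (E : nat -> pred (seq bool)) (tm : nat -> nat) J m z : bool :=
  if m is k.+1 then
    ~~ E (J + k)%N z && miss E tm J k (drop (tm (J + k).+1 - tm (J + k)) z)
  else true.

(** Conditioning at the start of each block multiplies the probability of no success by at most 1 -
    1/(j+1); this product telescopes to J/(J+m). *)
Lemma expect_miss (E : nat -> pred (seq bool)) (tm : nat -> nat) J m :
  (forall j, (tm j <= tm j.+1)%N) -> (0 < J)%N ->
  (forall j x, (J <= j)%N -> size x = tm j ->
    j.+1%:R^-1 <= expect (tm j.+1 - tm j) (fun z => (E j z)%:R) x) ->
  expect (tm (J + m)%N) (fun z => (miss E tm J m z)%:R) [::] <= J%:R / (J + m)%:R.
Proof.
move=> tmS J0 hE; elim: m => [|m IH].
  by rewrite addn0 divff ?pnatr_eq0 ?(gtn_eqF J0)// expect_indicator_le1.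
have Jm : 1 <= (J + m)%:R :> R by rewrite ler1n addn_gt0 J0.
rewrite addnS -(subnKC (tmS (J + m)%N)) expect_add.
set D := (_ - _)%N.
have h x : size x = tm (J + m)%N -> expect D (fun z => (miss E tm J m.+1 z)%:R) x <=
    (1 - (J + m).+1%:R^-1) * (miss E tm J m x)%:R.
  move=> sx; have := hE (J + m)%N x (leq_addr _ _) sx; rewrite -/D => hx.
  apply: le_trans (_ : expect D (fun z => (miss E tm J m x)%:R * (1 + -1 * (E (J + m)%N z)%:R)) x <= _).
    apply: expect_le => // z _ dz; rewrite /= -/D dz.
    by case: (E _ _); case: (miss _ _ _ _ _); rewrite /= ?mulr1 ?mul1r ?mulr0 ?mul0r ?addr0 ?subrr.
  by rewrite expectZ expectD expectZ expect_cst mulrC ler_wpM2r// mulN1r lerD2l lerN2.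
apply: le_trans (_ : expect (tm (J + m)%N) (fun x => (1 - (J + m).+1%:R^-1) * (miss E tm J m x)%:R) [::] <= _).
  by apply: expect_le => // z; rewrite addn0 => sz _; apply: h.
rewrite expectZ -(@natr1 _ (J + m)%N).
apply: le_trans (ler_wpM2l _ IH) _.
  by rewrite subr_ge0 invf_le1; lra.
by rewrite le_eqVlt; apply/orP; left; apply/eqP; field; lra.
Qed.

End deviations.

(** * From words to the probability space *)

Section probability_of_events.
Context (R : realType) (d : measure_display) (T : measurableType d) (P : probability T R).
Implicit Types A B E F : set T.

Definition pr E : R := fine (P E).

Lemma prE E : measurable E -> P E = (pr E)%:E.
Proof. by move=> mE; rewrite fineK// fin_num_measure. Qed.

Lemma pr_ge0 E : 0 <= pr E.
Proof. by rewrite fine_ge0// measure_ge0. Qed.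

Lemma le_pr E F : measurable E -> measurable F -> E `<=` F -> pr E <= pr F.
Proof.
move=> mE mF EF; rewrite -lee_fin -!prE//; apply: le_measure => //; exact/mem_set.
Qed.

Lemma pr_setT : pr setT = 1.
Proof. by rewrite /pr probability_setT. Qed.

Lemma pr_split B E : measurable B -> measurable E ->
  pr E = pr (E `&` B) + pr (E `&` ~` B).
Proof.
move=> mB mE; apply/EFin_inj; rewrite EFinD -!prE//; first last.
- exact: measurableI.
- by apply: measurableI => //; exact: measurableC.
rewrite -measureU//; first by rewrite -setIUr setUv setIT.
- exact: measurableI.
- by apply: measurableI => //; exact: measurableC.
- by rewrite setIACA setICr setI0.
Qed.

Lemma pr_setU E F : measurable E -> measurable F -> E `&` F = set0 ->
  pr (E `|` F) = pr E + pr F.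
Proof.
move=> mE mF EF; apply/EFin_inj; rewrite EFinD -!prE//; last exact: measurableU.
exact: measureU.
Qed.

Lemma pr_setC E : measurable E -> pr (~` E) = 1 - pr E.
Proof.
move=> mE; rewrite -pr_setT (pr_split mE measurableT) !setTI; ring.
Qed.

Lemma pr0_negligible E : measurable E -> pr E = 0 -> P.-negligible E.
Proof. by move=> mE E0; exists E; split => //; rewrite prE// E0. Qed.

Lemma negligible_pr0 E : measurable E -> P.-negligible E -> pr E = 0.
Proof. by move=> mE /(measure_negligible mE); rewrite /pr => ->. Qed.

Lemma ae_pr1 (Q : T -> Prop) : measurable [set t | Q t] -> pr [set t | Q t] = 1 ->
  {ae P, forall t, Q t}.
Proof.
move=> mQ Q1; have mC := measurableC mQ.
by apply: (pr0_negligible mC); rewrite pr_setC// Q1 subrr.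
Qed.

Lemma pr_ae_eq E F : measurable E -> measurable F ->
  {ae P, forall t, E t <-> F t} -> pr E = pr F.
Proof.
move=> mE mF EF.
have h (A B : set T) : measurable A -> measurable B ->
    {ae P, forall t, A t <-> B t} -> pr A = pr (A `&` B).
  move=> mA mB AB; rewrite (pr_split mB mA) [X in _ + X]negligible_pr0 ?addr0//.
    by apply: measurableI => //; exact: measurableC.
  apply: negligibleS AB => t /= [At nBt] ABt; exact/nBt/ABt.
rewrite (h _ _ mE mF EF) setIC -h//.
by apply: filterS EF => t; tauto.
Qed.

End probability_of_events.

(** * Law of the word formed by the first n steps *)

Section law_of_words.
Context (R : realType) (d : measure_display) (T : measurableType d)
    (P : probability T R) (p q s : R)
    (alpha beta X : nat -> {RV P >-> R}) (U : nat -> {RV P >-> nat})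
    (S : nat -> T -> R).
Hypotheses (hp : 0 <= p <= 1) (hq : 0 <= q <= 1) (hs : 0 <= s <= 1)
    (hS : minimal_random_walk p q s alpha beta X U S)
    (ha : p - q = 1 / 2).
Implicit Types (n k : nat) (w : seq bool).

Local Notation pr := (pr P).

Lemma mrw_q_half : 0 <= q <= 2^-1.
Proof. by move: hp hq ha; lra. Qed.

Lemma measurable_level (Y : {RV P >-> R}) (c : R) : measurable [set t | Y t = c].
Proof.
have := @measurable_funPT _ _ _ _ Y measurableT _ (measurable_set1 c).
by rewrite setTI.
Qed.

Lemma measurable_nat_level (V : {RV P >-> nat}) (c : nat) : measurable [set t | V t = c].
Proof.
have h : measurable [set c] by [].
by have := @measurable_funPT _ _ _ _ V measurableT _ h; rewrite setTI.
Qed.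

Lemma bernoulli_law1 (r : R) (Y : {RV P >-> R}) : 0 <= r <= 1 ->
  has_bernoulli_law r Y -> pr [set t | Y t = 1] = r.
Proof.
move=> r01 /(_ [set 1] (measurable_set1 1)); rewrite /pr.
rewrite /distribution /pushforward => E.
have -> : [set t | Y t = 1] = Y @^-1` [set 1] by [].
rewrite E /bernoulli_prob r01.
have -> : [set b : bool | [set (1:R)] (b%:R : R)] = [set true].
  by apply/seteqP; split => -[]//= /eqP; rewrite eq_sym oner_eq0.
by rewrite fsbig_set1.
Qed.

Lemma bernoulli_law0 (r : R) (Y : {RV P >-> R}) : 0 <= r <= 1 ->
  has_bernoulli_law r Y -> pr [set t | Y t = 0] = 1 - r.
Proof.
move=> r01 /(_ [set 0] (measurable_set1 0)); rewrite /pr.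
rewrite /distribution /pushforward => E.
have -> : [set t | Y t = 0] = Y @^-1` [set 0] by [].
rewrite E /bernoulli_prob r01.
have -> : [set b : bool | [set (0:R)] (b%:R : R)] = [set false].
  by apply/seteqP; split => -[]//= /eqP; rewrite oner_eq0.
by rewrite fsbig_set1.
Qed.

Lemma bernoulli_law_ae (r : R) (Y : {RV P >-> R}) : 0 <= r <= 1 ->
  has_bernoulli_law r Y -> {ae P, forall t, Y t = 1 \/ Y t = 0}.
Proof.
move=> r01 hY; apply: ae_pr1.
  exact: (measurableU _ _ (measurable_level Y 1) (measurable_level Y 0)).
have -> : [set t | Y t = 1 \/ Y t = 0] = [set t | Y t = 1] `|` [set t | Y t = 0] by [].
rewrite pr_setU ?(bernoulli_law1 r01 hY) ?(bernoulli_law0 r01 hY)//.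
- by ring.
- exact: measurable_level.
- exact: measurable_level.
- by apply/seteqP; split => t //= [-> /eqP]; rewrite oner_eq0.
Qed.

Lemma uniform_law n k : (1 <= k <= n)%N -> pr [set t | U n t = k] = n%:R^-1.
Proof.
move=> kn; have n0 : (1 <= n)%N by case/andP: kn; exact: leq_trans.
by rewrite /pr -/((U n) @^-1` [set k]) [P _](mrw_U_law hS n0 kn).
Qed.

Lemma measurable_uniform_le n k : measurable [set t | (1 <= U n t <= k)%N].
Proof.
have h : measurable [set i : nat | (1 <= i <= k)%N] by [].
by have := @measurable_funPT _ _ _ _ (U n) measurableT _ h; rewrite setTI.
Qed.

Lemma uniform_law_le n k : (k <= n)%N ->
  pr [set t | (1 <= U n t <= k)%N] = k%:R / n%:R.
Proof.
elim: k => [_|k IH kn].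
  rewrite mul0r; have -> : [set t | (1 <= U n t <= 0)%N] = set0.
    by apply/seteqP; split => t //=; case: (U n t).
  by rewrite /pr measure0.
have -> : [set t | (1 <= U n t <= k.+1)%N] =
    [set t | (1 <= U n t <= k)%N] `|` [set t | U n t = k.+1].
  apply/seteqP; split => t /=.
    by case/andP => -> ; rewrite leq_eqVlt => /predU1P[->|]; [right|left].
  by case=> [/andP[-> /leqW]|->]//; rewrite leqnn.
rewrite pr_setU ?IH ?uniform_law ?(ltnW kn) ?kn//.
- by rewrite -(@natr1 _ k) mulrDl mul1r.
- exact: measurable_uniform_le.
- exact: measurable_nat_level.
- by apply/seteqP; split => t //= [+ E]; rewrite E ltnn andbF.
Qed.

Lemma uniform_law_ae n : (1 <= n)%N -> {ae P, forall t, (1 <= U n t <= n)%N}.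
Proof.
move=> n0; apply: ae_pr1; first exact: measurable_uniform_le.
by rewrite uniform_law_le// divff// pnatr_eq0 -lt0n.
Qed.

(** Strong induction: X_(n+1) is built from X at the random earlier time U_n, which lies in 1..n
    only almost surely. *)
Lemma steps_binary_ae : {ae P, forall t, forall n, (1 <= n)%N -> X n t = 1 \/ X n t = 0}.
Proof.
have h1 := bernoulli_law_ae hs (mrw_X1_law hS).
have h2 : {ae P, forall t, forall n, (1 <= n)%N ->
    [/\ alpha n.+1 t = 1 \/ alpha n.+1 t = 0, beta n.+1 t = 1 \/ beta n.+1 t = 0 &
        (1 <= U n t <= n)%N]}.
  apply: ae_foralln => -[|n]; first exact: aeW.
  have A := bernoulli_law_ae hp (mrw_alpha_law hS (ltn0Sn n)).
  have B := bernoulli_law_ae hq (mrw_beta_law hS (ltn0Sn n)).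
  have C := uniform_law_ae (ltn0Sn n).
  by apply: filterS3 A B C => t a b c _; split.
apply: filterS2 h1 h2 => t X1 h n; elim/ltn_ind: n => -[//|[//|n]] IH _.
rewrite (mrw_X_rec hS)//; have [a b /andP[u1 u2]] := h n.+1 isT.
have := IH (U n.+1 t) u2 u1 => -[] ->.
  by rewrite subrr mulr0 addr0 mulr1.
by rewrite mulr0 subr0 mulr1 add0r.
Qed.

(** The test X = 1 is made at every point, so events about words are measurable without an
    exceptional set, although X takes the value 0 otherwise only almost surely. *)
Fixpoint word n t : seq bool :=
  if n is k.+1 then (X k.+1 t == 1) :: word k t else [::].

Lemma size_word n t : size (word n t) = n.
Proof. by elim: n => //= n ->. Qed.

Lemma drop_word n k t : drop k (word (k + n) t) = word n t.
Proof. by elim: k => [|k IH]; rewrite ?drop0. Qed.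

(** Stated for any class closed under complement and union in order to serve twice: for the
    measurable sets and for the past of the walk. *)
Lemma word_event_in (H : set_system T) n : H set0 ->
  (forall A, H A -> H (~` A)) -> (forall A B, H A -> H B -> H (A `|` B)) ->
  (forall i, (1 <= i <= n)%N -> H [set t | X i t = 1]) ->
  forall A : pred (seq bool), H [set t | A (word n t)].
Proof.
move=> H0 HC HU; elim: n => [|n IH] HX A.
  have [A0|A0] := boolP (A [::]).
    rewrite (_ : [set t | _] = ~` set0); first exact: HC.
    by rewrite setC0; apply/seteqP; split => t //= _.
  rewrite (_ : [set t | _] = set0)//.
  by apply/seteqP; split => t //=; rewrite (negbTE A0).
have HI B C : H B -> H C -> H (B `&` C).
  by move=> hB hC; rewrite -[B `&` C]setCK setCI; apply/HC/HU; exact: HC.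
have {}IH : forall B : pred (seq bool), H [set t | B (word n t)].
  by apply: IH => i /andP[i1 i2]; apply: HX; rewrite i1 leqW.
have hX : H [set t | X n.+1 t = 1] by apply: HX; rewrite leqnn.
rewrite (_ : [set t | _] =
  ([set t | X n.+1 t = 1] `&` [set t | A (true :: word n t)]) `|`
  (~` [set t | X n.+1 t = 1] `&` [set t | A (false :: word n t)])).
  apply: HU; apply: HI => //; [|exact: HC|].
  - exact: (IH (fun w => A (true :: w))).
  - exact: (IH (fun w => A (false :: w))).
apply/seteqP; split => t /=.
  by case: eqP => [->|]; [left|right].
by case=> -[]; [move=> ->; rewrite eqxx|move=> /eqP/negbTE ->].
Qed.

Lemma measurable_word_event n (A : pred (seq bool)) : measurable [set t | A (word n t)].
Proof.
apply: word_event_in => //; first exact: measurableC.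
- exact: measurableU.
- by move=> i _; exact: measurable_level.
Qed.

Local Notation past n := (sigma_join [set i | (1 <= i <= n)%N]
  (fun i => g_sigma_algebra_preimage (X i))).

Lemma past_word_event n (A : pred (seq bool)) : past n [set t | A (word n t)].
Proof.
pose G : set_system T := \bigcup_(i in [set i | (1 <= i <= n)%N]) g_sigma_algebra_preimage (X i).
apply: (@word_event_in (<<s G >>)).
- exact: sigma_algebra0.
- by move=> B; exact: sigma_algebraC.
- by move=> B C hB hC; exact: (@measurableU _ (g_sigma_algebraType G)).
- move=> i ii; apply: sub_sigma_algebra; exists i => //.
  exists [set 1]; first exact: measurable_set1.
  by rewrite setTI.
Qed.

Local Notation innov n := (innovation_systems alpha beta U n).
Local Notation toss n b := (if b then alpha n.+1 else beta n.+1).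
Local Notation toss_prob b := (if b then p else q).

Lemma innovation_pair n (i j : 'I_3) A B : (1 <= n)%N -> i != j ->
  innov n i A -> innov n j B -> P (A `&` B) = (P A * P B)%E.
Proof.
move=> n0 ij iA jB.
pose E (l : 'I_3) := if l == i then A else B.
have Ei : E i = A by rewrite /E eqxx.
have Ej : E j = B by rewrite /E eq_sym (negbTE ij).
have := mrw_innovation_indep hS n0 (J := [set i; j]%SET) (E := E).
rewrite finset.big_setU1 ?finset.in_set1//= finset.big_set1 Ei Ej => <-.
  by congr (P _); apply/seteqP; split => t /=;
    [case=> At Bt l /=; rewrite !inE => /orP[]/eqP ->; rewrite ?Ei ?Ej
    |move=> h; split; [rewrite -Ei|rewrite -Ej]; apply: h; rewrite /= !inE eqxx ?orbT].
by move=> l; rewrite !inE => /orP[]/eqP ->; rewrite ?Ei ?Ej.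
Qed.

Lemma pick_event_innov n k : innov n (Ordinal (isT : 2 < 3)%N) [set t | U n t = k].
Proof. by exists [set k] => //; rewrite setTI. Qed.

Lemma toss_event_innov n (b : bool) :
  innov n (if b then ord0 else Ordinal (isT : 1 < 3)%N) [set t | toss n b t = 1].
Proof.
by case: b; exists [set 1]; rewrite ?setTI//; exact: measurable_set1.
Qed.

Definition pick_toss n k (b : bool) : set T :=
  [set t | U n t = k] `&` [set t | toss n b t = 1].

Lemma measurable_pick_toss n k (b : bool) : measurable (pick_toss n k b).
Proof.
apply: measurableI; first exact: measurable_nat_level.
by case: b; exact: measurable_level.
Qed.

Lemma pr_pick_toss n k (b : bool) : (1 <= k <= n)%N ->
  pr (pick_toss n k b) = n%:R^-1 * toss_prob b.
Proof.
move=> kn; have n0 : (1 <= n)%N by case/andP: kn; exact: leq_trans.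
rewrite -(uniform_law kn).
have <- : pr [set t | toss n b t = 1] = toss_prob b.
  case: b; apply: bernoulli_law1 => //.
    exact: (mrw_alpha_law hS n0).
  exact: (mrw_beta_law hS n0).
rewrite /pr /pick_toss (innovation_pair n0 _ (pick_event_innov n k) (toss_event_innov n b)).
  rewrite fineM// fin_num_measure//; first exact: measurable_nat_level.
  by case: b; exact: measurable_level.
by case: b.
Qed.

Lemma pr_word_pick_toss n k (b : bool) (A : pred (seq bool)) : (1 <= k <= n)%N ->
  pr ([set t | A (word n t)] `&` pick_toss n k b) =
  pr [set t | A (word n t)] * (n%:R^-1 * toss_prob b).
Proof.
move=> kn; have n0 : (1 <= n)%N by case/andP: kn; exact: leq_trans.
have jn : sigma_join setT (innov n) (pick_toss n k b).
  apply: (@measurableI _ (g_sigma_algebraType (\bigcup_(i in setT) innov n i))).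
    by apply: sub_sigma_algebra; eexists; last exact: pick_event_innov.
  by apply: sub_sigma_algebra; eexists; last exact: toss_event_innov.
rewrite -(pr_pick_toss b kn) mulrC setIC /pr.
rewrite (mrw_past_indep hS n0 jn (past_word_event A)) fineM// fin_num_measure//.
  exact: measurable_pick_toss.
exact: measurable_word_event.
Qed.

Lemma nth_word n k t : (1 <= k <= n)%N -> nth false (word n t) (n - k) = (X k t == 1).
Proof.
elim: n => [|n IH]; first by case: k.
case/andP=> k1; rewrite leq_eqVlt => /predU1P[->|kn]; first by rewrite subnn.
by rewrite subSn// /= IH// k1.
Qed.

(** When the word is w and U_n = k, the recursion makes X_(n+1) almost surely equal to the toss
    selected by X_k, which is letter n-k of w because the latest comes first. The new step is thus
    replaced by innovations, to which independence from the past applies. *)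
Lemma pr_word_pick n k w : (1 <= k <= n)%N -> size w = n ->
  pr ([set t | word n t == w] `&` [set t | X n.+1 t = 1] `&` [set t | U n t = k]) =
  pr [set t | word n t == w] * (n%:R^-1 * toss_prob (nth false w (n - k))).
Proof.
move=> kn sw; rewrite -(pr_word_pick_toss _ (pred1 w) kn).
have n0 : (1 <= n)%N by case/andP: kn; exact: leq_trans.
have mW := measurable_word_event n (pred1 w).
apply: pr_ae_eq.
- apply: measurableI; last exact: measurable_nat_level.
  by apply: measurableI => //; exact: measurable_level.
- by apply: measurableI => //; exact: measurable_pick_toss.
apply: filterS steps_binary_ae => t bin.
have rec (Uk : U n t = k) : X n.+1 t = toss n (X k t == 1) t.
  rewrite (mrw_X_rec hS n0) Uk; have k1 : (1 <= k)%N by case/andP: kn.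
  case: (bin k k1) => ->; rewrite ?eqxx; first by rewrite subrr mulr0 addr0 mulr1.
  by rewrite mulr0 subr0 mulr1 add0r eq_sym oner_eq0.
split.
  case=> -[/= /eqP ww Xn] Uk; split => //=; first by rewrite ww.
  by split => //=; rewrite -ww nth_word// -rec.
case=> /= /eqP ww [/= Uk]; by rewrite -ww nth_word// -rec.
Qed.

Lemma pr_word_step_pick n w : (1 <= n)%N -> size w = n ->
  pr ([set t | word n t == w] `&` [set t | X n.+1 t = 1]) =
  pr [set t | word n t == w] * (n%:R^-1 * \sum_(1 <= k < n.+1) toss_prob (nth false w (n - k))).
Proof.
move=> n0 sw; set E := _ `&` _.
have mE : measurable E.
  apply: measurableI; last exact: measurable_level.
  exact: (measurable_word_event n (pred1 w)).
have h m : (m <= n)%N -> pr (E `&` [set t | (1 <= U n t <= m)%N]) =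
   pr [set t | word n t == w] * (n%:R^-1 * \sum_(1 <= k < m.+1) toss_prob (nth false w (n - k))).
  elim: m => [_|m IH mn].
    rewrite big_geq// !mulr0 (_ : _ `&` _ = set0) ?/pr ?measure0//.
    by apply/seteqP; split => t //= [_]; case: (U n t).
  have -> : E `&` [set t | (1 <= U n t <= m.+1)%N] =
      (E `&` [set t | (1 <= U n t <= m)%N]) `|` (E `&` [set t | U n t = m.+1]).
    rewrite -setIUr; congr (_ `&` _); apply/seteqP; split => t /=.
      by case/andP => -> ; rewrite leq_eqVlt => /predU1P[->|]; [right|left].
    by case=> [/andP[-> /leqW]|->]//; rewrite leqnn.
  rewrite pr_setU ?IH ?(ltnW mn) ?pr_word_pick ?mn//.
  - by rewrite [in RHS]big_nat_recr//=; ring.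
  - by apply: measurableI => //; exact: measurable_uniform_le.
  - by apply: measurableI => //; exact: measurable_nat_level.
  - apply/seteqP; split => t //= [[_ /=]] /andP[_ um] [_ /= E1].
    by rewrite E1 ltnn in um.
rewrite -h//; apply: pr_ae_eq => //.
  by apply: measurableI => //; exact: measurable_uniform_le.
by apply: filterS (uniform_law_ae n0) => t ut; split => [?|[]].
Qed.

Lemma sum_toss_prob w :
  \sum_(1 <= k < (size w).+1) toss_prob (nth false w (size w - k)) =
  (count id w)%:R * p + ((size w)%:R - (count id w)%:R) * q.
Proof.
elim: w => [|b w IH]; first by rewrite big_geq//= mul0r subrr mul0r addr0.
rewrite [size (b :: w)]/= big_nat_recr//= subnn /=.
rewrite (_ : \sum_(1 <= i < _) _ = \sum_(1 <= k < (size w).+1) toss_prob (nth false w (size w - k))); last first.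
  by apply: eq_big_nat => k /andP[k1 kw]; rewrite subSn.
by rewrite IH natrD -(@natr1 _ (size w)); case: b => /=; ring.
Qed.

Lemma pr_word_step n w : size w = n ->
  pr ([set t | word n t == w] `&` [set t | X n.+1 t = 1]) =
  pr [set t | word n t == w] * succ_prob q s w.
Proof.
case: n => [|n] sw.
  move/size0nil: sw => ->; rewrite (_ : [set t | _] = setT); last exact/seteqP.
  by rewrite setTI pr_setT mul1r /=; apply: bernoulli_law1 => //; exact: (mrw_X1_law hS).
rewrite pr_word_step_pick//; congr (_ * _).
rewrite -sw sum_toss_prob succ_probE /centered; last by rewrite sw.
have w1 : 1 <= (size w)%:R :> R by rewrite natr_ge1// sw.
have -> : p = q + 1 / 2 by rewrite -ha addrC subrK.
have gen (N C : R) : 1 <= N ->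
    N^-1 * (C * (q + 1 / 2) + (N - C) * q) = 2 * q + (C - 2 * q * N) / (2 * N).
  by clear sw => N1; field; lra.
exact: gen.
Qed.

Lemma pr_word_cons n w (b : bool) : size w = n ->
  pr [set t | word n.+1 t == b :: w] =
  pr [set t | word n t == w] * (if b then succ_prob q s w else 1 - succ_prob q s w).
Proof.
move=> sw; have mX := measurable_level (X n.+1) 1.
have mW := measurable_word_event n (pred1 w).
have h : pr [set t | word n.+1 t == true :: w] = pr [set t | word n t == w] * succ_prob q s w.
  rewrite -(pr_word_step sw); congr (pr _); apply/seteqP; split => t /=.
    by rewrite eqseq_cons => /andP[/eqP/eqP-> ->].
  by rewrite eqseq_cons => -[-> /eqP->]; rewrite !eqxx.
case: b => //; rewrite mulrBr mulr1 -(pr_word_step sw).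
rewrite [X in X - _](pr_split P mX mW) addrC addKr; congr (pr _).
apply/seteqP; split => t /=.
  by rewrite eqseq_cons => /andP[/eqP/eqP/eqP + ->] => /negP h2; split => // /eqP.
by rewrite eqseq_cons => -[/eqP -> /eqP/negbTE ->]; rewrite !eqxx.
Qed.

(** Induction on the number m of future letters: the next letter is moved from the future into the
    conditioning word, and [pr_word_cons] supplies its conditional law. *)
Lemma pr_word_law m n w (A : pred (seq bool)) : size w = n ->
  pr [set t | A (word (m + n) t) && (word n t == w)] =
  pr [set t | word n t == w] * expect q s m (fun z => (A z)%:R) w.
Proof.
elim: m n w => [|m IH] n w sw.
  rewrite /expect /= add0n.
  have [Aw|Aw] := boolP (A w).
    rewrite mulr1; congr (pr _); apply/seteqP; split => t /=; first by case/andP.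
    by move=> /eqP ->; rewrite Aw/=.
  rewrite mulr0 (_ : [set t | _] = set0) ?/pr ?measure0//.
  by apply/seteqP; split => t //= /andP[+ /eqP E]; rewrite E (negbTE Aw).
rewrite addSnnS /expect iterS /step -!/(expect _ _ _ _ _).
have h b := IH n.+1 (b :: w) (congr1 succn sw : size (b :: w) = n.+1).
have := h true; have := h false; rewrite !pr_word_cons//= => hf ht.
have mW b : measurable [set t | A (word (m + n.+1) t) && (word n.+1 t == b :: w)].
  have := measurable_word_event (m + n.+1) (fun z => A z && (drop m z == b :: w)).
  by under eq_fun do rewrite drop_word.
rewrite mulrDr !mulrA -ht -hf -pr_setU; [|exact: mW|exact: mW|].
  congr (pr _); apply/seteqP; split => t /=.
    case/andP => -> ww; rewrite !eqseq_cons ww /=.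
    by case: (X n.+1 t == 1); [left|right].
  by rewrite !eqseq_cons => -[] /and3P[-> _ ->].
apply/seteqP; split => t //= -[]; rewrite !eqseq_cons.
by case: (X n.+1 t == 1); rewrite /= ?andbF.
Qed.

Theorem pr_word_event n (A : pred (seq bool)) :
  pr [set t | A (word n t)] = expect q s n (fun z => (A z)%:R) [::].
Proof.
have := @pr_word_law n 0 [::] A erefl; rewrite addn0.
have -> : [set t | word 0 t == [::]] = setT by apply/seteqP.
rewrite pr_setT mul1r => <-; congr (pr _).
by apply/seteqP; split => t /=; rewrite andbT.
Qed.

Lemma sum_word_ae : {ae P, forall t, forall n, S n t = (count id (word n t))%:R}.
Proof.
apply: filterS steps_binary_ae => t bin.
have X01 n : (1 <= n)%N -> X n t = (X n t == 1)%:R.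
  by move=> /bin[] ->; rewrite ?eqxx// eq_sym oner_eq0.
case=> [|n]; first by rewrite (mrw_S0 hS).
elim: n => [|n IH]; first by rewrite (mrw_S1 hS) {1}X01//= addn0.
by rewrite (mrw_S_rec hS)// IH X01// -natrD addnC.
Qed.

End law_of_words.

(** * Law of the iterated logarithm *)

Section asymptotics.
Context {R : realType}.
Implicit Types (th K x : R) (j n : nat).

Lemma expr_dominates th K : 1 < th -> \forall j \near \oo, K * j%:R <= th ^+ j.
Proof.
move=> th1; have l0 : 0 < ln th by exact: ln_gt0.
near=> j.
have thE : th ^+ j = expR (j%:R * ln th).
  by rewrite expRM_natl lnK// posrE; lra.
have h : 0 <= j%:R * ln th by rewrite mulr_ge0// ltW.
have := expR_ge1Dxn 1 h; rewrite thE => /(le_trans _); apply.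
have jK : K * 2 / ln th ^+ 2 <= j%:R by near: j; exact: nbhs_infty_ger.
rewrite ler_pdivrMr ?exprn_gt0// in jK.
have := ler_wpM2r (ler0n R j) jK; rewrite exprMn !expr2 -[2`!%:R]/(2%:R).
lra.
Unshelve. all: by end_near. Qed.

Lemma expr_unbounded th K : 1 < th -> \forall j \near \oo, K <= th ^+ j.
Proof.
move=> th1; near=> j; apply: le_trans (_ : `|K| * j%:R <= _).
  apply: le_trans (ler_norm K) _; rewrite ler_peMr//.
  by rewrite ler1n; near: j; exact: nbhs_infty_gt.
by near: j; exact: expr_dominates.
Unshelve. all: by end_near. Qed.

Lemma natr_mul_unbounded x K : 0 < x -> \forall j \near \oo, K <= j%:R * x.
Proof.
move=> x0; near=> j; rewrite -ler_pdivrMr//; near: j; exact: nbhs_infty_ger.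
Unshelve. all: by end_near. Qed.

Lemma ln_unbounded K : \forall j \near \oo, K <= ln j%:R :> R.
Proof.
near=> j; have h : expR K <= j%:R by near: j; exact: nbhs_infty_ger.
rewrite -[leLHS]expRK ler_ln ?posrE ?expR_gt0//.
exact: lt_le_trans (expR_gt0 K) h.
Unshelve. all: by end_near. Qed.

(** Partial sums of j^(-g), dominated by the telescoping differences of j^(-(g-1)) / (g-1); the
    exponential form is the one that tail bounds produce. *)
Lemma sum_expR_ln_bounded (g : R) : 1 < g ->
  exists C, forall n, \sum_(1 <= j < n) expR (- (g * ln j%:R)) <= C.
Proof.
move=> g1; exists (1 + (g - 1)^-1) => n; have d0 : 0 < g - 1 by lra.
suff h : forall n, \sum_(1 <= j < n.+2) expR (- (g * ln j%:R)) <=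
    1 + (g - 1)^-1 * (1 - expR (- ((g - 1) * ln n.+1%:R))).
  have p0 : 0 <= 1 + (g - 1)^-1 by rewrite addr_ge0// invr_ge0 ltW.
  case: n => [|[|n]]; [by rewrite big_geq..|].
  apply: le_trans (h n) _; rewrite lerD2l; apply: ler_piMr.
    by rewrite invr_ge0 ltW.
  by rewrite lerBlDr lerDl expR_ge0.
elim=> [|m IH].
  by rewrite big_nat1 ln1 !mulr0 oppr0 expR0 subrr mulr0 addr0.
rewrite big_nat_recr//= (le_trans (lerD IH (lexx _)))//.
rewrite -addrA lerD2l -lerBrDl -mulrBr.
have -> : forall x y : R, 1 - x - (1 - y) = y - x by move=> x y; ring.
have l1 := @ln_succ_ge R m.+1 isT.
set u := ln m.+2%:R in l1 *; set w := ln m.+1%:R in l1 *.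
have uE : expR (- u) = m.+2%:R^-1 by rewrite expRN /u lnK// posrE.
have -> : - (g * u) = - ((g - 1) * u) + (- u) by ring.
rewrite expRD uE.
have -> : - ((g - 1) * w) = - ((g - 1) * u) + (g - 1) * (u - w) by ring.
rewrite (expRD (- ((g - 1) * u))); set E := expR (- _); have E0 : 0 < E := expR_gt0 _.
have h1 := expR_ge1Dx ((g - 1) * (u - w)).
have h2 : E * (1 + (g - 1) * (u - w)) <= E * expR ((g - 1) * (u - w)) by rewrite ler_wpM2l// ltW.
rewrite ler_pdivlMl//.
have : E * (g - 1) * m.+2%:R^-1 <= E * (g - 1) * (u - w).
  by rewrite ler_wpM2l// mulr_ge0// ltW.
set i := m.+2%:R^-1; lra.
Qed.

Lemma le_ln_expR x y : expR x <= y -> x <= ln y.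
Proof.
move=> xy; rewrite -[leLHS]expRK ler_ln ?posrE ?expR_gt0//.
exact: lt_le_trans (expR_gt0 x) xy.
Qed.

Lemma lnlnln_unbounded K : \forall n \near \oo, K <= ln (ln (ln n%:R)) :> R.
Proof.
near=> n; do 2 apply: le_ln_expR; near: n; exact: ln_unbounded.
Unshelve. all: by end_near. Qed.

(** The added 1 puts the logarithm of the time strictly above th^j, at the cost of an excess of at
    most 1. *)
Definition block_time th j : nat := (Num.truncn (expR (th ^+ j))).+1.

Lemma block_time_gt0 th j : (0 < block_time th j)%N.
Proof. by []. Qed.

Lemma ln_block_time_gt th j : th ^+ j < ln (block_time th j)%:R.
Proof.
rewrite -[ltLHS]expRK ltr_ln ?posrE ?expR_gt0 ?ltr0n//.
exact: truncnS_gt.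
Qed.

Lemma ln_block_time_le th j : 0 <= th -> ln (block_time th j)%:R <= th ^+ j + 1.
Proof.
move=> th0; rewrite -[leRHS]expRK ler_ln ?posrE ?expR_gt0 ?ltr0n//.
rewrite /block_time -natr1 expRD.
have := truncn_itv (expR_ge0 (th ^+ j)) => /andP[h _].
have e1 : 2 <= expR 1 :> R by have := expR_ge1Dx (1 : R); lra.
have e2 : 1 <= expR (th ^+ j) by have := expR_ge1Dx (th ^+ j); have := exprn_ge0 j th0; lra.
nra.
Qed.

Lemma block_time_le th j : 1 <= th -> (block_time th j <= block_time th j.+1)%N.
Proof.
move=> th1; rewrite ltnS; apply: le_truncn; rewrite ler_expR.
by rewrite exprS ler_peMl// exprn_ge0//; lra.
Qed.

Lemma block_time_leq th i j : 1 <= th -> (i <= j)%N -> (block_time th i <= block_time th j)%N.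
Proof.
move=> th1 /subnK <-; elim: (j - i)%N => // k IH.
by rewrite addSn (leq_trans IH)// block_time_le.
Qed.

Lemma block_time_exists th J n : 1 < th -> (block_time th J <= n)%N ->
  exists2 j, (J <= j)%N & (block_time th j <= n < block_time th j.+1)%N.
Proof.
move=> th1 Jn; have th1' := ltW th1.
have : \forall j \near \oo, ln n%:R <= th ^+ j by exact: expr_unbounded.
case=> K _ hK.
have n0 : (0 < n)%N by apply: leq_trans Jn.
have ub i : (block_time th i <= n)%N -> (i <= K)%N.
  move=> iN; rewrite leqNgt; apply/negP => Ki.
  have := hK i (ltnW Ki) => /=; apply/negP; rewrite -ltNge.
  apply: lt_le_trans (ln_block_time_gt th i) _.
  by rewrite ler_ln ?posrE ?ltr0n// ler_nat.
case: (@ex_maxnP (fun i => block_time th i <= n)%N K (ex_intro _ J Jn) ub) => j jn jmax.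
exists j; first exact: jmax.
rewrite jn/= ltnNge; apply/negP => /jmax; by rewrite ltnn.
Qed.

Lemma near_block_time (Q : nat -> Prop) th : 1 < th ->
  (\forall j \near \oo, forall n, (block_time th j <= n < block_time th j.+1)%N -> Q n) ->
  \forall n \near \oo, Q n.
Proof.
move=> th1 [J _ hJ]; exists (block_time th J) => // n /= Jn.
by have [j Jj jn] := block_time_exists th1 Jn; apply: (hJ j Jj n jn).
Qed.

Lemma near_at_block_time (Q : nat -> Prop) th : 1 < th ->
  (\forall n \near \oo, Q n) -> \forall j \near \oo, Q (block_time th j).
Proof.
move=> th1 [N _ hN]; near=> j; apply: hN => /=.
rewrite -(ler_nat R); apply: ltW; apply: le_lt_trans (truncnS_gt _).
have : N%:R <= th ^+ j by near: j; exact: expr_unbounded.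
move=> /le_trans; apply; have := expR_ge1Dx (th ^+ j); lra.
Unshelve. all: by end_near. Qed.

(** Up to the factor k, the squared boundary for M: the usual 2 A ln ln A for a clock A close to c
    log n. With n a_n^2 instead of its limit c, the product with [lil_rate] is exactly (n a_n)^2. *)
Definition lil_norm n : R := 2 * scale_sq n * ln n%:R * ln (ln (ln n%:R)).

Lemma lil_norm_gt0 : \forall n \near \oo, 0 < lil_norm n.
Proof.
near=> n; have n0 : (0 < n)%N by near: n; exact: nbhs_infty_gt.
have h1 : 1 <= ln n%:R :> R by near: n; exact: ln_unbounded.
have h2 : 1 <= ln (ln (ln n%:R)) :> R by near: n; exact: lnlnln_unbounded.
have h3 := @scale_sq_gt0 R n n0.
by rewrite /lil_norm; apply: mulr_gt0; [apply: mulr_gt0; [apply: mulr_gt0|]|]; lra.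
Unshelve. all: by end_near. Qed.

Lemma lnln_block_time_ge th j n : 1 < th -> 1 < j%:R * ln th ->
  (block_time th j <= n)%N ->
  [/\ th ^+ j <= ln n%:R, 0 < ln (j%:R * ln th) &
      ln (j%:R * ln th) <= ln (ln (ln n%:R))].
Proof.
move=> th1 j1 jn; have h : th ^+ j <= ln n%:R.
  apply: ltW; apply: lt_le_trans (ln_block_time_gt th j) _.
  by rewrite ler_ln ?posrE ?ltr0n ?ler_nat// (leq_trans _ jn).
have thE : ln (th ^+ j) = j%:R * ln th by rewrite lnXn ?mulr_natl//; lra.
have t0 : 0 < th ^+ j by rewrite exprn_gt0//; lra.
have h2 : j%:R * ln th <= ln (ln n%:R).
  by rewrite -thE ler_ln// posrE (lt_le_trans t0).
by split => //; [rewrite ln_gt0|rewrite ler_ln ?posrE//; lra].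
Qed.

Lemma lil_norm_ge th j n : 1 < th -> 1 < j%:R * ln th ->
  (block_time th j <= n)%N ->
  2 * scale_lim * th ^+ j * ln (j%:R * ln th) <= lil_norm n.
Proof.
move=> th1 j1 jn; have [h1 h2 h3] := lnln_block_time_ge th1 j1 jn.
have n0 : (0 < n)%N by apply: leq_trans jn.
have t0 : 0 < th ^+ j by rewrite exprn_gt0//; lra.
have c0 := @scale_lim_ge R; have c1 := @scale_lim_le R n n0.
rewrite /lil_norm ler_pM ?mulr_ge0//; try lra; try exact: ltW.
by rewrite ler_pM ?mulr_ge0//; lra.
Qed.

End asymptotics.

(** * First Borel-Cantelli lemma *)

Section borel_cantelli.
Context (R : realType) (d : measure_display) (T : measurableType d) (P : probability T R).

Lemma borel_cantelli_ae (E : nat -> set T) (c : nat -> R) (C : R) :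
  (forall j, measurable (E j)) -> (\forall j \near \oo, pr P (E j) <= c j) ->
  (forall j, 0 <= c j) -> (forall n, \sum_(1 <= j < n) c j <= C) ->
  {ae P, forall t, \forall j \near \oo, ~ E j t}.
Proof.
move=> mE [J _ hJ] c0 hC.
pose F j := E (J.+1 + j)%N.
have mF k : measurable (F k) by exact: mE.
have s : (\sum_(0 <= n <oo) P (F n) < +oo)%E.
  apply: (@le_lt_trans _ _ C%:E); last by rewrite ltry.
  apply: lime_le; first by apply: is_cvg_nneseries => *; exact: measure_ge0.
  apply: nearW => n.
  apply: (@le_trans _ _ (\sum_(0 <= i < n) (c (J.+1 + i)%N)%:E)%E).
    by apply: lee_sum => i _; rewrite /F prE// lee_fin; apply: hJ; rewrite /= addSn ltnW// ltnS leq_addr.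
  rewrite sumEFin lee_fin; apply: le_trans (hC (J.+1 + n)%N).
  rewrite [leRHS](@big_cat_nat _ _ _ J.+1)//=; last by rewrite leq_addr.
  have -> : \sum_(J.+1 <= i < J.+1 + n) c i = \sum_(0 <= i < n) c (J.+1 + i)%N.
    rewrite -{1}[J.+1]add0n big_addn addKn.
    by apply: eq_bigr => i _; rewrite addnC.
  by rewrite lerDr sumr_ge0.
have Z := lim_sup_set_cvg0 mF s.
have mL : measurable (lim_sup_set F).
  by apply: bigcap_measurable => // k _; apply: bigcup_measurable.
exists (lim_sup_set F); split => // t /= nt k _.
apply: contrapT => h; apply: nt; exists (J.+1 + k)%N => // j /= Jj Ej.
apply: h; exists (j - J.+1)%N; first by rewrite /= leq_subRL// (leq_trans _ Jj)// leq_addr.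
by rewrite /F subnKC// (leq_trans _ Jj)// leq_addr.
Qed.

End borel_cantelli.

(** * Upper half of the law of the iterated logarithm *)

Section upper_bound.
Context (R : realType) (d : measure_display) (T : measurableType d)
    (P : probability T R) (p q s : R)
    (alpha beta X : nat -> {RV P >-> R}) (U : nat -> {RV P >-> nat})
    (S : nat -> T -> R).
Hypotheses (hp : 0 <= p <= 1) (hq : 0 <= q <= 1) (hs : 0 <= s <= 1)
    (hS : minimal_random_walk p q s alpha beta X U S)
    (ha : p - q = 1 / 2).

Let q_half := mrw_q_half hp hq ha.
Local Notation v := (mrw_var q).
Local Notation c := (@scale_lim R).
Local Notation mart := (mart q).
Local Notation word := (word X).

(** A lower estimate of the square root of k [lil_norm n], valid throughout block j, obtained by
    evaluating the slowly varying factors at its start. *)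
Definition barrier (k th : R) j : R :=
  Num.sqrt (2 * k * c * th ^+ j * ln (j%:R * ln th)).

(** [upper_tail] up to the end of the block, at l = b/V, which minimizes l^2 V / 2 - l b; the
    minimum -b^2/(2V) is the announced exponent. That l <= 1/8 holds eventually because th^j
    dominates j. *)
Lemma upper_block (sg k k' th : R) : `|sg| = 1 -> v < k' -> k' < k -> 1 < th ->
  \forall j \near \oo,
    expect q s (block_time th j.+1) (fun z => (hits q (barrier k th j) sg z)%:R) [::] <=
    10 * expR (- (k / (k' * th) * ln (j%:R * ln th))).
Proof.
move=> sg1 vk' k'k th1; have /andP[v0 _] := mrw_var_itv q_half.
have c0 := @scale_lim_ge R; have c1 := @scale_lim_le1 R.
have l0 : 0 < ln th by exact: ln_gt0.
near=> j.
have y1 : 2 * v / (k' - v) <= th ^+ j by near: j; exact: expr_unbounded.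
have y2 : (128 * k * ln th / (k' ^+ 2 * c * th ^+ 2)) * j%:R <= th ^+ j.
  by near: j; exact: expr_dominates.
have j1 : 2 <= j%:R * ln th by near: j; exact: natr_mul_unbounded.
set y := th ^+ j in y1 y2; set L := ln (j%:R * ln th).
have y0 : 0 < y by rewrite exprn_gt0//; lra.
have L0 : 0 < L by rewrite ln_gt0//; lra.
have Lj : L <= j%:R * ln th by apply: ltW; apply: ln_sublinear; lra.
have bE : barrier k th j ^+ 2 = 2 * k * c * y * L.
  by rewrite /barrier -/y -/L sqr_sqrtr// !mulr_ge0//; lra.
have b0 : 0 < barrier k th j by rewrite /barrier -/y -/L sqrtr_gt0 !mulr_gt0//; lra.
(* An upper bound of v [qvar] at the end of the block; the margin k' > v absorbs the additive
   constants. *)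
set V := k' * c * (th * y).
have V0 : 0 < V by rewrite !mulr_gt0//; lra.
pose l := barrier k th j / V.
have l0' : 0 <= l by rewrite divr_ge0// ltW.
have l8 : l <= 8^-1.
  have V8 : 0 <= 8^-1 * V by rewrite mulr_ge0// ltW.
  rewrite ler_pdivrMr// -(ler_pXn2r (ltn0Sn 1)) ?nnegrE ?(ltW b0)//.
  rewrite bE /V.
  have {}y2 : 128 * k * (j%:R * ln th) <= k' ^+ 2 * c * th ^+ 2 * y.
    rewrite mulrAC ler_pdivrMr ?mulr_gt0 ?exprn_gt0// in y2; lra.
  have h1 : 128 * k * L <= k' ^+ 2 * c * th ^+ 2 * y.
    by apply: le_trans y2; rewrite ler_wpM2l//; lra.
  have h2 : 0 <= c * y by rewrite mulr_ge0//; lra.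
  have := ler_wpM2l h2 h1.
  by rewrite !exprMn !expr2; lra.
have vV : v * qvar (block_time th j.+1) <= V.
  apply: le_trans (_ : v * (c * (th * y + 2)) <= _).
    rewrite ler_wpM2l//; apply: le_trans (@qvar_le R _ (block_time_gt0 th j.+1)) _.
    rewrite ler_wpM2l//; first by lra.
    by have := @ln_block_time_le R th j.+1 ltac:(lra); rewrite exprS -/y; lra.
  rewrite ler_pdivrMr in y1; last by lra.
  have : 2 * v <= th * y * (k' - v) by nra.
  by rewrite /V; nra.
have l08 : 0 <= l <= 8^-1 by rewrite l0'.
apply: le_trans (upper_tail q_half hs (block_time_gt0 th j.+1) sg1 b0 l08) _.
rewrite ler_pM2l// ler_expR.
apply: le_trans (_ : l ^+ 2 * V / 2 - l * barrier k th j <= _).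
  by rewrite lerD2r ler_pM2r// ler_wpM2l// sqr_ge0.
have -> : l ^+ 2 * V / 2 - l * barrier k th j = - (barrier k th j ^+ 2 / (2 * V)).
  by rewrite /l; field; lra.
rewrite bE /V le_eqVlt; apply/orP; left; apply/eqP; field.
by rewrite !lt0r_neq0//; lra.
Unshelve. all: by end_near. Qed.

Lemma not_hits_le (b sg : R) m n t : (n <= m)%N -> ~ hits q b sg (word m t) ->
  sg * mart (word n t) < b.
Proof.
move=> nm nh; rewrite ltNge; apply/negP => bn; apply: nh.
rewrite -(subnK nm); apply: (@hits_drop _ _ _ _ (m - n)).
rewrite drop_word; case: (word n t) bn => [|e w] /= -> //.
Qed.

Lemma upper_lil_signed (sg k : R) : `|sg| = 1 -> v < k ->
  {ae P, forall t, \forall n \near \oo, sg * mart (word n t) <= Num.sqrt (k * lil_norm n)}.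
Proof.
move=> sg1 vk; have /andP[v0 _] := mrw_var_itv q_half.
(* With k' between v and k and th between 1 and k/k', the exponent g = k/(k' th) exceeds 1, so that
   the bounds j^(-g) are summable. *)
pose k' := (v + k) / 2; pose th := (1 + k / k') / 2.
have k'0 : 0 < k' by rewrite /k'; lra.
have vk' : v < k' by rewrite /k'; lra.
have k'k : k' < k by rewrite /k'; lra.
have kk1 : 1 < k / k' by rewrite ltr_pdivlMr ?mul1r.
have th1 : 1 < th by rewrite /th; lra.
pose g := k / (k' * th).
have g1 : 1 < g.
  rewrite /g invfM mulrA ltr_pdivlMr ?mul1r; rewrite /th; lra.
have l0 : 0 < ln th by exact: ln_gt0.
have [C hC] := sum_expR_ln_bounded g1.
pose E j := [set t | hits q (barrier k th j) sg (word (block_time th j.+1) t)].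
pose D := 10 * expR (- (g * ln (ln th))).
have D0 : 0 < D by rewrite mulr_gt0// expR_gt0.
have := @borel_cantelli_ae R d T P E (fun j => D * expR (- (g * ln j%:R))) (D * C).
move=> /(_ _ _ _ _)/filterS; apply => //; last first.
- by move=> n; rewrite -mulr_sumr ler_wpM2l// ltW.
- by move=> j; rewrite mulr_ge0 ?expR_ge0// ltW.
- near=> j; rewrite /E (pr_word_event hp hq hs hS ha).
  have : (0 < j)%N by near: j; exact: nbhs_infty_gt.
  move=> j0; rewrite /D -mulrA -expRD.
  have -> : - (g * ln (ln th)) + - (g * ln j%:R) = - (g * ln (j%:R * ln th)).
    by rewrite lnM ?posrE ?ltr0n//; ring.
  by near: j; exact: upper_block.
- by move=> j; exact: measurable_word_event.
move=> t hE; apply: (near_block_time th1); near=> j => n /andP[jn nj].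
have nh : ~ E j t by near: j.
apply: ltW; apply: lt_le_trans (not_hits_le (ltnW nj) nh) _.
have j1 : 2 <= j%:R * ln th by near: j; exact: natr_mul_unbounded.
rewrite ler_wsqrtr//.
have := @lil_norm_ge R th j n th1 ltac:(lra) jn.
have k0 : 0 <= k by lra.
by move/(ler_wpM2l k0); rewrite /lil_norm; lra.
Unshelve. all: by end_near. Qed.

Theorem upper_lil (k : R) : v < k ->
  {ae P, forall t, \forall n \near \oo, mart (word n t) ^+ 2 <= k * lil_norm n}.
Proof.
move=> vk; have h1 := @upper_lil_signed 1 k (normr1 _) vk.
have h2 := @upper_lil_signed (-1) k (etrans (normrN1 _) erefl) vk.
have /andP[v0 _] := mrw_var_itv q_half.
apply: filterS2 h1 h2 => t h1 h2; near=> n.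
have a1 : 1 * mart (word n t) <= Num.sqrt (k * lil_norm n) by near: n.
have a2 : -1 * mart (word n t) <= Num.sqrt (k * lil_norm n) by near: n.
have r0 : 0 <= k * lil_norm n.
  rewrite mulr_ge0//; first by lra.
  by apply: ltW; near: n; exact: lil_norm_gt0.
rewrite -(sqr_sqrtr r0) -[leLHS](real_normK (num_real _)).
rewrite lerXn2r ?nnegrE ?sqrtr_ge0// ler_norml; lra.
Unshelve. all: by end_near. Qed.

End upper_bound.

(** * Upper estimates of the normalization *)

Section lil_norm_at_block_times.
Context {R : realType}.
Implicit Types (th e : R) (j n : nat).

Lemma near_succ (Q : nat -> Prop) :
  (\forall j \near \oo, Q j) -> \forall j \near \oo, Q j.+1.
Proof. by case=> N _ hN; exists N => // j /= Nj; apply: hN; rewrite /= leqW. Qed.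

(** One factor 1 + e for each of n a_n^2, ln n and ln ln ln n. *)
Lemma lil_norm_block_le th e : 1 < th -> 0 < e -> \forall j \near \oo,
  lil_norm (block_time th j) <= 2 * scale_lim * (1 + e) ^+ 3 * th ^+ j * ln j%:R.
Proof.
move=> th1 e0; have c0 := @scale_lim_ge R; have lt0 : 0 < ln th by exact: ln_gt0.
near=> j; set n := block_time th j.
have y1 : e^-1 <= th ^+ j by near: j; exact: expr_unbounded.
have y2 : (th - 1)^-1 <= th ^+ j by near: j; exact: expr_unbounded.
have j1 : 2 <= j%:R * ln th by near: j; exact: natr_mul_unbounded.
have j2 : (0 < j)%N by near: j; exact: nbhs_infty_gt.
have l1 : ln (2 * ln th) / e <= ln j%:R by near: j; exact: ln_unbounded.
have l2 : 0 <= ln j%:R :> R by rewrite ln_ge0// natr_ge1.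
set y := th ^+ j in y1 y2 *.
have y0 : 0 < y by rewrite exprn_gt0//; lra.
have [n1 n2 n3] := @lnln_block_time_ge R th j n th1 ltac:(lra) (leqnn _).
have n4 := @ln_block_time_le R th j ltac:(lra); rewrite -/n -/y in n1 n4.
have yn : y <= n%:R.
  apply: le_trans n1 _; apply: ltW; apply: ln_sublinear; by rewrite ltr0n.
have A1 : scale_sq n <= scale_lim * (1 + e) :> R.
  have := @scale_sq_le R n (block_time_gt0 th j); rewrite -ler_pdivlMr ?divr_gt0// ?ltr0n//.
    move/le_trans; apply; rewrite invf_div ler_wpM2l//; first by lra.
    rewrite mulrDl divff ?mul1r ?lerD2l; last by rewrite gt_eqF// ltr0n.
    rewrite invf_ple ?posrE ?ltr0n//; exact: le_trans yn.
have B1 : ln n%:R <= (1 + e) * y.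
  apply: le_trans n4 _; rewrite mulrDl mul1r lerD2l.
  by rewrite -ler_pdivrMl// mulr1.
have C1 : ln (ln (ln n%:R)) <= (1 + e) * ln j%:R.
  have h1 : ln n%:R <= th ^+ j.+1.
    apply: le_trans n4 _; rewrite exprS -/y -lerBrDl -{2}[y]mul1r -mulrBl.
    by rewrite -ler_pdivrMl ?mulr1//; lra.
  have h2 : ln (ln n%:R) <= j.+1%:R * ln th.
    have -> : j.+1%:R * ln th = ln (th ^+ j.+1) by rewrite lnXn ?mulr_natl//; lra.
    by rewrite ler_ln ?posrE//; [exact: lt_le_trans n1|rewrite exprn_gt0//; lra].
  have h3 : 0 < ln (ln n%:R) :> R.
    have h : ln (j%:R * ln th) <= ln (ln (ln n%:R)) := n3.
    have [//|h0] := ltP 0 (ln (ln n%:R) : R).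
    by have := @ln_le0 R (ln (ln n%:R)) ltac:(lra); lra.
  apply: le_trans (_ : ln (j%:R * (2 * ln th)) <= _).
    rewrite ler_ln ?posrE// ?mulr_gt0 ?ltr0n//.
    apply: le_trans h2 _; rewrite mulrA ler_pM2r// -natr1.
    by have := @natr_ge1 R _ j2; lra.
  have -> : ln (j%:R * (2 * ln th)) = ln j%:R + ln (2 * ln th).
    by rewrite lnM ?posrE ?ltr0n// mulr_gt0.
  rewrite (mulrDl 1 e) mul1r lerD2l.
  by rewrite ler_pdivrMr// (mulrC _ e) in l1.
have a0 := @scale_sq_gt0 R n (block_time_gt0 th j).
rewrite /lil_norm.
have -> : 2 * scale_lim * (1 + e) ^+ 3 * y * ln j%:R =
  2 * (scale_lim * (1 + e)) * ((1 + e) * y) * ((1 + e) * ln j%:R) by ring.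
have ln0 : 0 <= ln n%:R :> R by lra.
have lll0 : 0 <= ln (ln (ln n%:R)) :> R by lra.
rewrite ler_pM//; first by rewrite mulr_ge0// mulr_ge0// ltW.
rewrite ler_pM//; first by rewrite mulr_ge0// ltW.
by rewrite ler_pM2l.
Unshelve. all: by end_near. Qed.

Lemma lil_norm_le_ln_sq : \forall n \near \oo, lil_norm n <= 2 * ln n%:R ^+ 2 :> R.
Proof.
near=> n.
have l1 : 1 <= ln n%:R :> R by near: n; exact: ln_unbounded.
have l2 : 0 <= ln (ln (ln n%:R)) :> R by near: n; exact: lnlnln_unbounded.
have l3 : ln (ln n%:R) <= ln n%:R :> R by apply: ltW; apply: ln_sublinear; lra.
have l4 : ln (ln (ln n%:R)) <= ln n%:R :> R.
  have [h|h] := ltP 0 (ln (ln n%:R) : R).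
    by apply: le_trans l3; apply: ltW; apply: ln_sublinear.
  by have := @ln_le0 R (ln (ln n%:R)) ltac:(lra); lra.
have a1 := @scale_sq_le1 R n.
have a0 : 0 <= scale_sq n :> R by rewrite mulr_ge0// sqr_ge0.
have h : ln n%:R * ln (ln (ln n%:R)) <= ln n%:R ^+ 2 :> R by rewrite expr2 ler_wpM2l//; lra.
rewrite /lil_norm -mulrA -mulrA ler_pM2l// ; apply: le_trans h.
by rewrite ler_piMl// mulr_ge0//; lra.
Unshelve. all: by end_near. Qed.

End lil_norm_at_block_times.

(** * Lower half of the law of the iterated logarithm *)

Section lower_bound.
Context (R : realType) (d : measure_display) (T : measurableType d)
    (P : probability T R) (p q s : R)
    (alpha beta X : nat -> {RV P >-> R}) (U : nat -> {RV P >-> nat})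
    (S : nat -> T -> R).
Hypotheses (hp : 0 <= p <= 1) (hq : 0 <= q <= 1) (hs : 0 <= s <= 1)
    (hS : minimal_random_walk p q s alpha beta X U S)
    (ha : p - q = 1 / 2).

Let q_half := mrw_q_half hp hq ha.
Local Notation v := (mrw_var q).
Local Notation c := (@scale_lim R).
Local Notation mart := (mart q).
Local Notation word := (word X).

(** Makes k = 1 admissible in [upper_lil]; this weak form already controls bad pasts, positions at
    block starts and the law of large numbers. *)
Lemma mrw_var_lt1 : v < 1.
Proof. by have /andP[_] := mrw_var_itv q_half; lra. Qed.

Lemma good_ae : {ae P, forall t, \forall n \near \oo, good q (word n t)}.
Proof.
apply: filterS (upper_lil hp hq hs hS ha mrw_var_lt1) => t h; near=> n.
have h1 : mart (word n t) ^+ 2 <= 1 * lil_norm n by near: n.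
have h2 : lil_norm n <= 2 * ln n%:R ^+ 2 :> R by near: n; exact: lil_norm_le_ln_sq.
(* 324 = 2 * 162, where y^3/162 is the cubic term of exp(y/3): from there on it exceeds 2 y^2. *)
have y1 : 324 <= ln n%:R :> R by near: n; exact: ln_unbounded.
have n0 : (0 < n)%N by near: n; exact: nbhs_infty_gt.
have dl := @damping_le R n n0; have d0 := @damping_gt0 R n.
have m0 : 0 <= `|mart (word n t)| * damping n by rewrite mulr_ge0// ltW.
rewrite /good size_word -(ler_pXn2r (ltn0Sn 1)) ?nnegrE//.
rewrite expr1n exprMn real_normK ?num_real//.
have d2 : damping n ^+ 2 <= expR (- (ln n%:R / 3)) :> R.
  apply: le_trans (_ : expR (- (ln n%:R / 6)) ^+ 2 <= _).
    by rewrite lerXn2r ?nnegrE ?expR_ge0// ltW.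
  by rewrite expr2 -expRD ler_expR; lra.
set y := ln n%:R in y1 h2 d2 *.
have e3 : y ^+ 3 / 162 <= expR (y / 3).
  have := @expR_ge1Dxn R (y / 3) 2 ltac:(lra).
  rewrite -[3`!%:R]/(6%:R) => /(le_trans _); apply.
  rewrite (_ : (y / 3) ^+ 3 / 6 = y ^+ 3 / 162); last by field.
  by lra.
have e4 : 2 * y ^+ 2 <= expR (y / 3).
  apply: le_trans e3; rewrite exprS mulrAC.
  by rewrite ler_wpM2r ?sqr_ge0//; lra.
apply: le_trans (_ : expR (y / 3) * expR (- (y / 3)) <= _); last by rewrite expRxMexpNx_1.
rewrite ler_pM ?sqr_ge0//; lra.
Unshelve. all: by end_near. Qed.

(** A lower bound of (1-e) lam V, with lam given by [tilt_choice] for l = ln (j+1), and V, the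
    variance gained in block j, bounded below by v c th^(j+1) (1 - 2/th). *)
Definition gap (e th : R) j : R :=
  Num.sqrt (2 * (1 - e) ^+ 2 * (1 - 3 * e) * (1 - 2 / th) * v * c * th ^+ j.+1 * ln j.+1%:R).

(** The tilt is chosen so that the Gaussian exponent lam^2 V / 2 is (1-3e) l. The hypothesis on V
    gives lam <= 1/120, hence the range required by [lower_tail]. *)
Lemma tilt_choice (e l V : R) : 0 < e <= 14^-1 -> 0 <= l -> 0 < V ->
  2 * 120 ^+ 2 * l <= V ->
  exists lam, [/\ 0 <= lam, lam ^+ 2 * V / 2 = (1 - 3 * e) * l & (1 + e) * lam <= 60^-1].
Proof.
move=> /andP[e0 e1] l0 V0 lV; pose u := 2 * (1 - 3 * e) * l / V.
have e3 : 0 <= 1 - 3 * e <= 1 by lra.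
have /andP[e30 e31] := e3.
have u0 : 0 <= u.
  by apply: divr_ge0; [apply: mulr_ge0 => //; rewrite mulr_ge0|exact: ltW].
exists (Num.sqrt u); split; first exact: sqrtr_ge0.
  by rewrite sqr_sqrtr// /u; field; rewrite gt_eqF.
have h : Num.sqrt u <= 120^-1.
  rewrite -[leRHS](ger0_norm (_ : 0 <= 120^-1))// -sqrtr_sqr ler_wsqrtr//.
  rewrite exprVn ler_pdivrMr// ler_pdivlMl ?exprn_gt0//.
  apply: le_trans lV; rewrite (_ : 120 ^+ 2 * _ = 2 * 120 ^+ 2 * ((1 - 3 * e) * l)); last by ring.
  have : (1 - 3 * e) * l <= 1 * l by rewrite ler_wpM2r.
  by move: ((1 - 3 * e) * l) => w; rewrite !expr2; lra.
have s0 := sqrtr_ge0 u; move: (Num.sqrt u) h s0 => r; nra.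
Qed.

Lemma lower_block (sg e th : R) : `|sg| = 1 -> 0 < v -> 0 < e <= 14^-1 -> 4 <= th ->
  \forall j \near \oo, forall x, size x = block_time th j -> good q x ->
    j.+1%:R^-1 <= expect q s (block_time th j.+1 - block_time th j)
      (fun z => (gap e th j <= sg * (mart z - mart x))%R%:R) x.
Proof.
move=> sg1 v0 e01' th4; have /andP[e0 e1] := e01'; have c0 := @scale_lim_ge R.
have th1 : 1 < th by lra.
near=> j => x sx gx.
set n := block_time th j; set n' := block_time th j.+1.
have nn' : (n <= n')%N by apply: block_time_le; lra.
pose l : R := ln j.+1%:R.
have y1 : 3 <= th ^+ j by near: j; exact: expr_unbounded.
have y2 : 240 ^+ 2 / (v * c) * j.+1%:R <= th ^+ j.+1.
  by near: j; exact: (near_succ (@expr_dominates R th _ th1)).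
(* Pays for the factor 1/4 of [lower_tail]: (1+2e)(1-3e) <= 1-e leaves a factor exp(e l) >= 4. The
   next bound makes e^2 (1-3e) l at least ln 12. *)
have l1 : ln 4 / e <= ln j.+1%:R by near: j; exact: (near_succ (@ln_unbounded R _)).
have l2 : ln 12 / (e ^+ 2 * (1 - 3 * e)) <= ln j.+1%:R :> R by near: j; exact: (near_succ (@ln_unbounded R _)).
have l3 : 1 <= ln j.+1%:R :> R by near: j; exact: (near_succ (@ln_unbounded R _)).
rewrite -/l in l1 l2 l3.
have lj : l <= j.+1%:R by apply: ltW; apply: ln_sublinear; rewrite ltr0n.
set y := th ^+ j.+1 in y2; have yE : y = th * th ^+ j by rewrite /y exprS.
have y0 : 0 < y by rewrite exprn_gt0//; lra.
pose V := v * (qvar n' - qvar n).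
(* The block gains at least c (th^(j+1) - th^j - 3) in [qvar]; as th^j >= 3, the constant costs one
   more th^j, hence 2/th. *)
have Vge : v * c * y * (1 - 2 / th) <= V.
  rewrite (_ : v * c * y * (1 - 2 / th) = v * (c * (y * (1 - 2 / th)))); last by ring.
  rewrite /V ler_pM2l//.
  have h1 := @qvar_ge R n' (block_time_gt0 th j.+1); have h2 := @qvar_le R n (block_time_gt0 th j).
  have h3 := @ln_block_time_gt R th j.+1; have h4 := @ln_block_time_le R th j ltac:(lra).
  apply: le_trans (_ : c * (y - th ^+ j - 3) <= _).
    rewrite ler_pM2l; last by lra.
    rewrite (_ : y * (1 - 2 / th) = y - 2 * th ^+ j); last by rewrite yE; field; lra.
    by lra.
  have h5 : c * (y - 1) <= c * (ln n'%:R - 1) by rewrite ler_pM2l; [rewrite lerD2r ltW|lra].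
  have h6 : c * (ln n%:R + 1) <= c * (th ^+ j + 1 + 1) by rewrite ler_pM2l; [rewrite lerD2r|lra].
  by lra.
have th2 : 2^-1 <= 1 - 2 / th.
  have : 2 / th <= 2^-1 by rewrite ler_pdivrMr; lra.
  by move: (2 / th) => u; lra.
have V2 : v * c * y / 2 <= V.
  have v1 : 0 <= v * c * y by apply: mulr_ge0; [apply: mulr_ge0; [exact: ltW|lra]|exact: ltW].
  by apply: le_trans Vge; rewrite (ler_wpM2l v1).
have V0 : 0 < V.
  apply: lt_le_trans V2; rewrite divr_gt0//; apply: mulr_gt0 => //.
  by apply: mulr_gt0 => //; lra.
have V3 : 2 * 120 ^+ 2 * l <= V.
  apply: le_trans V2; rewrite mulrAC ler_pdivrMr in y2; last by apply: mulr_gt0 => //; lra.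
  rewrite ler_pdivlMr//; apply: le_trans (_ : 240 ^+ 2 * j.+1%:R <= _); last by rewrite (mulrC _ y).
  rewrite (_ : 2 * 120 ^+ 2 * l * 2 = 240 ^+ 2 * l); last by ring.
  exact: (ler_wpM2l (exprn_ge0 2 (ler0n R 240))).
have l00 : 0 <= l by exact: le_trans l3.
have [lam [lam0 lamE lam60]] := tilt_choice e01' l00 V0 V3.
have V_E : V = v * (qvar ((n' - n) + size x) - qvar (size x)) by rewrite sx subnK.
have x0 : (0 < size x)%N by rewrite sx.
have e01 : 0 < e < 1 by rewrite e0/=; lra.
have small : expR (- (e ^+ 2 * (lam ^+ 2 * V / 2))) <= 12^-1.
  rewrite lamE expRN lef_pV2 ?posrE ?expR_gt0//.
  rewrite -[leLHS](@lnK R) ?posrE// ler_expR mulrA mulrC -ler_pdivrMr//.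
  by rewrite mulr_gt0 ?exprn_gt0//; lra.
have := @lower_tail R q s q_half hs (n' - n) x sg lam e V x0 gx sg1 e01 lam0 lam60 V_E small.
rewrite lamE => lt; apply: le_trans (le_trans _ lt) _.
  rewrite -[j.+1%:R](@lnK R) ?posrE// -expRN -/l.
  rewrite mulrC ler_pdivlMr// -[4](@lnK R) ?posrE// -expRD ler_expR.
  rewrite ler_pdivrMr// in l1.
  have := sqr_ge0 e; nra.
have gb : gap e th j <= (1 - e) * lam * V.
  have b0 : 0 <= (1 - e) * lam * V by apply: mulr_ge0; [rewrite mulr_ge0//; lra|exact: ltW].
  rewrite -[leRHS](ger0_norm b0) -sqrtr_sqr ler_wsqrtr// -/y -/l.
  have -> : ((1 - e) * lam * V) ^+ 2 = 2 * (1 - e) ^+ 2 * (lam ^+ 2 * V / 2) * V by field.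
  rewrite lamE.
  have k0 : 0 <= 2 * (1 - e) ^+ 2 * ((1 - 3 * e) * l).
    have e30 : 0 <= 1 - 3 * e by lra.
    exact: (mulr_ge0 (mulr_ge0 (ler0n R 2) (sqr_ge0 _)) (mulr_ge0 e30 l00)).
  have := ler_wpM2l k0 Vge; set A := 2 * (1 - e) ^+ 2; set B := 1 - 3 * e; set C := 1 - 2 / th.
  apply: le_trans; rewrite le_eqVlt; apply/orP; left; apply/eqP; ring.
apply: expect_le => // z _ _.
by have [/(le_trans gb) ->|_] := leP ((1 - e) * lam * V) (sg * (mart z - mart x)).
Unshelve. all: by end_near. Qed.

Lemma miss_word (E : nat -> pred (seq bool)) (tm : nat -> nat) J m t :
  (forall j, (tm j <= tm j.+1)%N) ->
  (forall j, (J <= j)%N -> ~~ E j (word (tm j.+1) t)) ->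
  miss E tm J m (word (tm (J + m)%N) t).
Proof.
move=> tmS h; elim: m => [//|m IH]; rewrite addnS /= h ?leq_addr//=.
by rewrite -{2}(subnK (tmS (J + m)%N)) drop_word.
Qed.

(** No independence is involved: the bound 1/(j+1) holds from every past, so beyond any J a total
    absence of success has probability at most J/(J+m) for all m. *)
Lemma second_borel_cantelli (E : nat -> pred (seq bool)) (tm : nat -> nat) :
  (forall j, (tm j <= tm j.+1)%N) ->
  (\forall j \near \oo, forall x, size x = tm j ->
    j.+1%:R^-1 <= expect q s (tm j.+1 - tm j) (fun z => (E j z)%:R) x) ->
  {ae P, forall t, forall J, exists2 j, (J <= j)%N & E j (word (tm j.+1) t)}.
Proof.
move=> tmS [J0 _ hE]; apply: ae_foralln => J.
pose J' := maxn (maxn J J0) 1.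
have J'0 : (0 < J')%N by rewrite /J' leq_max orbT.
pose F m := [set t | miss E tm J' m (word (tm (J' + m)%N) t)].
have mF m : measurable (F m) by exact: measurable_word_event.
have mI : measurable (\bigcap_m F m) by apply: bigcap_measurable.
have Z : pr P (\bigcap_m F m) = 0.
  apply/eqP; rewrite eq_le pr_ge0 andbT.
  apply/ler_addgt0Pl => eps eps0; rewrite addr0.
  have [m hm] : exists m : nat, J'%:R / eps <= m%:R :> R.
    exists (Num.truncn (J'%:R / eps)).+1; apply: ltW; exact: truncnS_gt.
  apply: (@le_trans _ _ (pr P (F m))).
    by apply: le_pr => // t h; exact: h.
  rewrite /F (pr_word_event hp hq hs hS ha).
  apply: le_trans (expect_miss q_half hs _ tmS J'0 _) _.
    move=> j x J'j sx; apply: hE => //=.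
    by apply: leq_trans J'j; rewrite /J' !leq_max leqnn orbT.
  rewrite ler_pdivrMr ?ltr0n ?addn_gt0 ?J'0//.
  rewrite ler_pdivrMr// in hm; rewrite mulrC; apply: le_trans hm _.
  by rewrite ler_pM2r// ler_nat leq_addl.
apply: negligibleS (pr0_negligible mI Z).
move=> t /= nt m _; apply: miss_word => // j J'j; apply/negP => Ej; apply: nt.
by exists j => //; apply: leq_trans J'j; rewrite /J' !leq_max leqnn.
Qed.

Lemma gap_ae (sg e th : R) : `|sg| = 1 -> 0 < v -> 0 < e <= 14^-1 -> 4 <= th ->
  {ae P, forall t, forall J, exists2 j, (J <= j)%N &
    gap e th j <= sg * (mart (word (block_time th j.+1) t) - mart (word (block_time th j) t))}.
Proof.
move=> sg1 v0 e01 th4; have th1 : 1 <= th by lra.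
pose tm := block_time th.
have tmS j : (tm j <= tm j.+1)%N by exact: block_time_le.
(* Counting a bad past as a success gives the conditional bound from every past; [good_ae] then
   discards this alternative for large j. *)
pose E j z := let x := drop (tm j.+1 - tm j) z in
  ~~ good q x || (gap e th j <= sg * (mart z - mart x)).
have hE : \forall j \near \oo, forall x, size x = tm j ->
    j.+1%:R^-1 <= expect q s (tm j.+1 - tm j) (fun z => (E j z)%:R) x.
  near=> j => x sx; have [gx|ngx] := boolP (good q x).
    apply: le_trans (_ : expect q s (tm j.+1 - tm j)
      (fun z => (gap e th j <= sg * (mart z - mart x))%R%:R) x <= _).
      by move: x sx gx; near: j; exact: lower_block.
    by apply: expect_le => // z _ dz; rewrite /E dz gx.
  apply: le_trans (_ : expect q s (tm j.+1 - tm j) (fun=> 1) x <= _).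
    by rewrite expect_cst invf_le1 ?ler1n ?ltr0n.
  by apply: expect_le => // z _ dz; rewrite /E dz ngx.
apply: filterS2 good_ae (second_borel_cantelli tmS hE) => t gt Et J.
have th1' : 1 < th by lra.
have [N _ hN] := near_at_block_time th1' gt.
have [j Jj Ej] := Et (maxn J N); exists j; first by apply: leq_trans Jj; rewrite leq_maxl.
have gj : good q (word (block_time th j) t).
  by apply: hN => /=; apply: leq_trans Jj; rewrite leq_maxr.
move: Ej; rewrite /E.
have -> : drop (tm j.+1 - tm j) (word (tm j.+1) t) = word (tm j) t.
  by rewrite -{2}(subnK (tmS j)) drop_word.
by rewrite gj.
Unshelve. all: by end_near. Qed.

(** The relation th e^2 = 1 makes the squared normalization at the start of the block about e^2
    times that at its end, so the starting position costs at most 2e. The factor 1 - 8e converts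
    [gap] into the normalization. *)
Lemma gap_combine (sg e th : R) (t : T) : `|sg| = 1 -> 0 < v -> 0 < e <= 14^-1 ->
  196 <= th -> th * e ^+ 2 = 1 ->
  (\forall n \near \oo, mart (word n t) ^+ 2 <= 1 * lil_norm n) ->
  \forall j \near \oo,
    gap e th j <= sg * (mart (word (block_time th j.+1) t) - mart (word (block_time th j) t)) ->
    (Num.sqrt v * (1 - 8 * e) - 2 * e) * Num.sqrt (lil_norm (block_time th j.+1)) <=
    sg * mart (word (block_time th j.+1) t).
Proof.
move=> sg1 v0 /andP[e0 e1] th196 thE ut; have c0 := @scale_lim_ge R.
have th1 : 1 < th by lra.
have lth : 1 <= ln th.
  apply: le_ln_expR; apply: le_trans th196.
  have : `|1| <= 1 :> R by rewrite normr1.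
  by move/expR_taylor2; rewrite normr1 !expr1n ler_norml; lra.
have lth0 : 0 < ln th by lra.
have th0 : 0 < th by lra.
have c00 : 0 <= c by lra.
have the : 2 / th = 2 * e ^+ 2.
  by rewrite -[in LHS](mulr1 2) -thE; field; lra.
near=> j => gj.
have b1 : lil_norm (block_time th j.+1) <= 2 * c * (1 + e) ^+ 3 * th ^+ j.+1 * ln j.+1%:R.
  by near: j; exact: (near_succ (lil_norm_block_le th1 e0)).
have b2 : lil_norm (block_time th j) <= 2 * c * (1 + e) ^+ 3 * th ^+ j * ln j%:R.
  by near: j; exact: lil_norm_block_le.
have j0 : (0 < j)%N by near: j; exact: nbhs_infty_gt.
have lj : 1 <= ln j%:R :> R by near: j; exact: ln_unbounded.
have j1 : 1 < j.+1%:R * ln th.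
  apply: (@lt_le_trans _ _ 2); first by rewrite ltr1n.
  by near: j; exact: (near_succ (natr_mul_unbounded _ lth0)).
have b3 := lil_norm_ge th1 j1 (leqnn (block_time th j.+1)).
have u1 : mart (word (block_time th j) t) ^+ 2 <= 1 * lil_norm (block_time th j).
  by near: j; exact: (near_at_block_time th1 ut).
have l0 : ln j%:R <= ln j.+1%:R :> R by rewrite ler_ln ?posrE ?ltr0n// ler_nat.
have l1 : ln j.+1%:R <= ln (j.+1%:R * ln th) :> R.
  by rewrite ler_ln ?posrE ?ltr0n// ?mulr_gt0 ?ltr0n ?ler_peMr.
have y'0 : 0 < th ^+ j by rewrite exprn_gt0.
have yE : th ^+ j.+1 = th * th ^+ j by rewrite exprS.
have y0 : 0 < th ^+ j.+1 by rewrite exprn_gt0.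
have L0 : 0 <= ln j.+1%:R :> R by apply: le_trans l0; exact: le_trans lj.
have L0' : 0 <= ln j%:R :> R by exact: le_trans lj.
move: gj; rewrite /gap the; set n := block_time th j.+1 in b1 b3 *; set n' := block_time th j in b2 u1 *.
set y := th ^+ j.+1 in b1 b3 yE y0 *; set y' := th ^+ j in b2 y'0 yE *.
clearbody n n' y y' => gj.
have n0 : 0 < lil_norm n :> R.
  by apply: lt_le_trans b3; rewrite !mulr_gt0//; lra.
have g1 : (Num.sqrt v * (1 - 8 * e)) * Num.sqrt (lil_norm n) <=
  Num.sqrt (2 * (1 - e) ^+ 2 * (1 - 3 * e) * (1 - 2 * e ^+ 2) * v * c * y * ln j.+1%:R).
  have s0 : 0 <= Num.sqrt v * (1 - 8 * e) * Num.sqrt (lil_norm n).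
    by rewrite !mulr_ge0 ?sqrtr_ge0//; lra.
  rewrite -[leLHS](ger0_norm s0) -sqrtr_sqr ler_wsqrtr//.
  rewrite !exprMn sqr_sqrtr ?(ltW v0)// sqr_sqrtr ?(ltW n0)//.
  (* To first order the left side is below 1 - 7e (11 - 4) and the right side above 1 - 6e (2 + 3 +
     1). *)
  have poly : (1 - 8 * e) ^+ 2 * (1 + e) ^+ 3 <= (1 - e) ^+ 2 * (1 - 3 * e) * (1 - 2 * e ^+ 2).
    have a1 : (1 - 8 * e) ^+ 2 <= 1 - 11 * e by rewrite !expr2; nra.
    have a2 : (1 + e) ^+ 3 <= 1 + 4 * e by rewrite !exprS expr0; nra.
    have a3 : 1 - 2 * e <= (1 - e) ^+ 2 by rewrite !expr2; nra.
    have a4 : 1 - e <= 1 - 2 * e ^+ 2 by rewrite !expr2; nra.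
    apply: le_trans (_ : (1 - 11 * e) * (1 + 4 * e) <= _).
      by rewrite ler_pM// ?sqr_ge0// exprn_ge0//; lra.
    apply: le_trans (_ : (1 - 2 * e) * (1 - 3 * e) * (1 - e) <= _); first by nra.
    have f1 : 0 <= 1 - 3 * e by lra.
    have f2 : 0 <= 1 - 2 * e by lra.
    have f3 : 0 <= 1 - e by lra.
    exact: (ler_pM (mulr_ge0 f2 f1) f3 (ler_wpM2r f1 a3) a4).
  have k1 : 0 <= v * (1 - 8 * e) ^+ 2 by rewrite mulr_ge0 ?sqr_ge0// ltW.
  apply: le_trans (ler_wpM2l k1 b1) _.
  have k2 : 0 <= 2 * v * c * y * ln j.+1%:R.
    exact: (mulr_ge0 (mulr_ge0 (mulr_ge0 (mulr_ge0 (ler0n R 2) (ltW v0)) c00) (ltW y0)) L0).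
  have := ler_wpM2l k2 poly.
  set A := (1 - 8 * e) ^+ 2; set B := (1 + e) ^+ 3; set C := (1 - e) ^+ 2 * _ * _.
  move=> h; apply: le_trans (_ : 2 * v * c * y * ln j.+1%:R * (A * B) <= _).
    by rewrite le_eqVlt; apply/orP; left; apply/eqP; ring.
  apply: le_trans h _.
  by rewrite le_eqVlt; apply/orP; left; apply/eqP; rewrite /C; ring.
have g2 : Num.sqrt (lil_norm n') <= 2 * e * Num.sqrt (lil_norm n).
  have s0 : 0 <= 2 * e * Num.sqrt (lil_norm n) by rewrite !mulr_ge0 ?sqrtr_ge0//; lra.
  rewrite -[leRHS](ger0_norm s0) -sqrtr_sqr ler_wsqrtr//.
  rewrite !exprMn sqr_sqrtr ?(ltW n0)//.
  have e3 : (1 + e) ^+ 3 <= 2 by rewrite !exprS expr0; nra.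
  have {}b2 : lil_norm n' <= 2 * c * 2 * y' * ln j%:R.
    apply: le_trans b2 _; apply: (ler_wpM2r L0'); apply: (ler_wpM2r (ltW y'0)).
    by apply: ler_wpM2l => //; rewrite mulr_ge0.
  have {}b3 : 2 * c * y * ln j%:R <= lil_norm n.
    apply: le_trans b3; apply: ler_wpM2l; last exact: le_trans l1.
    by apply: mulr_ge0; [rewrite mulr_ge0|exact: ltW].
  apply: le_trans b2 _.
  have k1 : 0 <= 2 ^+ 2 * e ^+ 2 by rewrite mulr_ge0 ?sqr_ge0.
  apply: le_trans (ler_wpM2l k1 b3).
  have -> : 2 ^+ 2 * e ^+ 2 * (2 * c * y * ln j%:R) = 2 * (2 * c * 2 * y' * ln j%:R).
    rewrite yE [LHS](_ : _ = (th * e ^+ 2) * (2 * (2 * c * 2 * y' * ln j%:R))); last by ring.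
    by rewrite thE mul1r.
  have : 0 <= 2 * c * 2 * y' * ln j%:R.
    exact: (mulr_ge0 (mulr_ge0 (mulr_ge0 (mulr_ge0 (ler0n R 2) c00) (ler0n R 2)) (ltW y'0)) L0').
  by move: (2 * c * 2 * y' * ln j%:R) => u; lra.
have g3 : `|mart (word n' t)| <= Num.sqrt (lil_norm n').
  by rewrite -sqrtr_sqr ler_wsqrtr// -[leRHS]mul1r.
have g4 : - (sg * mart (word n' t)) <= `|mart (word n' t)|.
  by apply: le_trans (ler_norm _) _; rewrite normrN normrM sg1 mul1r.
have gen (A B W W' Z M M' : R) : A * W <= sg * (M - M') -> W' <= B * W -> Z <= W' ->
  - (sg * M') <= Z -> (A - B) * W <= sg * M.
  by rewrite (mulrBr sg) (mulrBl W) lerBlDr => *; lra.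
exact: gen (le_trans g1 gj) g2 g3 g4.
Unshelve. all: by end_near. Qed.

Theorem lower_lil (sg k : R) : `|sg| = 1 -> 0 <= k -> k < v ->
  {ae P, forall t, forall N, exists2 n, (N <= n)%N &
    Num.sqrt (k * lil_norm n) <= sg * mart (word n t)}.
Proof.
move=> sg1 k0 kv; have v0 : 0 < v by exact: le_lt_trans kv.
have /andP[_ v4] := mrw_var_itv q_half.
have sv : Num.sqrt v <= 2^-1.
  rewrite -[leRHS](ger0_norm (_ : 0 <= 2^-1))// -sqrtr_sqr ler_wsqrtr//.
  by rewrite expr2; lra.
have sk0 := sqrtr_ge0 k.
have skv : Num.sqrt k < Num.sqrt v by rewrite ltr_sqrt.
(* As sqrt v <= 1/2, the coefficient sqrt v (1-8e) - 2e is at least sqrt v - 6e, hence above sqrt v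
   - 7e = sqrt k. The same bound gives e <= 1/14 and th >= 196. *)
have [e eE] : exists e, e = (Num.sqrt v - Num.sqrt k) / 7 by eexists.
have e0 : 0 < e by rewrite eE; lra.
have e1 : e <= 14^-1 by rewrite eE; lra.
have e01 : 0 < e <= 14^-1 by rewrite e0.
have e2 : 0 < e ^+ 2 by rewrite exprn_gt0.
have [th thE] : exists th, th = (e ^+ 2)^-1 by eexists.
have th196 : 196 <= th.
  rewrite -[196]invrK thE lef_pV2 ?posrE//.
  apply: le_trans (_ : 14^-1 ^+ 2 <= _); first by rewrite lerXn2r ?nnegrE; lra.
  by rewrite expr2; lra.
have {}thE : th * e ^+ 2 = 1 by rewrite thE mulVf// gt_eqF.
have th4 : 4 <= th by lra.
have th1 : 1 < th by lra.
apply: filterS2 (gap_ae sg1 v0 e01 th4) (upper_lil hp hq hs hS ha mrw_var_lt1) => t gt ut N.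
have [J1 _ h1] := gap_combine sg1 v0 e01 th196 thE ut.
have [J2 _ h2] := near_succ (near_at_block_time th1 (nbhs_infty_ge N)).
have [j Jj gj] := gt (maxn J1 J2); exists (block_time th j.+1).
  by apply: h2; apply: leq_trans Jj; rewrite leq_maxr.
apply: le_trans (h1 j _ gj); last by apply: leq_trans Jj; rewrite leq_maxl.
rewrite sqrtrM// ler_wpM2r ?sqrtr_ge0//.
have -> : Num.sqrt k = Num.sqrt v - 7 * e by rewrite eE; field.
have : Num.sqrt v * e <= 2^-1 * e by rewrite ler_wpM2r// ltW.
lra.
Qed.

End lower_bound.

(** * Quadratic strong law *)

Section averaging.
Context {R : realType}.
Implicit Types (u w x L C : nat -> R) (l : R).

Lemma cvg_inv_unbounded u : (forall K, \forall n \near \oo, K <= u n) ->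
  (fun n => (u n)^-1) @ \oo --> 0.
Proof.
move=> hu; apply/cvgrPdist_le => e e0; near=> n.
have h : e^-1 <= u n by near: n; exact: hu.
have ei : 0 < e^-1 by rewrite invr_gt0.
rewrite sub0r normrN ger0_norm; last by rewrite invr_ge0; lra.
by rewrite invf_ple ?posrE//; lra.
Unshelve. all: by end_near. Qed.

(** Toeplitz's lemma: the terms before index K have a fixed sum, killed by L; the others are within
    eta of x0. *)
Lemma weighted_average_cvg w x L l (x0 : R) (m : nat) : (forall k, 0 <= w k) ->
  (forall K, \forall n \near \oo, K <= L n) ->
  (fun n => (\sum_(m <= k < n) w k) / L n) @ \oo --> l -> x @ \oo --> x0 ->
  (fun n => (\sum_(m <= k < n) w k * x k) / L n) @ \oo --> l * x0.
Proof.
move=> w0 hL hW hx.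
suff h : (fun n => (\sum_(m <= k < n) w k * (x k - x0)) / L n) @ \oo --> (0 : R).
  have -> : (fun n => (\sum_(m <= k < n) w k * x k) / L n) =
    (fun n => (\sum_(m <= k < n) w k) / L n * x0 + (\sum_(m <= k < n) w k * (x k - x0)) / L n).
    apply/funext => n; rewrite (mulrAC _ _ x0) -mulrDl; congr (_ / _).
    rewrite mulr_suml -big_split/=.
    by apply: eq_bigr => k _; ring.
  by rewrite -[l * x0]addr0; apply: cvgD => //; apply: cvgMl.
apply/cvgrPdist_le => e e0.
have l0 : 0 < `|l| + 1 by rewrite ltr_wpDl.
pose eta := e / 2 / (`|l| + 1).
have eta0 : 0 < eta by rewrite !divr_gt0.
move/cvgrPdist_le : hx => /(_ _ eta0)[K _ hK].
pose D := \sum_(m <= k < K) w k * `|x k - x0|.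
have D0 : 0 <= D by apply: sumr_ge0 => k _; rewrite mulr_ge0.
move/cvgrPdist_le : hW => /(_ _ ltr01) hW.
near=> n.
have L1 : 2 * D / e + 1 <= L n by near: n; exact: hL.
have hWn : `|l - (\sum_(m <= k < n) w k) / L n| <= 1 by near: n.
have De : 0 <= 2 * D / e by rewrite divr_ge0 ?mulr_ge0// ltW.
have Ln0 : 0 < L n by lra.
have bound : `|\sum_(m <= k < n) w k * (x k - x0)| <= D + eta * \sum_(m <= k < n) w k.
  apply: le_trans (ler_norm_sum _ _ _) _.
  rewrite mulr_sumr.
  have -> : \sum_(m <= k < n) `|w k * (x k - x0)| = \sum_(m <= k < n) w k * `|x k - x0|.
    by apply: eq_bigr => k _; rewrite normrM ger0_norm.
  apply: le_trans (_ : \sum_(m <= k < n) ((if (k < K)%N then w k * `|x k - x0| else 0) + eta * w k) <= _).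
    apply: ler_sum => k _; case: ltnP => kK; first by rewrite lerDl mulr_ge0// ltW.
    by rewrite add0r mulrC ler_wpM2r// distrC hK.
  rewrite big_split/= lerD2r /D.
  rewrite -big_mkcond/=.
  have [nK|Kn] := leqP n K.
    have [mn|nm] := leqP m n; last by rewrite big_geq ?(ltnW nm)// sumr_ge0// => k _; rewrite mulr_ge0.
    rewrite [leRHS](@big_cat_nat _ _ _ n)//= ler_wpDr ?sumr_ge0// => [k _|].
      by rewrite mulr_ge0.
    by rewrite big_mkcond; apply: ler_sum => k _; case: ifP => // _; rewrite mulr_ge0.
  rewrite -(@big_nat_widen _ _ _ m K n predT)//; exact: ltnW.
rewrite sub0r normrN normrM normfV (gtr0_norm Ln0) ler_pdivrMr//.
apply: le_trans bound _.
have W1 : \sum_(m <= k < n) w k <= (`|l| + 1) * L n.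
  rewrite -ler_pdivrMr//; move: hWn; rewrite distrC => hWn.
  have := ler_normD ((\sum_(m <= k < n) w k) / L n - l) l; rewrite subrK => t1.
  by apply: le_trans (ler_norm _) _; apply: le_trans t1 _; rewrite addrC lerD2l.
have -> : e * L n = e / 2 * L n + eta * ((`|l| + 1) * L n).
  by rewrite /eta; field; rewrite gt_eqF.
rewrite lerD//; last by rewrite ler_wpM2l// ltW.
have : 2 * D / e <= L n by lra.
by rewrite ler_pdivrMr//; lra.
Unshelve. all: by end_near. Qed.

Definition sparse_time (i : nat) : nat := block_time (expR 1 : R) (i ^ 2).

Lemma expR1_gt1 : 1 < expR 1 :> R.
Proof. by rewrite expR_gt1. Qed.

Lemma lnln_sparse_time_ge i n : (sparse_time i <= n)%N ->
  i%:R ^+ 2 <= ln (ln n%:R) :> R.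
Proof.
move=> h; apply: le_ln_expR.
have -> : expR (i%:R ^+ 2) = expR 1 ^+ (i ^ 2) :> R by rewrite -expRM_natl mulr1 natrX.
apply: ltW; apply: lt_le_trans (ln_block_time_gt _ _) _.
by rewrite ler_ln ?posrE ?ltr0n ?ler_nat//; exact: leq_trans h.
Qed.

Lemma lnln_sparse_time_le i n : (1 < n)%N -> (n <= sparse_time i)%N ->
  ln (ln n%:R) <= i%:R ^+ 2 + 1 :> R.
Proof.
move=> n1 h; have n0 : (0 < n)%N by exact: ltnW.
have l0 : 0 < ln n%:R :> R by rewrite ln_gt0// ltr1n.
rewrite -[leRHS]expRK ler_ln ?posrE ?expR_gt0//.
apply: le_trans (_ : ln (sparse_time i)%:R <= _).
  by rewrite ler_ln ?posrE ?ltr0n ?ler_nat.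
apply: le_trans (ln_block_time_le _ (expR_ge0 _)) _.
have -> : expR (i%:R ^+ 2 + 1) = expR 1 ^+ (i ^ 2) * expR 1 :> R.
  by rewrite expRD -expRM_natl mulr1 natrX.
have e2 : 2 <= expR 1 :> R by have := expR_ge1Dx (1 : R); lra.
have y1 : 1 <= expR 1 ^+ (i ^ 2) :> R by rewrite exprn_ege1//; lra.
nra.
Qed.

Lemma sparse_time_exists I n : (sparse_time I <= n)%N ->
  exists2 i, (I <= i)%N & (sparse_time i <= n < sparse_time i.+1)%N.
Proof.
move=> In; have th1 := expR1_gt1.
have [j Ij /andP[jn nj]] := block_time_exists th1 In.
have ub i : (i ^ 2 <= j)%N -> (i <= j)%N by apply: leq_trans; case: i => // i; rewrite expnS leq_pmulr.
case: (@ex_maxnP (fun i => i ^ 2 <= j)%N j (ex_intro _ I Ij) ub) => i ij imax.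
exists i; first exact: imax.
rewrite (leq_trans _ jn)/=; last by apply: block_time_leq => //; exact: ltW.
apply: leq_trans nj _; apply: block_time_leq; first exact: ltW.
by rewrite ltnNge; apply/negP => /imax; rewrite ltnn.
Qed.

(** Consecutive values i^2 and (i+1)^2 of log log have ratio tending to 1, so monotonicity encloses
    C between its values at neighbouring sparse times. *)
Lemma sparse_interpolation C l : 0 <= l -> (forall n, 0 <= C n) -> nondecreasing_seq C ->
  (fun i => C (sparse_time i) / i%:R ^+ 2) @ \oo --> l ->
  (fun n => C n / ln (ln n%:R)) @ \oo --> l.
Proof.
move=> l0 C0 Cn hC; apply/cvgrPdist_le => e e0.
pose eta := Num.min 1 (e / (l + 3)).
have eta0 : 0 < eta by rewrite lt_min ltr01 divr_gt0//; lra.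
have eta1 : eta <= 1 by rewrite ge_min lexx.
have etae : eta * (l + 3) <= e by rewrite -ler_pdivlMr ?ge_min ?lexx ?orbT//; lra.
move/cvgrPdist_le : hC => /(_ _ eta0) hC.
have : \forall i \near \oo, [/\ `|l - C (sparse_time i) / i%:R ^+ 2| <= eta,
    `|l - C (sparse_time i.+1) / i.+1%:R ^+ 2| <= eta & 4 / eta <= i%:R].
  near=> i; split; first by near: i.
    by near: i; exact: (near_succ hC).
  by near: i; exact: nbhs_infty_ger.
case=> I _ hI; exists (maxn (sparse_time I) 2) => // n /=; rewrite geq_max => /andP[In n2].
have [i Ii /andP[in1 in2]] := sparse_time_exists In.
have [h1 h2 h3] := hI i Ii.
have g1 := lnln_sparse_time_ge in1; have g2 := lnln_sparse_time_le n2 (ltnW in2).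
have c1 : C (sparse_time i) <= C n by exact: Cn.
have c2 : C n <= C (sparse_time i.+1) by apply: Cn; exact: ltnW.
have i4 : 4 <= eta * i%:R by rewrite mulrC -ler_pdivrMr.
have i0 : 4 <= i%:R :> R by apply: le_trans i4 _; rewrite ler_piMl.
move: h1 h2 g2; rewrite -(@natr1 _ i) => h1 h2 g2.
have Cn0 := C0 n.
move: g1 g2 c1 c2 h1 h2 i0 i4 Cn0; move: (ln (ln n%:R)) (C n) (C (sparse_time i)) (C (sparse_time i.+1)) (i%:R : R).
move=> Ln c cm cM x g1 g2 c1 c2; rewrite !ler_norml => /andP[h1 h1'] /andP[h2 h2'] x4 ex c0.
have Ln0 : 0 < Ln by apply: lt_le_trans g1; rewrite exprn_gt0//; lra.
have {}h1 : (l - eta) * x ^+ 2 <= cm by rewrite -ler_pdivlMr ?exprn_gt0//; lra.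
have {}h2 : cM <= (l + eta) * (x + 1) ^+ 2 by rewrite -ler_pdivrMr ?exprn_gt0//; lra.
have x1 : (x + 1) ^+ 2 <= (1 + eta) * x ^+ 2 by rewrite !expr2; nra.
have x2 : (1 - eta) * ((x + 1) ^+ 2 + 1) <= x ^+ 2 by rewrite !expr2; nra.
have up : c <= (l + e) * Ln.
  apply: le_trans c2 _; apply: le_trans h2 _.
  apply: le_trans (_ : (l + eta) * ((1 + eta) * Ln) <= _).
    rewrite ler_wpM2l//; first by lra.
    by apply: le_trans x1 _; rewrite ler_wpM2l//; lra.
  by rewrite mulrA ler_wpM2r ?(ltW Ln0)//; nra.
have dn : (l - e) * Ln <= c.
  have [le|le] := leP (l - eta) 0.
    apply: le_trans c0; rewrite mulr_le0_ge0 ?(ltW Ln0)//; nra.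
  apply: le_trans c1; apply: le_trans h1.
  apply: le_trans (_ : (l - eta) * ((1 - eta) * Ln) <= _).
    by rewrite mulrA ler_wpM2r ?(ltW Ln0)//; nra.
  rewrite ler_wpM2l ?(ltW le)//; apply: le_trans x2; rewrite ler_wpM2l//; lra.
rewrite lerBrDr lerBlDr; apply/andP; split.
  rewrite addrC -lerBrDr; rewrite ler_pdivrMr//; lra.
by rewrite -lerBlDl ler_pdivlMr.
Unshelve. all: by end_near. Qed.

End averaging.

(** * Asymptotics of logarithms and iterated logarithms *)

Section log_limits.
Context {R : realType}.
Implicit Types (k n : nat).

Lemma cvg_natr_inv : (fun n => (n%:R : R)^-1) @ \oo --> (0 : R).
Proof. by apply: cvg_inv_unbounded => K; exact: nbhs_infty_ger. Qed.

Lemma lnln_unbounded (K : R) : \forall n \near \oo, K <= ln (ln n%:R).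
Proof.
near=> n; apply: le_ln_expR; near: n; exact: ln_unbounded.
Unshelve. all: by end_near. Qed.

Lemma cvg_ln_ratio : (fun k => ln k.+1%:R / ln k%:R : R) @ \oo --> (1 : R).
Proof.
apply: (@squeeze_cvgr _ _ _ _ (fun=> 1) (fun k => 1 + (k%:R : R)^-1)); last 2 first.
- exact: cvg_cst.
- by rewrite -[X in _ --> X]addr0; apply: cvgD; [exact: cvg_cst|exact: cvg_natr_inv].
near=> k; have k0 : (0 < k)%N by near: k; exact: nbhs_infty_gt.
have l1 : 1 <= ln k%:R :> R by near: k; exact: ln_unbounded.
have h1 := @ln_succ_le R k k0; have h2 := @ln_succ_ge R k k0.
have i0 : 0 < k.+1%:R^-1 :> R by rewrite invr_gt0.
have i1 : 0 < k%:R^-1 :> R by rewrite invr_gt0 ltr0n.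
have l0 : 0 < ln k%:R :> R by exact: lt_le_trans l1.
rewrite ler_pdivlMr// ler_pdivrMr// mul1r.
move: (ln k.+1%:R) (ln k%:R) (k%:R^-1) (k.+1%:R^-1) h1 h2 i0 i1 l0 l1 => u v x y; nra.
Unshelve. all: by end_near. Qed.

Lemma cvg_ln_increment : (fun k => k%:R * (ln k.+1%:R - ln k%:R) : R) @ \oo --> (1 : R).
Proof.
apply: (@squeeze_cvgr _ _ _ _ (fun k => 1 - harmonic k) (fun=> 1)); last 2 first.
- by rewrite -[X in _ --> X]subr0; apply: cvgB; [exact: cvg_cst|exact: cvg_harmonic].
- exact: cvg_cst.
near=> k; have k0 : (0 < k)%N by near: k; exact: nbhs_infty_gt.
have h1 := @ln_succ_le R k k0; have h2 := @ln_succ_ge R k k0.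
have kp : 0 < k%:R :> R by rewrite ltr0n.
apply/andP; split.
  apply: le_trans (ler_wpM2l (ltW kp) h2).
  rewrite /harmonic/= -natr1 le_eqVlt; apply/orP; left; apply/eqP; field.
  by rewrite gt_eqF// ltr_wpDr.
by apply: le_trans (ler_wpM2l (ltW kp) h1) _; rewrite mulfV// gt_eqF.
Unshelve. all: by end_near. Qed.

Lemma lnln_succ_le k : (2 <= k)%N ->
  ln (ln k.+1%:R) - ln (ln k%:R) <= (k%:R * ln k%:R)^-1 :> R.
Proof.
move=> k2; have h1 := @ln_ge_half R k k2; have h2 := @ln_ge_half R k.+1 (leqW k2).
have h3 := @ln_succ_le R k (ltnW k2).
rewrite invfM; move: h1 h2 h3; move: (ln k.+1%:R) (ln k%:R) (k%:R^-1) => u v x h1 h2 h3.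
rewrite -ln_div ?posrE; [|lra|lra].
have v0 : 0 < v by lra.
rewrite (_ : _ / _ = 1 + (u - v) / v); last by field; lra.
apply: le_trans (le_ln1Dx _) _; first by rewrite ltr_pdivlMr//; lra.
by rewrite ler_pM2r ?invr_gt0.
Qed.

Lemma cvg_loglog_weight :
  (fun n => (\sum_(2 <= k < n) (k.+1%:R * ln k.+1%:R)^-1) / ln (ln n%:R) : R) @ \oo --> (1 : R).
Proof.
have hu n : (2 <= n)%N -> \sum_(2 <= k < n) (k.+1%:R * ln k.+1%:R)^-1 <= ln (ln n%:R) - ln (ln 2%:R) :> R.
  move=> n2; rewrite -(telescope_sumr (fun k => ln (ln k%:R) : R) n2).
  by apply: ler_sum_nat => k /andP[k2 _]; exact: lnln_succ_ge.
have hl n : (2 <= n)%N -> ln (ln n.+1%:R) - ln (ln 3%:R) <= \sum_(2 <= k < n) (k.+1%:R * ln k.+1%:R)^-1 :> R.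
  move=> n2; rewrite -(telescope_sumr (fun k => ln (ln k.+1%:R) : R) n2).
  by apply: ler_sum_nat => k /andP[k2 _]; apply: lnln_succ_le; exact: leqW.
apply: (@squeeze_cvgr _ _ _ _ (fun n => 1 - ln (ln 3%:R) * (ln (ln n%:R))^-1)
  (fun n => 1 - ln (ln 2%:R) * (ln (ln n%:R))^-1)); last 2 first.
- rewrite -[X in _ --> X]subr0 -[X in _ --> _ - X](mulr0 (ln (ln 3%:R))).
  apply: cvgB; first exact: cvg_cst.
  by apply: cvgMr; exact: (cvg_inv_unbounded lnln_unbounded).
- rewrite -[X in _ --> X]subr0 -[X in _ --> _ - X](mulr0 (ln (ln 2%:R))).
  apply: cvgB; first exact: cvg_cst.
  by apply: cvgMr; exact: (cvg_inv_unbounded lnln_unbounded).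
near=> n; have n2 : (2 <= n)%N by near: n; exact: nbhs_infty_ge.
have L1 : 1 <= ln (ln n%:R) :> R by near: n; exact: lnln_unbounded.
have L0 : 0 < ln (ln n%:R) :> R by exact: lt_le_trans L1.
have h1 := hu n n2; have h2 := hl n n2.
have h3 : ln (ln n%:R) <= ln (ln n.+1%:R) :> R.
  have a1 := @ln_ge_half R n n2; have a2 := @ln_ge_half R n.+1 (leqW n2).
  rewrite ler_ln ?posrE; [|lra|lra].
  by rewrite ler_ln ?posrE ?ltr0n// ?ler_nat// ltnW.
have e (z : R) : 1 - z * (ln (ln n%:R))^-1 = (ln (ln n%:R) - z) / ln (ln n%:R).
  by rewrite mulrBl divff// gt_eqF.
rewrite !e !ler_pM2r ?invr_gt0//; lra.
Unshelve. all: by end_near. Qed.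

Lemma cvg_lnln_ratio : (fun n => ln (ln n.+1%:R) / ln (ln n%:R) : R) @ \oo --> (1 : R).
Proof.
apply: (@squeeze_cvgr _ _ _ _ (fun=> 1) (fun k => 1 + (k%:R : R)^-1)); last 2 first.
- exact: cvg_cst.
- by rewrite -[X in _ --> X]addr0; apply: cvgD; [exact: cvg_cst|exact: cvg_natr_inv].
near=> n; have n2 : (2 <= n)%N by near: n; exact: nbhs_infty_ge.
have L1 : 1 <= ln (ln n%:R) :> R by near: n; exact: lnln_unbounded.
have l1 : 1 <= ln n%:R :> R by near: n; exact: ln_unbounded.
have L0 : 0 < ln (ln n%:R) :> R by exact: lt_le_trans L1.
have h1 := @lnln_succ_le n n2.
have h2 : 0 <= ln (ln n.+1%:R) - ln (ln n%:R) :> R.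
  apply: le_trans (@lnln_succ_ge R n n2); rewrite invr_ge0 mulr_ge0// ln_ge0//.
  by rewrite ler1n.
have h3 : (n%:R * ln n%:R)^-1 <= n%:R^-1 :> R.
  by rewrite invfM ler_piMr ?invr_ge0// invf_le1//; lra.
have h4 : 0 <= n%:R^-1 :> R by rewrite invr_ge0.
rewrite ler_pdivlMr// ler_pdivrMr// mul1r.
have gen (u v x y : R) : u - v <= x -> x <= y -> 0 <= y -> 1 <= v -> 0 <= u - v ->
  (v <= u) && (u <= (1 + y) * v) by nra.
exact: gen h1 h3 h4 L1 h2.
Unshelve. all: by end_near. Qed.

Lemma cvg_sparse_time : @sparse_time R @ \oo --> \oo.
Proof.
move=> A [N _ hN].
have [J _ hJ] := near_at_block_time (@expR1_gt1 R) (nbhs_infty_ge N).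
exists J => // i /= Ji; apply: hN; apply: hJ => /=; apply: leq_trans Ji _.
by case: i => // i; rewrite expnS leq_pmulr// expn_gt0.
Qed.

Lemma sparse_time_near N : \forall i \near \oo, (N <= @sparse_time R i)%N.
Proof. exact: (cvg_sparse_time (nbhs_infty_ge N)). Qed.

Lemma cvg_sparse_ratio :
  (fun i => ln (ln (@sparse_time R i)%:R) / i%:R ^+ 2 : R) @ \oo --> (1 : R).
Proof.
apply: (@squeeze_cvgr _ _ _ _ (fun=> 1) (fun k => 1 + (k%:R : R)^-1)); last 2 first.
- exact: cvg_cst.
- by rewrite -[X in _ --> X]addr0; apply: cvgD; [exact: cvg_cst|exact: cvg_natr_inv].
near=> i; have i0 : (1 <= i)%N by near: i; exact: nbhs_infty_ge.
have n2 : (2 <= @sparse_time R i)%N.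
  by near: i; exact: sparse_time_near.
have h1 := lnln_sparse_time_ge (leqnn (@sparse_time R i)).
have h2 := lnln_sparse_time_le n2 (leqnn (@sparse_time R i)).
have i1 : 1 <= i%:R :> R by rewrite ler1n.
have ip : 0 < i%:R ^+ 2 :> R by rewrite exprn_gt0//; lra.
rewrite ler_pdivlMr// ler_pdivrMr// mul1r h1/=; apply: le_trans h2 _.
rewrite mulrDl mul1r lerD2l expr2 mulKf//; lra.
Unshelve. all: by end_near. Qed.

End log_limits.

(** * Law of large numbers and quadratic strong law *)

Section quadratic_law.
Context (R : realType) (d : measure_display) (T : measurableType d)
    (P : probability T R) (p q s : R)
    (alpha beta X : nat -> {RV P >-> R}) (U : nat -> {RV P >-> nat})
    (S : nat -> T -> R).
Hypotheses (hp : 0 <= p <= 1) (hq : 0 <= q <= 1) (hs : 0 <= s <= 1)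
    (hS : minimal_random_walk p q s alpha beta X U S)
    (ha : p - q = 1 / 2).

Let q_half := mrw_q_half hp hq ha.
Local Notation v := (mrw_var q).
Local Notation c := (@scale_lim R).
Local Notation mart := (mart q).
Local Notation word := (word X).
Local Notation LL n := (ln (ln n%:R) : R).

Lemma sq_noise_ae : {ae P, forall t,
  (fun i => sq_noise q s (word (@sparse_time R i) t) / i%:R ^+ 2) @ \oo --> (0 : R)}.
Proof.
have h : {ae P, forall t, forall m : nat, \forall i \near \oo,
    ~ (m.+1%:R^-1 * i%:R ^+ 2 <= `|sq_noise q s (word (@sparse_time R i) t)|)}.
  apply: ae_foralln => m; set eps : R := m.+1%:R^-1.
  have eps0 : 0 < eps by rewrite invr_gt0.
  have [C hC] := @sum_expR_ln_bounded R 2 ltac:(lra).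
  (* 88 = 22 * 4: the second moment is at most 22 (3 + i^2) <= 88 i^2, and dividing by (eps i^2)^2
     leaves a summable i^(-2). *)
  pose D := 88 / eps ^+ 2; have D0 : 0 <= D by rewrite divr_ge0 ?sqr_ge0.
  pose A i z := eps * i%:R ^+ 2 <= `|sq_noise q s z|.
  pose E i := [set t | A i (word (@sparse_time R i) t)].
  apply: (@borel_cantelli_ae R d T P E (fun j => D * expR (- (2 * ln j%:R))) (D * C)).
  - by move=> j; exact: measurable_word_event.
  - near=> i; rewrite /E (pr_word_event hp hq hs hS ha).
    have i0 : (1 <= i)%N by near: i; exact: nbhs_infty_ge.
    have i1 : 1 <= i%:R :> R by rewrite ler1n.
    have n2 : (2 <= @sparse_time R i)%N.
      by near: i; exact: sparse_time_near.
    have ip : 0 < eps * i%:R ^+ 2 by rewrite mulr_gt0// exprn_gt0//; lra.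
    apply: le_trans (_ : expect q s (@sparse_time R i)
      (fun z => (eps * i%:R ^+ 2) ^- 2 * sq_noise q s z ^+ 2) [::] <= _).
      apply: expect_le => // z _ _; rewrite /A.
      have [hA|_] := leP (eps * i%:R ^+ 2) `|sq_noise q s z|; last first.
        by rewrite mulr_ge0 ?sqr_ge0// invr_ge0 sqr_ge0.
      rewrite ler_pdivlMl ?exprn_gt0// mulr1 -[leRHS](real_normK (num_real _)).
      by rewrite lerXn2r ?nnegrE// ltW.
    rewrite expectZ.
    have h1 := expect_sq_noise q_half hs n2.
    have h2 := lnln_sparse_time_le n2 (leqnn (@sparse_time R i)).
    have h3 : 22 * (2 + LL (@sparse_time R i)) <= 88 * i%:R ^+ 2.
      have : 1 <= i%:R ^+ 2 :> R by rewrite exprn_ege1.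
      by move: h2; move: (LL _) (i%:R ^+ 2) => x y; lra.
    have ik : 0 <= (eps * i%:R ^+ 2) ^- 2 by rewrite invr_ge0 sqr_ge0.
    apply: le_trans (ler_wpM2l ik (le_trans h1 h3)) _.
    have -> : expR (- (2 * ln i%:R)) = (i%:R ^+ 2)^-1 :> R.
      by rewrite expRN expRM_natl lnK// posrE; lra.
    rewrite /D le_eqVlt; apply/orP; left; apply/eqP; field.
    by apply/andP; split; rewrite lt0r_neq0//; lra.
  - by move=> j; rewrite mulr_ge0 ?expR_ge0.
  - by move=> n; rewrite -mulr_sumr ler_wpM2l.
apply: filterS h => t h; apply/cvgrPdist_le => e e0.
have [m hm] : exists m : nat, m.+1%:R^-1 <= e.
  exists (Num.truncn e^-1); rewrite invf_ple ?posrE//; apply: ltW; exact: truncnS_gt.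
near=> i; have i0 : (1 <= i)%N by near: i; exact: nbhs_infty_ge.
have ip : 0 < i%:R ^+ 2 :> R by rewrite exprn_gt0// ltr0n.
have hi : ~ (m.+1%:R^-1 * i%:R ^+ 2 <= `|sq_noise q s (word (@sparse_time R i) t)|).
  by near: i; exact: h.
rewrite sub0r normrN normrM normfV (gtr0_norm ip) ler_pdivrMr//.
move/negP : hi; rewrite -ltNge => /ltW/le_trans; apply.
by rewrite ler_wpM2r// ltW.
Unshelve. all: by end_near. Qed.

Definition abel_sum t n : R :=
  \sum_(2 <= k < n) mart (word k t) ^+ 2 * ((ln k%:R)^-1 - (ln k.+1%:R)^-1).

Definition cond_var t k : R :=
  succ_prob q s (word k t) * (1 - succ_prob q s (word k t)).

(** A pointwise summation by parts: the increment of M_k^2 / ln k is the change of weight, plus the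
    conditional variance, plus the noise. It starts at 2, the first index with ln k > 0, hence the
    boundary terms. *)
Lemma abel_sumE t n : (2 <= n)%N -> abel_sum t n =
  \sum_(2 <= k < n) (k.+1%:R * ln k.+1%:R)^-1 * (scale_sq k.+1 * cond_var t k)
  + (sq_noise q s (word n t) - sq_noise q s (word 2 t))
  - mart (word n t) ^+ 2 / ln n%:R + mart (word 2 t) ^+ 2 / ln 2%:R.
Proof.
rewrite /abel_sum; elim: n => // n IH; rewrite leq_eqVlt => /predU1P[<-|n2].
  by rewrite !big_geq// subrr addr0 add0r addrC subrr.
have recr (f : nat -> R) : \sum_(2 <= k < n.+1) f k = \sum_(2 <= k < n) f k + f n.
  by rewrite big_nat_recr.
rewrite !recr IH//.
set N2 := sq_noise q s (word 2 t); set W2 := mart (word 2 t) ^+ 2 / _; clearbody N2 W2.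
have n0 : (0 < size (word n t))%N by rewrite size_word; apply: ltnW.
rewrite [word n.+1 t]/= (@mart_sq_cons R q s _ _ n0) [sq_noise _ _ (_ :: _)]/= size_word -/(cond_var t n).
have -> : mart_scale n.+1 ^+ 2 = scale_sq n.+1 / n.+1%:R :> R by rewrite mart_scale_sq.
rewrite (invfM n.+1%:R); ring.
Qed.

Lemma centered_cvg0 t : (\forall n \near \oo, mart (word n t) ^+ 2 <= 1 * lil_norm n) ->
  (fun n => centered q (word n t) / n%:R) @ \oo --> (0 : R).
Proof.
move=> ut; apply/cvgrPdist_le => e e0; near=> n.
have u1 : mart (word n t) ^+ 2 <= 1 * lil_norm n by near: n.
have u2 : lil_norm n <= 2 * ln n%:R ^+ 2 :> R by near: n; exact: lil_norm_le_ln_sq.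
have n0 : (0 < n)%N by near: n; exact: nbhs_infty_gt.
(* 24 = 4 * 6: the squared ratio is at most 4 ln^2 n / n, and n >= ln^3 n / 6. *)
have l1 : 24 / e ^+ 2 + 1 <= ln n%:R :> R by near: n; exact: ln_unbounded.
have e2 : 0 < e ^+ 2 by rewrite exprn_gt0.
have np : 0 < n%:R :> R by rewrite ltr0n.
have l0 : 24 <= e ^+ 2 * ln n%:R by rewrite mulrC -ler_pdivrMr//; lra.
have lp : 0 < ln n%:R :> R.
  by apply: lt_le_trans l1; rewrite ltr_wpDl// divr_ge0// ltW.
have n3 : ln n%:R ^+ 3 / 6 <= n%:R :> R.
  have := @expR_ge1Dxn R (ln n%:R) 2 (ltW lp).
  by rewrite lnK ?posrE// -[3`!%:R]/(6%:R); lra.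
have cs : 2^-1 <= scale_sq n :> R by exact: le_trans (@scale_lim_ge R) (@scale_lim_le R n n0).
rewrite sub0r normrN -(ler_pXn2r (ltn0Sn 1)) ?nnegrE ?(ltW e0)// real_normK ?num_real//.
have mE : mart (word n t) ^+ 2 = scale_sq n / n%:R * centered q (word n t) ^+ 2.
  by rewrite martE size_word exprMn mart_scale_sq.
rewrite expr_div_n ler_pdivrMr ?exprn_gt0//.
have h1 : 2^-1 * centered q (word n t) ^+ 2 <= n%:R * (2 * ln n%:R ^+ 2).
  apply: le_trans (_ : scale_sq n * centered q (word n t) ^+ 2 <= _).
    by rewrite ler_wpM2r ?sqr_ge0.
  rewrite -ler_pdivrMl// mulrA (mulrC _^-1) -mE.
  by apply: le_trans u1 _; rewrite mul1r.
have h2 : 4 * ln n%:R ^+ 2 <= e ^+ 2 * n%:R.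
  apply: le_trans (ler_wpM2l (ltW e2) n3).
  rewrite exprS; have := sqr_ge0 (ln n%:R : R).
  by move: (ln n%:R : R) (e ^+ 2) l0 => l f l0 l2; nra.
have h3 := ler_wpM2l (ltW np) h2.
have gen (C N L F : R) : 2^-1 * C <= N * (2 * L) -> N * (4 * L) <= N * (F * N) -> C <= F * (N * N) by lra.
by rewrite (expr2 n%:R); exact: gen h1 h3.
Unshelve. all: by end_near. Qed.

Lemma cond_var_cvg t : (fun n => centered q (word n t) / n%:R) @ \oo --> (0 : R) ->
  (fun k => scale_sq k.+1 * cond_var t k) @ \oo --> c * v.
Proof.
move=> h; apply: cvgM; first exact: cvg_scale_sq.
apply/cvgrPdist_le => e e0; move/cvgrPdist_le : h => /(_ _ e0) h; near=> n.
have n0 : (0 < n)%N by near: n; exact: nbhs_infty_gt.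
have np : 0 < n%:R :> R by rewrite ltr0n.
have : `|0 - centered q (word n t) / n%:R| <= e by near: n.
rewrite sub0r normrN normrM normfV (gtr0_norm np); apply: le_trans; rewrite distrC.
have w0 : (0 < size (word n t))%N by rewrite size_word.
apply: le_trans (cond_var_le q_half hs w0) _; rewrite size_word.
rewrite ler_wpM2l// lef_pV2 ?posrE ?mulr_gt0//; lra.
Unshelve. all: by end_near. Qed.

(** The upper bound makes M_n^2 / ln n of order ln ln ln n, and ln x <= 2 sqrt x makes this
    negligible against ln ln n. *)
Lemma mart_sq_negligible t : (\forall n \near \oo, mart (word n t) ^+ 2 <= 1 * lil_norm n) ->
  (fun n => mart (word n t) ^+ 2 / ln n%:R / LL n) @ \oo --> (0 : R).
Proof.
move=> ut; apply/cvgrPdist_le => e e0; near=> n.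
have u1 : mart (word n t) ^+ 2 <= 1 * lil_norm n by near: n.
have n0 : (0 < n)%N by near: n; exact: nbhs_infty_gt.
have l1 : 1 <= ln n%:R :> R by near: n; exact: ln_unbounded.
have L1 : 16 / e ^+ 2 + 1 <= LL n by near: n; exact: lnln_unbounded.
have l3 : 0 <= ln (LL n) by near: n; exact: lnlnln_unbounded.
have e2 : 0 < e ^+ 2 by rewrite exprn_gt0.
have L0 : 0 < LL n by apply: lt_le_trans L1; rewrite ltr_wpDl// divr_ge0// ltW.
have lp : 0 < ln n%:R :> R by exact: lt_le_trans l1.
have L2 : 16 <= e ^+ 2 * LL n by rewrite mulrC -ler_pdivrMr//; lra.
have s0 : 0 < Num.sqrt (LL n) by rewrite sqrtr_gt0.
have sE : LL n = Num.sqrt (LL n) ^+ 2 by rewrite sqr_sqrtr// ltW.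
have h3 : ln (LL n) <= 2 * Num.sqrt (LL n).
  have -> : ln (LL n) = 2 * ln (Num.sqrt (LL n)).
    by rewrite -[in LHS](sqr_sqrtr (ltW L0)) lnXn// mulr_natl.
  by rewrite ler_pM2l//; apply: ltW; exact: ln_sublinear.
have s4 : 4 <= e * Num.sqrt (LL n).
  rewrite -(ler_pXn2r (ltn0Sn 1)) ?nnegrE// ?mulr_ge0 ?(ltW s0) ?(ltW e0)//.
  by rewrite exprMn -sE; lra.
have a1 := @scale_sq_le1 R n.
have a0 : 0 <= scale_sq n :> R by apply: ltW; exact: scale_sq_gt0.
rewrite sub0r normrN ger0_norm; last first.
  by apply: divr_ge0; [apply: divr_ge0; [exact: sqr_ge0|exact: ltW]|exact: ltW].
rewrite -mulrA -invfM ler_pdivrMr ?mulr_gt0//.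
apply: le_trans u1 _; rewrite mul1r /lil_norm.
apply: le_trans (_ : 1 * (2 * ln n%:R * ln (LL n)) <= _).
  rewrite (_ : 2 * scale_sq n * ln n%:R * ln (LL n) = scale_sq n * (2 * ln n%:R * ln (LL n))); last by ring.
  have k0 : 0 <= 2 * ln n%:R * ln (LL n) by exact: mulr_ge0 (mulr_ge0 (ler0n R 2) (ltW lp)) l3.
  exact: ler_wpM2r.
rewrite mul1r; have gen (l u w f : R) : u <= 2 * w -> 4 <= f * w -> 0 < w -> 0 < l ->
  2 * l * u <= f * (l * w ^+ 2).
  move=> h1 h2 w1 l2; have lw : 0 < l * w by exact: mulr_gt0.
  have h5 := ler_wpM2l (ltW l2) h1; have h6 := ler_wpM2l (ltW lw) h2.
  rewrite expr2; lra.
by have := gen _ _ _ _ h3 s4 s0 lp; rewrite -sE.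
Unshelve. all: by end_near. Qed.

Lemma abel_weight_ge0 k : (2 <= k)%N -> 0 <= (ln k%:R)^-1 - (ln k.+1%:R)^-1 :> R.
Proof.
move=> k2; have l0 : 0 < ln k%:R :> R by rewrite ln_gt0// ltr1n.
have l1 : ln k%:R <= ln k.+1%:R :> R.
  by rewrite ler_ln ?posrE ?ltr0n// ?ler_nat// ltnW.
by rewrite subr_ge0 lef_pV2 ?posrE// (lt_le_trans l0).
Qed.

Lemma abel_sum_ge0 t n : 0 <= abel_sum t n.
Proof.
rewrite /abel_sum big_nat_cond; apply: sumr_ge0 => k /andP[/andP[k2 _] _].
by apply: mulr_ge0; [exact: sqr_ge0|exact: abel_weight_ge0].
Qed.

Lemma abel_sum_nondecreasing t : nondecreasing_seq (abel_sum t).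
Proof.
apply/nondecreasing_seqP => n; have [n2|n2] := ltnP n 2.
  by rewrite {1}/abel_sum big_geq ?abel_sum_ge0// ltnW.
rewrite /abel_sum (@big_nat_recr _ _ _ n 2)// lerDl.
by apply: mulr_ge0; [exact: sqr_ge0|exact: abel_weight_ge0].
Qed.

Lemma abel_sum_cvg t :
  (\forall n \near \oo, mart (word n t) ^+ 2 <= 1 * lil_norm n) ->
  (fun i => sq_noise q s (word (@sparse_time R i) t) / i%:R ^+ 2) @ \oo --> (0 : R) ->
  (fun n => abel_sum t n / LL n) @ \oo --> c * v.
Proof.
move=> ut nt; have /andP[v0 _] := mrw_var_itv q_half.
have c0 : 0 <= c by apply: le_trans (@scale_lim_ge R).
apply: sparse_interpolation; first exact: mulr_ge0.
- exact: abel_sum_ge0.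
- exact: abel_sum_nondecreasing.
have hD : (fun n => (\sum_(2 <= k < n) (k.+1%:R * ln k.+1%:R)^-1 *
    (scale_sq k.+1 * cond_var t k)) / LL n) @ \oo --> 1 * (c * v).
  apply: weighted_average_cvg.
  - by move=> k; rewrite invr_ge0; apply: mulr_ge0 => //; rewrite ln_ge0// ler1n.
  - exact: lnln_unbounded.
  - exact: cvg_loglog_weight.
  - exact: cond_var_cvg (centered_cvg0 ut).
have hM := mart_sq_negligible ut.
have sD := cvg_comp _ _ (@cvg_sparse_time R) hD.
have sM := cvg_comp _ _ (@cvg_sparse_time R) hM.
have sr := @cvg_sparse_ratio R.
have si : (fun i => (i%:R ^+ 2 : R)^-1) @ \oo --> (0 : R).
  apply: cvg_inv_unbounded => K; near=> i.
  have i1 : (1 <= i)%N by near: i; exact: nbhs_infty_ge.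
  have iK : K <= i%:R :> R by near: i; exact: nbhs_infty_ger.
  by apply: le_trans iK _; rewrite expr2 ler_peMr// ler1n.
set N2 := sq_noise q s (word 2 t); set W2 := mart (word 2 t) ^+ 2 / ln 2%:R.
have sc : (fun i => (W2 - N2) * (i%:R ^+ 2)^-1) @ \oo --> (W2 - N2) * 0 by exact: cvgMr.
pose A n := (\sum_(2 <= k < n) (k.+1%:R * ln k.+1%:R)^-1 * (scale_sq k.+1 * cond_var t k)) / LL n.
pose r i := LL (@sparse_time R i) / i%:R ^+ 2.
have lim : (fun i => A (@sparse_time R i) * r i +
    (sq_noise q s (word (@sparse_time R i) t) / i%:R ^+ 2 + (W2 - N2) * (i%:R ^+ 2)^-1) -
    mart (word (@sparse_time R i) t) ^+ 2 / ln (@sparse_time R i)%:R / LL (@sparse_time R i) * r i)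
    @ \oo --> c * v.
  have -> : c * v = 1 * (c * v) * 1 + (0 + (W2 - N2) * 0) - 0 * 1 by ring.
  by apply: cvgB; [apply: cvgD; [exact: cvgM sD sr|exact: cvgD]|exact: cvgM sM sr].
apply: cvg_trans lim; apply: near_eq_cvg; near=> i.
have n2 : (2 <= @sparse_time R i)%N by near: i; exact: sparse_time_near.
have i0 : (0 < i)%N by near: i; exact: nbhs_infty_gt.
have i2 : i%:R ^+ 2 != 0 :> R by rewrite expf_neq0// pnatr_eq0 -lt0n.
have L0 : LL (@sparse_time R i) != 0.
  rewrite gt_eqF//; apply: lt_le_trans (lnln_sparse_time_ge (leqnn _)).
  by rewrite exprn_gt0// ltr0n.
rewrite (abel_sumE t n2) -/N2 -/W2 /A /r.
set x := LL _ in L0 *; set y := i%:R ^+ 2 in i2 *.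
set A' := \sum_(_ <= _ < _) _; clearbody A'; set B := mart _ ^+ 2 / _; clearbody B N2 W2.
by field; rewrite i2 L0.
Unshelve. all: by end_near. Qed.

Lemma quadratic_law t :
  (\forall n \near \oo, mart (word n t) ^+ 2 <= 1 * lil_norm n) ->
  (fun i => sq_noise q s (word (@sparse_time R i) t) / i%:R ^+ 2) @ \oo --> (0 : R) ->
  (fun n => 1 / LL n * \sum_(2 <= k < n.+1)
     (1 / ln k%:R) ^+ 2 * (centered q (word k t) / k%:R) ^+ 2) @ \oo --> v.
Proof.
move=> ut nt; have c0 : 0 < c by apply: lt_le_trans (@scale_lim_ge R).
have cn : c != 0 by rewrite gt_eqF.
(* The absolute value is harmless for k >= 2 and makes the weights nonnegative at every index. *)
pose w k := mart (word k t) ^+ 2 * `|(ln k%:R)^-1 - (ln k.+1%:R)^-1|.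
(* Ratio of the desired summand to that of [abel_sum]; it tends to 1/c because 1/ln k - 1/ln (k+1)
   is equivalent to 1/(k ln^2 k). *)
pose x k : R := ln k.+1%:R / ln k%:R * (scale_sq k)^-1 * (k%:R * (ln k.+1%:R - ln k%:R))^-1.
have hx : x @ \oo --> 1 * c^-1 * 1^-1.
  apply: cvgM; last by apply: cvgV; [exact: oner_neq0|exact: cvg_ln_increment].
  apply: cvgM; first exact: cvg_ln_ratio.
  by apply: cvgV => //; rewrite -(cvg_shiftS (@scale_sq R)); exact: cvg_scale_sq.
have hw : (fun n => (\sum_(2 <= k < n) w k) / LL n) @ \oo --> c * v.
  have -> : (fun n => (\sum_(2 <= k < n) w k) / LL n) = (fun n => abel_sum t n / LL n).
    apply/funext => n; congr (_ / _); apply: eq_big_nat => k /andP[k2 _].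
    by rewrite /w ger0_norm// abel_weight_ge0.
  exact: abel_sum_cvg.
have w0 k : 0 <= w k by apply: mulr_ge0; [exact: sqr_ge0|exact: normr_ge0].
have h := weighted_average_cvg w0 (@lnln_unbounded R) hw hx.
(* The desired sum includes k = n, hence the shift by one and the ratio of iterated logarithms. *)
have h' : (fun n => (\sum_(2 <= k < n.+1) w k * x k) / LL n.+1 * (LL n.+1 / LL n)) @ \oo --> v.
  have -> : v = c * v * (1 * c^-1 * 1^-1) * 1 by rewrite invr1 !mulr1 mul1r mulrAC divff// mul1r.
  by move: h; rewrite -cvg_shiftS => h; exact: cvgM h (@cvg_lnln_ratio R).
apply: cvg_trans h'; apply: near_eq_cvg; near=> n.
have L1 : 1 <= LL n by near: n; exact: lnln_unbounded.
have n2 : (2 <= n)%N by near: n; exact: nbhs_infty_ge.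
have L2 : LL n.+1 != 0.
  rewrite gt_eqF//; have := @lnln_succ_ge R n n2.
  have : 0 <= (n.+1%:R * ln n.+1%:R)^-1 :> R.
    by rewrite invr_ge0 mulr_ge0// ln_ge0// ler1n.
  have gen (a y z : R) : 0 <= a -> a <= y - z -> 1 <= z -> 0 < y by lra.
  by move=> h1 h2; exact: gen h1 h2 L1.
have -> : \sum_(2 <= k < n.+1) w k * x k =
   \sum_(2 <= k < n.+1) (1 / ln k%:R) ^+ 2 * (centered q (word k t) / k%:R) ^+ 2.
  apply: eq_big_nat => k /andP[k2 _]; have k0 : (0 < k)%N by exact: ltnW.
  rewrite /w ger0_norm ?abel_weight_ge0// /x.
  have -> : mart (word k t) ^+ 2 = scale_sq k / k%:R * centered q (word k t) ^+ 2.
    by rewrite martE size_word exprMn mart_scale_sq.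
  have a0 := @scale_sq_gt0 R k k0.
  have l0 : 0 < ln k%:R :> R by rewrite ln_gt0// ltr1n.
  have l1 : ln k%:R < ln k.+1%:R :> R by rewrite ltr_ln ?posrE ?ltr0n// ltr_nat.
  have kp : 0 < k%:R :> R by rewrite ltr0n.
  have gen (a l m K C : R) : 0 < a -> 0 < l -> l < m -> 0 < K ->
    a / K * C ^+ 2 * (l^-1 - m^-1) * (m / l * a^-1 * (K * (m - l))^-1) = (1 / l) ^+ 2 * (C / K) ^+ 2.
    move=> a1 l2 lm K1; field; rewrite !gt_eqF ?subr_gt0//; lra.
  exact: gen.
set A := \sum_(_ <= _ < _) _; clearbody A.
by field; rewrite L2 gt_eqF//; lra.
Unshelve. all: by end_near. Qed.

Lemma quadratic_law_ae : {ae P, forall t,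
  (fun n => 1 / LL n * \sum_(2 <= k < n.+1)
     (1 / ln k%:R) ^+ 2 * (centered q (word k t) / k%:R) ^+ 2) @ \oo --> v}.
Proof.
apply: filterS2 (upper_lil hp hq hs hS ha (mrw_var_lt1 hp hq ha)) sq_noise_ae => t.
exact: quadratic_law.
Qed.

Lemma centered_cvg0_ae :
  {ae P, forall t, (fun n => centered q (word n t) / n%:R) @ \oo --> (0 : R)}.
Proof.
apply: filterS (upper_lil hp hq hs hS ha (mrw_var_lt1 hp hq ha)) => t.
exact: centered_cvg0.
Qed.

End quadratic_law.

(** * Upper limits of real sequences *)

Section limsup.
Context {R : realType}.
Implicit Types (w u : nat -> R) (l : R).

Lemma limn_esup_fin u l :
  (forall e : R, 0 < e -> \forall n \near \oo, u n <= l + e) ->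
  (forall e : R, 0 < e -> forall N, exists2 n, (N <= n)%N & l - e <= u n) ->
  limn_esup (fun n => (u n)%:E) = l%:E.
Proof.
move=> hu hl; apply/eqP; rewrite eq_le; apply/andP; split.
  apply/lee_addgt0Pr => e e0; apply: (@le_trans _ _ (ereal_sup
    ((fun n => (u n)%:E) @` [set n | u n <= l + e]))).
    by apply: ereal_inf_lbound; exists [set n | u n <= l + e] => //; exact: hu.
  by apply: ge_ereal_sup => _ [n /= h <-]; rewrite -EFinD lee_fin.
apply: le_ereal_inf_tmp => _ [V [N _ hN] <-]; apply/lee_addgt0Pr => e e0.
have [n Nn hn] := hl e e0 N.
apply: (@le_trans _ _ ((u n)%:E + e%:E)%E); first by rewrite -EFinD lee_fin -lerBlDr.
by rewrite leeD2r//; apply: ereal_sup_ubound; exists n => //; exact: hN.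
Qed.

(** The upper bound concerns |u|, as squaring mixes both tails. Equality with the square is asked
    only eventually: for small n [lil_rate] can be negative, where its square root is 0. *)
Lemma limn_esup_sqr w u l : 0 <= l -> (\forall n \near \oo, w n = u n ^+ 2) ->
  (forall e : R, 0 < e -> \forall n \near \oo, `|u n| <= l + e) ->
  (forall e : R, 0 < e -> forall N, exists2 n, (N <= n)%N & l - e <= u n) ->
  limn_esup (fun n => (w n)%:E) = (l ^+ 2)%:E.
Proof.
move=> l0 wE hu hl.
have del (e : R) : 0 < e -> exists2 x, 0 < x & x <= 1 /\ (2 * l + 1) * x <= e.
  move=> e0; have k0 : 0 < 2 * l + 1 by lra.
  exists (Num.min 1 (e / (2 * l + 1))); first by rewrite lt_min ltr01 divr_gt0.
  by split; [rewrite ge_min lexx|rewrite mulrC -ler_pdivlMr// ge_min lexx orbT].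
apply: limn_esup_fin => e /del[x x0 [x1 xe]].
  apply: filterS2 wE (hu x x0) => n -> h.
  rewrite -(real_normK (num_real (u n))).
  apply: le_trans (_ : (l + x) ^+ 2 <= _); last by rewrite expr2; nra.
  by rewrite lerXn2r ?nnegrE//; lra.
move=> N; have [N0 _ w0] := wE; have [n] := hl x x0 (maxn N N0).
rewrite geq_max => /andP[Nn N0n] hn; exists n => //; rewrite w0//.
have [h|h] := leP l x; first by apply: le_trans (sqr_ge0 _); rewrite expr2; nra.
apply: le_trans (_ : (l - x) ^+ 2 <= _); first by rewrite !expr2; nra.
by rewrite lerXn2r ?nnegrE//; lra.
Qed.

(** Reduces a real tolerance to the countably many 1/(m+1), as almost sure statements demand. *)
Lemma eventually_of_inv (Q : R -> nat -> Prop) :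
  (forall e f n, e <= f -> Q e n -> Q f n) ->
  (forall m : nat, \forall n \near \oo, Q m.+1%:R^-1 n) ->
  forall e, 0 < e -> \forall n \near \oo, Q e n.
Proof.
move=> Q1 h e e0; have [m hm] : exists m : nat, m.+1%:R^-1 <= e.
  exists (Num.truncn e^-1); rewrite invf_ple ?posrE//; apply: ltW; exact: truncnS_gt.
by have := h m; apply: filterS => n; exact: Q1.
Qed.

End limsup.

(** * Transfer from the martingale to S_n/n *)

Section conclusion.
Context (R : realType) (d : measure_display) (T : measurableType d)
    (P : probability T R) (p q s : R)
    (alpha beta X : nat -> {RV P >-> R}) (U : nat -> {RV P >-> nat})
    (S : nat -> T -> R).
Hypotheses (hp : 0 <= p <= 1) (hq : 0 <= q <= 1) (hs : 0 <= s <= 1)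
    (hS : minimal_random_walk p q s alpha beta X U S)
    (ha : p - q = 1 / 2).

Let q_half := mrw_q_half hp hq ha.
Local Notation v := (mrw_var q).
Local Notation mart := (mart q).
Local Notation word := (word X).
Local Notation fluct t n := (Num.sqrt (lil_rate R n) * (S n t / n%:R - 2 * q)).

Lemma mrw_varE : 4 * q * (1 - p) = v.
Proof.
have -> : p = q + 1 / 2 by rewrite -ha addrC subrK.
by rewrite /mrw_var; field.
Qed.

Lemma mart_abs_le (e : R) : 0 < e -> {ae P, forall t, \forall n \near \oo,
  `|mart (word n t)| <= (Num.sqrt v + e) * Num.sqrt (lil_norm n)}.
Proof.
move=> e0; have s0 := sqrtr_ge0 v.
have /andP[v0 _] := mrw_var_itv q_half.
have k0 : 0 <= Num.sqrt v + e by lra.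
have vk : v < (Num.sqrt v + e) ^+ 2.
  by rewrite -{1}(sqr_sqrtr v0) ltrXn2r ?nnegrE//; lra.
apply: filterS (upper_lil hp hq hs hS ha vk) => t; apply: filterS => n h.
have -> : Num.sqrt v + e = Num.sqrt ((Num.sqrt v + e) ^+ 2) by rewrite sqrtr_sqr ger0_norm.
rewrite -sqrtrM ?sqr_ge0//.
by rewrite -sqrtr_sqr ler_wsqrtr.
Qed.

Lemma mart_ge (sg e : R) : `|sg| = 1 -> 0 < e -> {ae P, forall t N, exists2 n, (N <= n)%N &
  (Num.sqrt v - e) * Num.sqrt (lil_norm n) <= sg * mart (word n t)}.
Proof.
(* For v = 0 no k satisfies 0 <= k < v; the claim then follows from the upper bound on |M|. *)
move=> sg1 e0; have s0 := sqrtr_ge0 v; have [v0|v0] := leP v 0.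
  apply: filterS (mart_abs_le e0) => t [N0 _ h] N.
  exists (maxn N N0); first by rewrite leq_maxl.
  have := h (maxn N N0) (leq_maxr _ _); rewrite ler0_sqrtr// !add0r => {}h.
  rewrite mulNr lerNl; apply: le_trans h; apply: le_trans (ler_norm _) _.
  by rewrite normrN normrM sg1 mul1r.
pose k : R := Num.max 0 (Num.sqrt v - e); have k0 : 0 <= k by rewrite le_max lexx.
have sv : 0 < Num.sqrt v by rewrite sqrtr_gt0.
have kv : k ^+ 2 < v.
  rewrite -[ltRHS](sqr_sqrtr (ltW v0)) ltrXn2r ?nnegrE// gt_max sv; lra.
apply: filterS (lower_lil hp hq hs hS ha sg1 (sqr_ge0 k) kv) => t h N.
have [n Nn hn] := h N; exists n => //; apply: le_trans hn.
rewrite (sqrtrM _ (sqr_ge0 k)) sqrtr_sqr (ger0_norm k0).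
by rewrite ler_wpM2r ?sqrtr_ge0// le_max lexx orbT.
Qed.

Lemma sum_centered t n : (0 < n)%N -> S n t = (count id (word n t))%:R ->
  S n t / n%:R - 2 * q = centered q (word n t) / n%:R.
Proof.
move=> n0 ->; rewrite /centered size_word mulrBl mulfK//.
by rewrite pnatr_eq0 -lt0n.
Qed.

Lemma lil_rate_ge0 : \forall n \near \oo, 0 <= lil_rate R n.
Proof.
near=> n.
have l1 : 1 <= ln n%:R :> R by near: n; exact: ln_unbounded.
have l3 : 0 <= ln (ln (ln n%:R)) :> R by near: n; exact: lnlnln_unbounded.
rewrite /lil_rate; apply: divr_ge0 => //; apply: mulr_ge0 => //; lra.
Unshelve. all: by end_near. Qed.

(** [lil_rate] times [lil_norm] is (n a_n)^2, so bounds on M relative to its normalization are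
    exactly bounds on the rescaled fluctuation. *)
Lemma fluctE t : (forall n, S n t = (count id (word n t))%:R) ->
  \forall n \near \oo, fluct t n * Num.sqrt (lil_norm n) = mart (word n t).
Proof.
move=> St; near=> n; have n0 : (0 < n)%N by near: n; exact: nbhs_infty_gt.
have l1 : 1 <= ln n%:R :> R by near: n; exact: ln_unbounded.
have l3 : 1 <= ln (ln (ln n%:R)) :> R by near: n; exact: lnlnln_unbounded.
have r0 : 0 <= lil_rate R n by near: n; exact: lil_rate_ge0.
have np : n%:R != 0 :> R by rewrite pnatr_eq0 -lt0n.
have a0 : 0 < @mart_scale R n by exact: mart_scale_gt0.
rewrite (sum_centered n0 (St n)) mulrAC -sqrtrM//.
have -> : lil_rate R n * lil_norm n = (mart_scale n * n%:R) ^+ 2.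
  rewrite /lil_rate /lil_norm /scale_sq; field; apply/andP; split; lra.
rewrite sqrtr_sqr ger0_norm ?mulr_ge0 ?(ltW a0)//.
by rewrite martE size_word; field.
Unshelve. all: by end_near. Qed.

Lemma fluct_abs_le_ae : {ae P, forall t, forall e, 0 < e ->
  \forall n \near \oo, `|fluct t n| <= Num.sqrt v + e}.
Proof.
have h : {ae P, forall t, forall m : nat, \forall n \near \oo,
    `|mart (word n t)| <= (Num.sqrt v + m.+1%:R^-1) * Num.sqrt (lil_norm n)}.
  by apply: ae_foralln => m; apply: mart_abs_le; rewrite invr_gt0.
apply: filterS2 (sum_word_ae hp hq hs hS) h => t St h.
apply: (@eventually_of_inv R (fun e n => `|fluct t n| <= Num.sqrt v + e)).
  by move=> e f n ef /le_trans; apply; rewrite lerD2l.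
move=> m; near=> n.
have N0 : 0 < lil_norm n :> R by near: n; exact: lil_norm_gt0.
have fE : fluct t n * Num.sqrt (lil_norm n) = mart (word n t).
  by near: n; exact: fluctE.
have : `|mart (word n t)| <= (Num.sqrt v + m.+1%:R^-1) * Num.sqrt (lil_norm n).
  by near: n; exact: h.
by rewrite -fE normrM (ger0_norm (sqrtr_ge0 _)) ler_pM2r// sqrtr_gt0.
Unshelve. all: by end_near. Qed.

Lemma fluct_ge_ae (sg : R) : `|sg| = 1 -> {ae P, forall t, forall e, 0 < e ->
  forall N, exists2 n, (N <= n)%N & Num.sqrt v - e <= sg * fluct t n}.
Proof.
move=> sg1; have h : {ae P, forall t, forall m : nat, forall N, exists2 n, (N <= n)%N &
    (Num.sqrt v - m.+1%:R^-1) * Num.sqrt (lil_norm n) <= sg * mart (word n t)}.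
  by apply: ae_foralln => m; apply: mart_ge; rewrite ?invr_gt0.
apply: filterS2 (sum_word_ae hp hq hs hS) h => t St h e e0 N.
have [m hm] : exists m : nat, m.+1%:R^-1 <= e.
  exists (Num.truncn e^-1); rewrite invf_ple ?posrE//; apply: ltW; exact: truncnS_gt.
have [N1 _ h1] := fluctE St; have [N2 _ h2] := @lil_norm_gt0 R.
have [n] := h m (maxn N (maxn N1 N2)); rewrite !geq_max => /and3P[Nn N1n N2n] hn.
exists n => //; move: hn; rewrite -(h1 n N1n) mulrA ler_pM2r ?sqrtr_gt0 ?h2//.
by apply: le_trans; rewrite lerD2l lerN2.
Qed.

End conclusion.

Theorem theorem2p3 (R : realType) (d : measure_display) (T : measurableType d)
    (P : probability T R) (p q s : R)
    (alpha beta X : nat -> {RV P >-> R}) (U : nat -> {RV P >-> nat})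
    (S : nat -> T -> R)
    (hp : 0 <= p <= 1) (hq : 0 <= q <= 1) (hs : 0 <= s <= 1)
    (hS : minimal_random_walk p q s alpha beta X U S)
    (ha : p - q = 1 / 2) :
  [/\ {ae P, forall t, (fun n : nat => S n t / n%:R) @ \oo --> 2 * q},
      {ae P, forall t,
        limn_esup (fun n : nat =>
          (Num.sqrt (lil_rate R n) * (S n t / n%:R - 2 * q))%:E)
        = (Num.sqrt (4 * q * (1 - p)))%:E
        /\ (- limn_einf (fun n : nat =>
          (Num.sqrt (lil_rate R n) * (S n t / n%:R - 2 * q))%:E))%E
        = (Num.sqrt (4 * q * (1 - p)))%:E},
      {ae P, forall t,
        limn_esup (fun n : nat =>
          (lil_rate R n * (S n t / n%:R - 2 * q) ^+ 2)%:E)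
        = (4 * q * (1 - p))%:E} &
      {ae P, forall t,
        (fun n : nat => 1 / ln (ln n%:R) *
          \sum_(2 <= k < n.+1)
             (1 / ln k%:R) ^+ 2 * (S k t / k%:R - 2 * q) ^+ 2) @ \oo
        --> 4 * q * (1 - p)}].
Proof.
have q_half := mrw_q_half hp hq ha.
rewrite (mrw_varE ha); split.
- apply: filterS2 (sum_word_ae hp hq hs hS) (centered_cvg0_ae hp hq hs hS ha) => t St ct.
  rewrite -[2 * q]addr0; apply: cvg_trans (cvgD (cvg_cst _) ct).
  apply: near_eq_cvg; near=> n; have n0 : (0 < n)%N by near: n; exact: nbhs_infty_gt.
  by rewrite fctE/= -(sum_centered q n0 (St n)) addrC subrK.
- have n1 : `|-1| = 1 :> R by rewrite normrN normr1.
  apply: filterS3 (fluct_abs_le_ae hp hq hs hS ha)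
    (fluct_ge_ae hp hq hs hS ha (@normr1 R)) (fluct_ge_ae hp hq hs hS ha n1) => t hu h1 h2.
  (* The lower limit is by definition the opposite of the upper limit of the negated sequence, so
     the second claim is again an upper limit, fed by the sign -1. *)
  split; last (rewrite /limn_einf oppeK; under eq_fun do rewrite -EFinN).
    apply: limn_esup_fin => e e0.
      by apply: filterS (hu e e0) => n /(le_trans (ler_norm _)).
    by move=> N; have [n Nn hn] := h1 e e0 N; exists n => //; rewrite -[leRHS]mul1r.
  apply: limn_esup_fin => e e0.
    by apply: filterS (hu e e0) => n; apply: le_trans; rewrite -normrN ler_norm.
  by move=> N; have [n Nn hn] := h2 e e0 N; exists n => //; rewrite -[leRHS]mulN1r.
- apply: filterS2 (fluct_abs_le_ae hp hq hs hS ha)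
    (fluct_ge_ae hp hq hs hS ha (@normr1 R)) => t hu h1.
  have /andP[v0 _] := mrw_var_itv q_half.
  rewrite -[in RHS](sqr_sqrtr v0).
  apply: (@limn_esup_sqr _ _ (fun n => Num.sqrt (lil_rate R n) * (S n t / n%:R - 2 * q))) => //.
    by apply: filterS (@lil_rate_ge0 R) => n r0; rewrite exprMn sqr_sqrtr.
  by move=> e e0 N; have [n Nn hn] := h1 e e0 N; exists n => //; rewrite -[leRHS]mul1r.
- apply: filterS2 (sum_word_ae hp hq hs hS) (quadratic_law_ae hp hq hs hS ha) => t St.
  apply: cvg_trans; apply: near_eq_cvg; near=> n; congr (_ * _); apply: eq_big_nat => k /andP[k2 _].
  by rewrite (sum_centered q (ltnW k2) (St k)).
Unshelve. all: by end_near. Qed.
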